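(* If $\big(k,\ell,r,\delta,(n_0,u_0,\kappa_0,\lambda_0)\big)$ is a $p$-adic exponent datum, then so is $$\left(\ell-\frac12,\ k+\frac12,\ \tilde r,\ \tilde\delta,\ (\tilde n_0,\tilde u_0,\tilde\kappa_0,\tilde\lambda_0)\right),$$ where, denoting $\tilde\lambda=\min(\kappa-\rho_p(y),\lambda)$ and $\iota'=\iota'(y)$, $$\tilde r(y,p,\kappa,\lambda)=r(y^{-1},p,\kappa,\tilde\lambda),\qquad\tilde\delta=\delta+\delta_{01},$$ with $\delta_{01}=1$ if $(k,\ell)=(0,1)$ and $\delta_{01}=0$ otherwise, and \begin{align*} \tilde\kappa_0(y,p)&=\max\big(1+\iota'(4),\ \kappa_0(y^{-1},p),\ \lambda_0(y^{-1},p)+\rho_p(y)\big),\\ \tilde\lambda_0(y,p)&=\lambda_0(y^{-1},p),\\ \tilde n_0(y,p,\kappa,\lambda)&=\max\big(\kappa+\iota'+1+\iota'(12),\ \mathrm{ord}_py+n_0(y^{-1},p,\kappa,\tilde\lambda)\big),\\ \tilde u_0(y,p,\kappa,\lambda)&=\max\big(\kappa-\lfloor\lambda\rfloor+\iota'+1,\ \mathrm{ord}_py+u_0(y^{-1},p,\kappa,\tilde\lambda)+\lceil\tilde\lambda\rceil-\lfloor\lambda\rfloor,\ 1\big) \end{align*} (if $\tilde\kappa_0(y,p)$ is not an integer it is to be rounded up).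
   Context: Notation. $\mathbb N=\{1,2,\dots\}$, $\mathbb Q^+$ is the set of positive rationals, $\mathbb R^+_0=[0,\infty)$, $P$ is the set of primes. For a prime $p$: $\rho_p=1/(p-1)$; $e(x)=e^{2\pi i x}$, also extended from $\mathbb Z[1/p]$ to the unique $\mathbb Z_p$-periodic function on $\mathbb Q_p$. For $y\in\mathbb Q^+$: $\iota(y)=\max(0,-\mathrm{ord}_p y)$, $\iota'(y)=\max(0,\mathrm{ord}_p y)$ (these depend on $p$); $\iota,\iota'$ stand for $\iota(y),\iota'(y)$ when $y$ is clear. $\rho_p(y)=\rho_p$ if $\mathrm{ord}_py\ne0$, and $\rho_p(y)=0$ otherwise. Power series. $\mathbf I_0(\mathbb Z_p)$ is the set of power series $\sum_{k\ge0}a_kt^k$ with $a_k\in\mathbb Z_p$ and $|a_k|_p\to0$; for real $\lambda\ge 0$, $\mathbf I_0[\lambda](\mathbb Z_p)=\{a\in\mathbf I_0(\mathbb Z_p):\mathrm{ord}_pa_k\ge\lceil k\lambda\rceil\ \forall k\ge0\}$. $(1+x)^y=\sum_k\binom yk x^k$. Class $\mathbf F$. Let $w\in\mathbb Z$, $u,\kappa\in\mathbb N$ with $\kappa\ge1+\iota'(2)$, $\lambda\in\rho_p\mathbb N$, $y\in\mathbb Q^+$, $\omega,\omega'\in\mathbb Z_p^\times$. A power series $f\in\mathbb Q_p^\times\mathbf I_0(\mathbb Z_p)$ belongs to $\mathbf F(w,y,\kappa,\lambda,u,\omega,\omega')$ if $$f'(t)=p^w\omega'(1+p^{\iota+\kappa}\omega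 t)^{-y}+p^w\gamma_0+p^{u+w}g(t)$$ for some $\gamma_0\in\mathbb Z_p$ and $g\in\mathbf I_0[\lambda](\mathbb Z_p)$. $f\in\mathbf F(w,y,\kappa,\lambda,u)$ means $f\in\mathbf F(w,y,\kappa,\lambda,u,\omega,\omega')$ for some $\omega,\omega'\in\mathbb Z_p^\times$. Parameter functions. For a set $Y$, $\mathbf J(Y)$ is the set of functions $g:\mathbb Q^+\times P\to Y$ such that for every $y$ there are a finite $P_0(y)\subset P$ and a function $g_0:P\setminus P_0(y)\to Y$ with $g(y,p)=g_0(p)$ for all $p\in P\setminus P_0(y)$. Similarly $\mathbf J_1(Y)$ is the set of functions $g(y,p,\kappa,\lambda)\in Y$ defined for $y\in\mathbb Q^+$, $p\in P$, $\kappa\in\iota'(2)+\mathbb N$, $\lambda\in\rho_p\mathbb N$, such that for every $y$ there are a finite $P_0(y)\subset P$ and a function $g_0$ on $(P\setminus P_0(y))\times X$, $X=\mathbb N\times\mathbb R^+$, with $g(y,p,\kappa,\lambda)=g_0(p,\kappa,\lambda)$ for all $p\in P\setminus P_0(y)$ and all admissible $\kappa,\lambda$. $p$-adic exponent data. Let $q=(k,\ell,r,\delta,(n_0,u_0,\kappa_0,\lambda_0))$ with $k,\ell\in\mathbb R$, $0\le k\le\frac12\le\ell\le1$, $r\in\mathbf J_1(\mathbb R)$, $\delta\in\mathbb R_0^+$, $n_0,u_0\in\mathbf J_1(\mathbb N)$, $\kappa_0\in\mathbf J(\mathbb N)$, $\lambda_0\in\mathbf J(\mathbb R_0^+)$,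 and $n_0(y,p,\kappa,\lambda)>\kappa+\iota'(y)$. Such $q$ is a $p$-adic exponent datum if, for every $p\in P$, $y\in\mathbb Q^+$, $w\in\mathbb Z$, $\kappa\in\mathbb N$ with $\kappa\ge1+\iota'(2)$, $\lambda\in\rho_p\mathbb N$, $n,u\in\mathbb N$ with $$\kappa\ge\kappa_0(y,p),\quad\lambda\ge\lambda_0(y,p),\quad n\ge w+n_0(y,p,\kappa,\lambda),\quad u\ge u_0(y,p,\kappa,\lambda),$$ and for every $f\in\mathbf F(w,y,\kappa,\lambda,u)$, $M\in\mathbb Z$, and $0<B\le p^{n-w-\kappa-\iota'}$, $$\sum_{M<m\le M+B}e\left(\frac{f(m)}{p^n}\right)\ll p^{r}\left(\frac{p^{n-w-\kappa-\iota'}}B\right)^kB^{\ell}\big(\log p^{n-w-\kappa-\iota'}\big)^{\delta},$$ where $r=r(y,p,\kappa,\lambda)$ and the implied constant depends only on the datum $q$. *)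

(* Defs.v *)
(* MathComp + MathComp-Analysis; complex numbers from mathcomp-real-closed. *)
From HB Require Import structures.
From mathcomp Require Import all_boot all_order all_algebra fraction.
From mathcomp Require Import all_classical all_reals all_analysis.
From mathcomp Require Import complex.

Set Implicit Arguments.
Unset Strict Implicit.
Unset Printing Implicit Defensive.

Import Order.TTheory GRing.Theory Num.Theory.
Import numFieldNormedType.Exports.

Local Open Scope ring_scope.
Local Open Scope classical_set_scope.

Record prime_number := PrimeNumber {
  prime_val :> nat;
  prime_valP : prime prime_val }.

(* Z_p as the inverse limit of the Z/p^n: [x n] is the representative of x
   modulo p^n in [0, p^n), which the coherence equation already enforces. *)
Definition zp_coherent (p : nat) (x : nat -> int) : Prop :=
  forall n, x n = (x n.+1 %% (p ^ n)%:Z)%Z.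

Record padic_int (p : prime_number) := PadicInt {
  zp_res :> nat -> int;
  zp_resP : zp_coherent p zp_res }.

HB.instance Definition _ p := gen_eqMixin (padic_int p).
HB.instance Definition _ p := gen_choiceMixin (padic_int p).

Lemma modz_expnS (p n : nat) (a : int) :
  ((a %% (p ^ n.+1)%:Z)%Z = a %[mod (p ^ n)%:Z])%Z.
Proof.
by rewrite [in RHS](divz_eq a (p ^ n.+1)%:Z) expnS PoszM mulrA modzMDl.
Qed.

Section PadicIntRing.
Variable p : prime_number.
Local Notation Zp := (padic_int p).
Implicit Types x y z : Zp.

Lemma zp_eq x y : (forall n, x n = y n) -> x = y.
Proof.
case: x y => [x xP] [y yP] /= /funext xy; case: y / xy yP => yP.
by congr PadicInt; exact: Prop_irrelevance.
Qed.

Lemma zp_mod x m n : (m <= n)%N -> (x n = x m %[mod (p ^ m)%:Z])%Z.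
Proof.
move=> /subnK <-; elim: (n - m)%N => [//|k IH]; rewrite -IH addSn.
rewrite [x (k + m)%N]zp_resP.
rewrite [in LHS](divz_eq (x (k + m).+1) (p ^ (k + m))%:Z).
by rewrite {2}expnD PoszM mulrA modzMDl.
Qed.

Lemma zp_small x n : (x n %% (p ^ n)%:Z)%Z = x n.
Proof. by rewrite [in LHS]zp_resP modz_mod -zp_resP. Qed.

Fact zp_of_subproof (x : nat -> int) :
  (forall n, (x n.+1 = x n %[mod (p ^ n)%:Z])%Z) ->
  zp_coherent p (fun n => (x n %% (p ^ n)%:Z)%Z).
Proof.
by move=> xP n; rewrite modz_expnS xP.
Qed.

Definition zp_of (x : nat -> int)
    (xP : forall n, (x n.+1 = x n %[mod (p ^ n)%:Z])%Z) : Zp :=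
  PadicInt (zp_of_subproof xP).

Fact zp_const_subproof (a : int) n : (a = a %[mod (p ^ n)%:Z])%Z.
Proof. by []. Qed.
Definition zp_const a := @zp_of (fun=> a) (zp_const_subproof a).

Fact zp_opp_subproof x n : (- x n.+1 = - x n %[mod (p ^ n)%:Z])%Z.
Proof. by rewrite -modzNm zp_mod // modzNm. Qed.
Definition zp_opp x := @zp_of (fun n => - x n) (zp_opp_subproof x).

Fact zp_add_subproof x y n :
  (x n.+1 + y n.+1 = x n + y n %[mod (p ^ n)%:Z])%Z.
Proof. by rewrite -modzDm !(@zp_mod _ n n.+1) // modzDm. Qed.
Definition zp_add x y := @zp_of (fun n => x n + y n) (zp_add_subproof x y).

Fact zp_mul_subproof x y n :
  (x n.+1 * y n.+1 = x n * y n %[mod (p ^ n)%:Z])%Z.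
Proof. by rewrite -modzMm !(@zp_mod _ n n.+1) // modzMm. Qed.
Definition zp_mul x y := @zp_of (fun n => x n * y n) (zp_mul_subproof x y).

Fact zp_addA : associative zp_add.
Proof. by move=> x y z; apply: zp_eq => n /=; rewrite modzDmr modzDml addrA. Qed.
Fact zp_addC : commutative zp_add.
Proof. by move=> x y; apply: zp_eq => n /=; rewrite addrC. Qed.
Fact zp_add0 : left_id (zp_const 0) zp_add.
Proof. by move=> x; apply: zp_eq => n /=; rewrite mod0z add0r zp_small. Qed.
Fact zp_addN : left_inverse (zp_const 0) zp_opp zp_add.
Proof. by move=> x; apply: zp_eq => n /=; rewrite modzDml addNr. Qed.

HB.instance Definition _ :=
  GRing.isZmodule.Build Zp zp_addA zp_addC zp_add0 zp_addN.

Fact zp_mulA : associative zp_mul.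
Proof. by move=> x y z; apply: zp_eq => n /=; rewrite modzMmr modzMml mulrA. Qed.
Fact zp_mulC : commutative zp_mul.
Proof. by move=> x y; apply: zp_eq => n /=; rewrite mulrC. Qed.
Fact zp_mul1 : left_id (zp_const 1) zp_mul.
Proof. by move=> x; apply: zp_eq => n /=; rewrite modzMml mul1r zp_small. Qed.
Fact zp_mulD : left_distributive zp_mul zp_add.
Proof.
by move=> x y z; apply: zp_eq => n /=; rewrite modzMml modzDm mulrDl.
Qed.
Fact zp_one_neq0 : zp_const 1 != 0 :> Zp.
Proof.
apply/eqP => /(congr1 (fun x : Zp => x 1%N)) /=.
have p1 : (1 < p)%N := prime_gt1 (prime_valP p).
by rewrite expn1 mod0z modz_small // lez_nat /= ltz_nat p1.
Qed.

HB.instance Definition _ := GRing.Zmodule_isComNzRing.Build Zp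
  zp_mulA zp_mulC zp_mul1 zp_mulD zp_one_neq0.

Definition zp_unit : {pred Zp} := [pred x | `[< exists y, y * x = 1 >]].
Definition zp_inv x : Zp :=
  if x \in zp_unit then xget 0 [set y | y * x = 1] else x.

Fact zp_mulV : {in zp_unit, left_inverse 1 zp_inv *%R}.
Proof.
move=> x ux; rewrite /zp_inv ux; move/asboolP: ux => xV.
by case: xgetP => [y _ //|nV]; case: xV => y /nV.
Qed.
Fact zp_unitP x y : y * x = 1 -> zp_unit x.
Proof. by move=> yx; apply/asboolP; exists y. Qed.
Fact zp_inv_out : {in [predC zp_unit], zp_inv =1 id}.
Proof. by move=> x /= nx; rewrite /zp_inv (negPf nx). Qed.

HB.instance Definition _ :=
  GRing.ComNzRing_hasMulInverse.Build Zp zp_mulV zp_unitP zp_inv_out.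

Lemma zp_neq0 x : x != 0 -> exists n, x n != 0.
Proof.
move=> x0; apply: contrapT => xn; move/eqP: x0; apply; apply: zp_eq => n /=.
by rewrite mod0z; apply/eqP/negPn/negP => xn0; apply: xn; exists n.
Qed.

Fact zp_mul_eq0 x y : x * y = 0 -> (x == 0) || (y == 0).
Proof.
move=> xy0; apply: contrapT => /negP; rewrite negb_or.
case/andP => /zp_neq0 [a xa] /zp_neq0 [b yb].
have pP := prime_valP p.
have ndvd z c m : (c <= m)%N -> z c != 0 -> ~~ (p ^ c %| `|z m|)%N.
  move=> cm; apply: contra => dv.
  have /dvdz_mod0P zc : ((p ^ c)%:Z %| z m)%Z by rewrite dvdzE.
  by rewrite -(zp_small z c) -(zp_mod z cm) zc.
have xN := ndvd x _ _ (leq_addr b a) xa.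
have yN := ndvd y _ _ (leq_addl a b) yb.
have gt0 c (z : nat) : ~~ (p ^ c %| z)%N -> (0 < z)%N by case: z => //; rewrite dvdn0.
have /(congr1 (fun z : Zp => z (a + b)%N)) /= := xy0.
rewrite mod0z => /dvdz_mod0P; rewrite dvdzE /= abszM.
have [x0 y0] := (gt0 _ _ xN, gt0 _ _ yN); move: xN yN.
rewrite !pfactor_dvdn ?muln_gt0 ?x0 // lognM // -!ltnNge => xa' yb'.
by rewrite leqNgt -addnS leq_add // ltnW.
Qed.

HB.instance Definition _ :=
  GRing.ComUnitRing_isIntegral.Build Zp zp_mul_eq0.

End PadicIntRing.

Notation padic p := {fraction (padic_int p)}.

Section PadicAnalysis.
Variables (R : realType) (p : prime_number).
Local Notation Zp := (padic_int p).
Local Notation Qp := (padic p).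

Definition zp_inj (x : Zp) : Qp := tofrac x.

Definition padic_ord (x : Qp) : \bar int :=
  if x == 0 then +oo%E else
  (xget 0 [set m : int | exists2 u : Zp,
     u \is a GRing.unit & x = p%:R ^ m * zp_inj u])%:E.

Definition padic_norm (x : Qp) : R :=
  if padic_ord x is m%:E%E then p%:R ^ (- m) else 0.

Definition padic_cvg (u : nat -> Qp) (l : Qp) : Prop :=
  (fun n => padic_norm (u n - l)) @ \oo --> (0 : R).

(* Power series are coefficient sequences; a divergent series has value 0. *)
Definition pseries_eval (f : nat -> Qp) (x : Qp) : Qp :=
  xget 0 [set l | padic_cvg (fun n => \sum_(k < n) f k * x ^+ k) l].

Definition pseries_deriv (f : nat -> Qp) (k : nat) : Qp := f k.+1 *+ k.+1.

Definition I0 (a : nat -> Zp) : Prop :=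
  (fun k => padic_norm (zp_inj (a k))) @ \oo --> (0 : R).

Definition I0_ (lambda : R) (a : nat -> Zp) : Prop :=
  I0 a /\
  forall k, ((Num.ceil (k%:R * lambda))%:E <= padic_ord (zp_inj (a k)))%E.

Definition gbinom (y : rat) (k : nat) : rat :=
  \prod_(j < k) ((y - j%:R) / j.+1%:R).

(* coefficients of (1 + c t)^y *)
Definition pseries_pow (c : Qp) (y : rat) (k : nat) : Qp :=
  ratr (gbinom y k) * c ^+ k.

Definition e (x : R) : R[i] := Complex (cos (2 * pi * x)) (sin (2 * pi * x)).

(* some r in Z[1/p] with x in r + Z_p; it is unique modulo Z *)
Definition padic_frac (x : Qp) : rat :=
  xget 0 [set r : rat |
    (exists (a : int) (N : nat), r = a%:~R / p%:R ^+ N) /\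
    (exists z : Zp, x = ratr r + zp_inj z)].

Definition padic_e (x : Qp) : R[i] := e (ratr (padic_frac x)).

Definition ordq (y : rat) : int :=
  (logn p `|numq y|)%:Z - (logn p `|denq y|)%:Z.

Definition iotam (y : rat) : int := Num.max 0 (- ordq y).
Definition iotap (y : rat) : int := Num.max 0 (ordq y).

Definition rho : R := (p%:R - 1)^-1.
Definition rho_at (y : rat) : R := if ordq y != 0 then rho else 0.

Definition classF_with (w : int) (y : rat) (kappa : nat) (lambda : R) (u : nat)
    (omega omega' : Zp) (f : nat -> Qp) : Prop :=
  (exists (c : Qp) (a : nat -> Zp),
     [/\ c != 0, I0 a & forall k, f k = c * zp_inj (a k)]) /\
  (exists (gamma0 : Zp) (g : nat -> Zp), I0_ lambda g /\
     forall k, pseries_deriv f k =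
       p%:R ^ w * zp_inj omega' *
         pseries_pow (p%:R ^ (iotam y + kappa%:Z) * zp_inj omega) (- y) k
       + (if k == 0%N then p%:R ^ w * zp_inj gamma0 else 0)
       + p%:R ^ (u%:Z + w) * zp_inj (g k)).

Definition classF (w : int) (y : rat) (kappa : nat) (lambda : R) (u : nat)
    (f : nat -> Qp) : Prop :=
  exists omega omega' : Zp,
    [/\ omega \is a GRing.unit, omega' \is a GRing.unit &
        classF_with w y kappa lambda u omega omega' f].

(* kappa in iota'(2) + N and lambda in rho_p N, where N = {1, 2, ...} *)
Definition admissible (kappa : nat) (lambda : R) : Prop :=
  1 + iotap 2 <= kappa%:Z /\ exists2 j : nat, (0 < j)%N & lambda = j%:R * rho.

End PadicAnalysis.

Section ParameterFunctions.
Variable R : realType.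

(* Functions that, for each y, agree for almost all p with a function g0 not
   involving y.  If [shared] is false, g0 is chosen after y, so that only the
   condition on the values has content; if it is true, the same g0 serves
   every y.  Results on exponent data are stated for both values. *)
Definition J (shared : bool) (T : Type) (Y : set T)
    (g : rat -> prime_number -> T) : Prop :=
  let agree (y : rat) (g0 : prime_number -> T) :=
    exists P0 : set prime_number, finite_set P0 /\
      forall p, ~ P0 p -> g y p = g0 p in
  (forall y p, 0 < y -> Y (g y p)) /\
  (if shared then exists g0, forall y, 0 < y -> agree y g0
   else forall y, 0 < y -> exists g0, agree y g0).

(* Only the values at admissible (kappa, lambda) matter. *)
Definition J1 (shared : bool) (T : Type) (Y : set T)
    (g : rat -> prime_number -> nat -> R -> T) : Prop :=
  let agree (y : rat) (g0 : prime_number -> nat -> R -> T) :=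
    exists P0 : set prime_number, finite_set P0 /\
      forall p kappa lambda, ~ P0 p -> admissible p kappa lambda ->
        g y p kappa lambda = g0 p kappa lambda in
  (forall y p kappa lambda, 0 < y -> admissible p kappa lambda ->
     Y (g y p kappa lambda)) /\
  (if shared then exists g0, forall y, 0 < y -> agree y g0
   else forall y, 0 < y -> exists g0, agree y g0).

Definition posint : set int := [set n | 0 < n].

(* The summation index is m = M + j with 1 <= j <= floor B. *)
Definition padic_exponent_datum (shared : bool) (k l : R)
    (r : rat -> prime_number -> nat -> R -> R) (delta : R)
    (n0 u0 : rat -> prime_number -> nat -> R -> int)
    (kappa0 : rat -> prime_number -> int)
    (lambda0 : rat -> prime_number -> R) : Prop :=
  [/\ 0 <= k <= 2^-1, 2^-1 <= l <= 1 & 0 <= delta] /\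
  [/\ J1 shared setT r, J1 shared posint n0, J1 shared posint u0,
      J shared posint kappa0 & J shared [set x | 0 <= x] lambda0] /\
  (forall y p kappa lambda, 0 < y -> admissible p kappa lambda ->
     kappa%:Z + iotap p y < n0 y p kappa lambda) /\
  exists C : R,
    forall (p : prime_number) (y : rat) (w : int) (kappa : nat) (lambda : R)
      (n u : nat),
    0 < y -> admissible p kappa lambda -> (0 < n)%N -> (0 < u)%N ->
    kappa0 y p <= kappa%:Z -> lambda0 y p <= lambda ->
    w + n0 y p kappa lambda <= n%:Z -> u0 y p kappa lambda <= u%:Z ->
    forall (f : nat -> padic p) (M : int) (B : R),
    classF w y kappa lambda u f ->
    let X : R := p%:R ^ (n%:Z - w - kappa%:Z - iotap p y) in
    0 < B <= X ->
    ComplexField.Normc.normc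
      (\sum_(1 <= j < (Num.truncn B).+1)
         padic_e R (pseries_eval R f (M + j%:Z)%:~R / p%:R ^+ n))
    <= C * p%:R `^ (r y p kappa lambda) * (X / B) `^ k * B `^ l
         * (ln X) `^ delta.

Definition lambda_tilde (y : rat) (p : prime_number) (kappa : nat)
    (lambda : R) : R :=
  Num.min (kappa%:R - rho_at R p y) lambda.

End ParameterFunctions.

(* Main.v *)
(* Put X = p^s with s = n - w - kappa - iota'.  Up to a constant of modulus one, e(f(m)/p^n)
   is a linear phase e(beta m/X) times an X-periodic function phi(m).  By p-adic stationary
   phase, the Fourier coefficient of phi at h is a constant of modulus sqrt X times
   c(h) = e(f~(h)/p^n), where f~ is the Legendre dual of f: its derivative is minus the
   inverse function of f', normalised.  The inverse of (1 + t)^(-y) - 1 is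
   (1 + t)^(-1/y) - 1, so f~ lies in the class F for 1/y, and it stays there after adding
   any integral linear term.  Fourier inversion turns the sum over M < m <= M + B into
   X^(-1/2) times the sum over h in a window of length X around -beta of c(h) times a
   geometric sum in (h + beta)/X.  Summation by parts against the bound for 1/y shows that
   the frequencies with |h + beta| <= X/B dominate; the others contribute the tail of
   H^(l - k - 2), with a loss of a logarithm exactly when (k, l) = (0, 1). *)
Require Import Defs.
From mathcomp Require Import all_boot all_order all_algebra fraction.
From mathcomp Require Import generic_quotient.
From mathcomp Require Import all_classical all_reals all_analysis.
From mathcomp Require Import complex zify ring lra.
Set Implicit Arguments.
Unset Strict Implicit.
Unset Printing Implicit Defensive.
Import Order.TTheory GRing.Theory Num.Theory.
Import numFieldNormedType.Exports.
Local Open Scope ring_scope.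

(** * The p-adic integers and the p-adic valuation *)

(** The modulus of [G] is never computed. Once all Fourier coefficients are [G] times numbers of
    modulus one, inversion and Parseval force |G|^2 = X; stationary phase only has to show that the
    local quadratic sum does not depend on h, whatever p and the parity of s.

    Integral linear terms must be allowed in the dual series because, with b the integer part of B
    and z = e((h + beta)/X), the geometric sum over M < m <= M + b is (z^(M + b) - z^M) z / (z - 1):
    summation by parts needs the bound for 1/y twisted by the linear phases M and M + b.

    The p-adic obstacle is that inverting and integrating series costs denominators. All orders are
    measured against a slope: coefficient j has order at least c + j la, a Gauss norm that survives
    products, composition and Newton steps. The slope la = min(kappa - rho_p(y), lambda) is common
    to the binomial series, where k! costs at most (k - 1) rho, and to the error term. The numbers 4
    and 12 in the new data pay for the denominators 2 and 3 in Taylor's formula. *)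

Section PadicIntegers.
Variable p : prime_number.
Local Notation Zp := (padic_int p).
Local Notation Qp := (padic p).

Let p_gt0 : (0 < p)%N. Proof. exact: prime_gt0 (prime_valP p). Qed.
Let p_gt1 : (1 < p)%N. Proof. exact: prime_gt1 (prime_valP p). Qed.
Let pn_neq0 n : (p ^ n)%:Z != 0.
Proof. by rewrite eqz_nat -lt0n expn_gt0 p_gt0. Qed.

Lemma zp_addE (x y : Zp) n : (x + y) n = ((x n + y n) %% (p ^ n)%:Z)%Z.
Proof. by []. Qed.
Lemma zp_oppE (x : Zp) n : (- x) n = ((- x n) %% (p ^ n)%:Z)%Z.
Proof. by []. Qed.
Lemma zp_mulE (x y : Zp) n : (x * y) n = ((x n * y n) %% (p ^ n)%:Z)%Z.
Proof. by []. Qed.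
Lemma zp_oneE n : (1 : Zp) n = (1 %% (p ^ n)%:Z)%Z.
Proof. by []. Qed.
Lemma zp_zeroE n : (0 : Zp) n = 0.
Proof. by rewrite /= mod0z. Qed.

Lemma zp_intE (a : int) n : (a%:~R : Zp) n = (a %% (p ^ n)%:Z)%Z.
Proof.
have natE (m : nat) : ((m : int)%:~R : Zp) n = (m %% (p ^ n)%:Z)%Z.
  elim: m => [|m IH]; first by rewrite mulr0z zp_zeroE mod0z.
  by rewrite -addn1 PoszD rmorphD zp_addE IH zp_oneE modzDm.
case: a => m; first exact: natE.
by rewrite NegzE rmorphN zp_oppE natE modzNm.
Qed.

Lemma zp_resB (x : Zp) n : exists y, x = (x n)%:~R + p%:R ^+ n * y.
Proof.
pose y i := ((x (n + i)%N - x n) %/ (p ^ n)%:Z)%Z.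
have dv i : ((p ^ n)%:Z %| x (n + i)%N - x n)%Z.
  by rewrite -eqz_mod_dvd; apply/eqP; rewrite zp_mod // leq_addr.
have yE i : x (n + i)%N = x n + y i * (p ^ n)%:Z by rewrite divzK //; ring.
have yP i : (y i.+1 = y i %[mod (p ^ i)%:Z])%Z.
  apply/eqP; rewrite eqz_mod_dvd -(dvdz_mul2l (pn_neq0 n)).
  rewrite -PoszM -expnD mulrBr.
  rewrite [X in (_ %| X)%Z](_ : _ = x (n + i.+1)%N - x (n + i)%N); last by rewrite !yE; ring.
  by rewrite -eqz_mod_dvd; apply/eqP; rewrite zp_mod // leq_add2l.
exists (zp_of yP); apply: zp_eq => i.
rewrite -natrX pmulrn zp_addE zp_mulE !zp_intE /=.
rewrite modzMm modzDm -[LHS]zp_small -(zp_mod x (leq_addl n i)) yE.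
by rewrite [y i * _]mulrC.
Qed.

(** The inverse is assembled from Bezout coefficients modulo each p^n; these are coherent because an
    inverse modulo p^n is unique. *)
Lemma zp_unitE (x : Zp) : (x \is a GRing.unit) = (x 1%N != 0).
Proof.
apply/idP/idP => [|x1].
  move=> ux; have /(congr1 (fun z : Zp => z 1%N)) := mulrV ux.
  rewrite zp_mulE zp_oneE; apply: contra_eq_neq => ->.
  rewrite mul0r mod0z expn1 eq_sym modz_small ?ltz_nat //.
have cop n : coprimez (x n) (p ^ n)%:Z.
  case: n => [|n]; first by rewrite coprimezE coprimen1.
  rewrite coprimezE coprime_pexpr // coprime_sym prime_coprime ?prime_valP //.
  apply/negP => dv; move/eqP: x1; apply.
  rewrite -(zp_small x 1) -(@zp_mod _ x 1 n.+1) // expn1.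
  by apply/dvdz_mod0P; rewrite dvdzE.
pose y n := (egcdz (x n) (p ^ n)%:Z).1.
have yE n : (y n * x n = 1 %[mod (p ^ n)%:Z])%Z.
  rewrite /y; case: egcdzP => a b ab _ /=.
  move/eqP: (cop n) ab => -> <-.
  by rewrite addrC modzMDl.
have yP n : (y n.+1 = y n %[mod (p ^ n)%:Z])%Z.
  have h : (y n.+1 * x n = 1 %[mod (p ^ n)%:Z])%Z.
    rewrite -modzMmr -(@zp_mod _ x n n.+1) // modzMmr -modz_expnS yE modz_expnS //.
  rewrite -[y n.+1]mulr1 -modzMmr -(yE n) modzMmr mulrCA -modzMmr h modzMmr mulr1 //.
apply/asboolP; exists (zp_of yP); apply: zp_eq => n.
by rewrite zp_mulE zp_oneE /= modzMml yE.
Qed.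

Lemma zp_natr_neq0 n : (0 < n)%N -> n%:R != 0 :> Zp.
Proof.
move=> n0; apply/eqP => /(congr1 (fun z : Zp => z n)).
rewrite zp_zeroE pmulrn zp_intE modz_small; first by case: n n0.
by rewrite lez_nat ltz_nat ltn_expl.
Qed.

Lemma zp_factor (x : Zp) : x != 0 ->
  exists n u, u \is a GRing.unit /\ x = p%:R ^+ n * u.
Proof.
move=> /zp_neq0 ex; case: (ex_minnP ex) => -[|n]; first by rewrite -zp_small modz1.
move=> xn min; have [u xE] := zp_resB x n.
have x0 : x n = 0 by apply/eqP/negPn/negP => /min; rewrite ltnn.
exists n, u; split; last by rewrite {1}xE x0 add0r.
rewrite zp_unitE; apply: contra xn => /eqP u1.
have [v uE] := zp_resB u 1.
move: uE xE; rewrite u1 x0 !add0r expr1 => -> ->.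
by rewrite mulrA -exprSr zp_mulE -natrX pmulrn zp_intE modzz mul0r mod0z.
Qed.

Lemma zp_inj0 (x : Zp) : (zp_inj x == 0) = (x == 0).
Proof. by rewrite /zp_inj tofrac_eq0. Qed.

Lemma zp_injD : {morph @zp_inj p : x y / x + y}. Proof. exact: tofracD. Qed.
Lemma zp_injB : {morph @zp_inj p : x y / x - y}. Proof. exact: tofracB. Qed.
Lemma zp_injN : {morph @zp_inj p : x / - x}. Proof. exact: tofracN. Qed.
Lemma zp_injM : {morph @zp_inj p : x y / x * y}. Proof. exact: tofracM. Qed.
Lemma zp_inj_nat n : zp_inj (n%:R : Zp) = n%:R. Proof. exact: (rmorph_nat (@FracField.tofrac Zp)). Qed.
Lemma zp_inj_int (n : int) : zp_inj (n%:~R : Zp) = n%:~R. Proof. exact: (rmorph_int (@FracField.tofrac Zp)). Qed.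
Lemma zp_inj_expp n : zp_inj (p%:R ^+ n : Zp) = p%:R ^+ n.
Proof. by rewrite /zp_inj tofracXn; congr (_ ^+ _); exact: zp_inj_nat. Qed.

Lemma zp_inj_inj : injective (@zp_inj p).
Proof. move=> x y /eqP; rewrite /zp_inj tofrac_eq => /eqP //. Qed.

Lemma qp_natr_neq0 n : (0 < n)%N -> n%:R != 0 :> Qp.
Proof. by move=> n0; rewrite -(rmorph_nat (@FracField.tofrac Zp)) tofrac_eq0 zp_natr_neq0. Qed.

Lemma qp_p_neq0 : p%:R != 0 :> Qp. Proof. exact: qp_natr_neq0. Qed.
Lemma qp_quot (x : Qp) : exists a b : Zp, b != 0 /\ x = zp_inj a / zp_inj b.
Proof.
set r := repr x; have rE : (\pi_(padic p) r)%qT = x by rewrite /r reprK.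
exists (fraction.frac r).1, (fraction.frac r).2; split; first exact: denom_ratioP.
rewrite -rE /zp_inj; unlock FracField.tofrac.
rewrite -[X in _ = _ * X]FracField.pi_inv -[RHS]FracField.pi_mul.
have d0 := denom_ratioP r.
rewrite /FracField.mulf /FracField.invf /= !numden_Ratio ?oner_neq0 //.
by rewrite mulr1 mul1r Ratio_numden.
Qed.

Lemma qp_factor (x : Qp) : x != 0 ->
  exists (m : int) (u : Zp), u \is a GRing.unit /\ x = p%:R ^ m * zp_inj u.
Proof.
have [a [b [b0 ->]]] := qp_quot x; rewrite mulf_eq0 negb_or zp_inj0 => /andP[a0 _].
have [i [u [uu ->]]] := zp_factor a0; have [j [v [uv ->]]] := zp_factor b0.
exists (i%:Z - j%:Z), (u / v); split; first by rewrite unitrM uu unitrV.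
rewrite /zp_inj !rmorphM !rmorphXn /= rmorph_nat rmorphV //= invfM expfzDr ?qp_p_neq0 // -exprnP.
by rewrite -exprnN; ring.
Qed.

End PadicIntegers.

Section Valuation.
Variables (R : realType) (p : prime_number).
Local Notation Zp := (padic_int p).
Local Notation Qp := (padic p).
Implicit Types (c d : R) (x y : Qp).

Let p_gt0 : (0 < p)%N. Proof. exact: prime_gt0 (prime_valP p). Qed.
Let p_gt1 : (1 < p)%N. Proof. exact: prime_gt1 (prime_valP p). Qed.
Let pr0 := @qp_p_neq0 p.

(* ord_p x >= c for a real bound c, stated so that x = 0 needs no case distinction *)
Definition vge c x : Prop :=
  exists (m : int) (z : Zp), c <= m%:~R /\ x = p%:R ^ m * zp_inj z.

Lemma vge_le c d x : c <= d -> vge d x -> vge c x.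
Proof. by move=> cd [m [z [dm ->]]]; exists m, z; rewrite (le_trans cd dm). Qed.

Lemma vge_intP (m : int) x : vge m%:~R x <-> exists z, x = p%:R ^ m * zp_inj z.
Proof.
split=> [[n [z [mn ->]]]|[z ->]]; last by exists m, z.
move: mn; rewrite ler_int -subr_ge0 => mn.
exists (p%:R ^+ `|n - m|%N * z).
rewrite /zp_inj rmorphM rmorphXn /= rmorph_nat mulrA; congr (_ * _).
by rewrite exprnP -expfzDr //; congr (_ ^ _); lia.
Qed.

(** Orders are integers, so a real lower bound above m - 1 is as good as m. This is how the
    estimates with fractional slopes in rho are turned into congruences. *)
Lemma vge_ceil c (m : int) x : m%:~R - 1 < c -> vge c x -> vge m%:~R x.
Proof.
move=> mc [n [z [cn ->]]]; apply/vge_le/(_ : vge n%:~R _); last by exists n, z.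
rewrite ler_int -ltzD1 -(ltr_int R) intrD; lra.
Qed.

Lemma vge_zp (z : Zp) : vge 0 (zp_inj z).
Proof. by exists 0, z; rewrite expr0z mul1r. Qed.

Lemma vge0P x : vge 0 x <-> exists z, x = zp_inj z.
Proof.
split=> [/(vge_intP 0) [z ->]|[z ->]]; last exact: vge_zp.
by exists z; rewrite expr0z mul1r.
Qed.

Lemma vge0 c : vge c 0.
Proof.
exists (Num.ceil c), 0; split; first exact: ceil_ge.
by rewrite /zp_inj rmorph0 mulr0.
Qed.

Lemma vgeN c x : vge c x -> vge c (- x).
Proof.
by move=> [m [z [cm ->]]]; exists m, (- z); rewrite /zp_inj rmorphN mulrN.
Qed.

Lemma vgeD c x y : vge c x -> vge c y -> vge c (x + y).
Proof.
wlog : x y / exists (m n : int) (a b : Zp), [/\ m <= n, c <= m%:~R, x = p%:R ^ m * zp_inj a & y = p%:R ^ n * zp_inj b].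
  move=> W [m [a [cm xE]]] [n [b [cn yE]]]; case: (leP m n) => mn.
    by apply: W; [exists m, n, a, b|exists m, a|exists n, b].
  rewrite addrC; apply: W; [|by exists n, b|by exists m, a].
  by exists n, m, b, a; split=> //; exact: ltW.
move=> [m [n [a [b [mn cm -> ->]]]]] _ _.
have /(vge_intP m)[d ->] : vge m%:~R (p%:R ^ n * zp_inj b) by exists n, b; rewrite ler_int.
by exists m, (a + d); split=> //; rewrite /zp_inj rmorphD mulrDr.
Qed.

Lemma vgeB c x y : vge c x -> vge c y -> vge c (x - y).
Proof. by move=> cx cy; apply: vgeD => //; exact: vgeN. Qed.

Lemma vgeM c d x y : vge c x -> vge d y -> vge (c + d) (x * y).
Proof.
move=> [m [a [cm ->]]] [n [b [cn ->]]]; exists (m + n), (a * b); split.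
  by rewrite intrD lerD.
by rewrite /zp_inj rmorphM expfzDr //; ring.
Qed.

Lemma vgeMl c x y : vge 0 x -> vge c y -> vge c (x * y).
Proof. by move=> x0 cy; rewrite -[c]add0r; exact: vgeM. Qed.

Lemma vgeMr c x y : vge c x -> vge 0 y -> vge c (x * y).
Proof. by move=> x0 cy; rewrite -[c]addr0; exact: vgeM. Qed.

Lemma vge_sum c (I : Type) (r : seq I) (P : pred I) (F : I -> Qp) :
  (forall i, P i -> vge c (F i)) -> vge c (\sum_(i <- r | P i) F i).
Proof.
move=> H; apply: big_ind => //; [exact: vge0|move=> x y; exact: vgeD].
Qed.

Lemma vge_int (n : int) : vge 0 n%:~R.
Proof. by rewrite -(rmorph_int (@FracField.tofrac Zp)); exact: vge_zp. Qed.

Lemma vge_nat (n : nat) : vge 0 n%:R.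
Proof. by rewrite -(rmorph_nat (@FracField.tofrac Zp)); exact: vge_zp. Qed.

Lemma vge_mulrn c x n : vge c x -> vge c (x *+ n).
Proof. by move=> cx; rewrite -mulr_natr; apply: vgeMr => //; exact: vge_nat. Qed.

Lemma vgeX x n : vge 0 x -> vge 0 (x ^+ n).
Proof.
by move=> x0; elim: n => [|n IH]; [exact: (vge_nat 1)|rewrite exprS; exact: vgeMl].
Qed.

Lemma vge_expz (m : int) : vge m%:~R (p%:R ^ m).
Proof. by apply/vge_intP; exists 1; rewrite /zp_inj rmorph1 mulr1. Qed.

Lemma vge_expn (m : nat) : vge m%:R (p%:R ^+ m).
Proof. exact: (vge_expz m). Qed.

Lemma vge_unitV (u : Zp) : u \is a GRing.unit -> vge 0 (zp_inj u)^-1.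
Proof. by move=> uu; rewrite /zp_inj -rmorphV //; exact: vge_zp. Qed.

Lemma vge_div_expz c (m : int) x : vge c x -> vge (c - m%:~R) (x / p%:R ^ m).
Proof.
move=> cx; rewrite invr_expz; apply: vgeM => //.
by rewrite -rmorphN; exact: vge_expz.
Qed.

Lemma natr_factor n : (0 < n)%N -> exists2 u : Zp, u \is a GRing.unit &
  n%:R = p%:R ^+ logn p n * zp_inj u.
Proof.
move=> n0; have [q qc nE] := pfactor_coprime (prime_valP p) n0.
exists q%:R; last by rewrite {1}nE natrM mulrC natrX /zp_inj rmorph_nat.
rewrite zp_unitE pmulrn zp_intE expn1; apply/eqP => /dvdz_mod0P.
rewrite dvdzE /= => /(conj (dvdnn p))/andP; rewrite -dvdn_gcd (eqP qc) dvdn1.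
by move/eqP => p1; move: p_gt1; rewrite p1.
Qed.

Lemma vge_natV n : vge (- (logn p n)%:R) (n%:R^-1).
Proof.
case: n => [|n]; first by rewrite invr0; exact: vge0.
have [u uu ->] := @natr_factor n.+1 isT; rewrite invfM.
apply: vgeMr; last exact: vge_unitV.
by rewrite exprnP invr_expz pmulrn -rmorphN; exact: vge_expz.
Qed.

End Valuation.

Lemma cross_sub (F : fieldType) (a b w P Q : F) : P != 0 -> Q != 0 ->
  b * Q - a * P = P * Q * (b / P + w - a / Q - w).
Proof. by move=> P0 Q0; field; rewrite P0 Q0. Qed.

Lemma add_frac (F : fieldType) (a b z w P Q : F) : P != 0 -> Q != 0 ->
  a / P + z + (b / Q + w) = (a * Q + b * P) / (P * Q) + (z + w).
Proof. by move=> P0 Q0; field; rewrite P0 Q0. Qed.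

(** * Rational numbers inside Q_p *)

Section Rational.
Variables (p : prime_number).
Local Notation Qp := (padic p).

Lemma qp_int_eq0 (z : int) : (z%:~R == 0 :> Qp) = (z == 0).
Proof.
apply/eqP/eqP => [|->]; last by rewrite mulr0z.
case: z => [[|n]|n] //; last first.
  move/eqP; rewrite NegzE mulrNz oppr_eq0 -pmulrn => /eqP; move/eqP.
  by rewrite (negPf (@qp_natr_neq0 p n.+1 _)).
by rewrite -pmulrn; move/eqP; rewrite (negPf (@qp_natr_neq0 p n.+1 _)).
Qed.

(** [ratr] is computed from the reduced fraction; additivity and multiplicativity over Q_p rest on
    this independence of the representative. *)
Lemma qp_ratrE (m n : int) : n != 0 ->
  ratr (m%:~R / n%:~R) = m%:~R / n%:~R :> Qp.
Proof.
move=> n0; set x : rat := _ / _; rewrite /ratr.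
have d0 := denq_neq0 x.
have : numq x * n = m * denq x.
  apply: (@intr_inj rat); rewrite !rmorphM /=.
  apply/eqP; rewrite -eqr_div ?intr_eq0 // divq_num_den //.
move/(congr1 (fun z : int => z%:~R : Qp)); rewrite !rmorphM /= => E.
by apply/eqP; rewrite eqr_div ?qp_int_eq0 // E.
Qed.

Lemma qp_ratrM (x y : rat) : ratr (x * y) = ratr x * ratr y :> Qp.
Proof.
have [dx dy] := (denq_neq0 x, denq_neq0 y).
rewrite -[in LHS](divq_num_den x) -[in LHS](divq_num_den y) mulf_div -!intrM.
by rewrite qp_ratrE ?mulf_neq0 // !intrM -mulf_div.
Qed.

Lemma qp_ratrD (x y : rat) : ratr (x + y) = ratr x + ratr y :> Qp.
Proof.
have [dx dy] := (denq_neq0 x, denq_neq0 y).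
rewrite -[in LHS](divq_num_den x) -[in LHS](divq_num_den y).
rewrite addf_div ?intr_eq0 // -!intrM -!intrD.
rewrite qp_ratrE ?mulf_neq0 // !(intrM, intrD) -addf_div ?qp_int_eq0 //.
Qed.

Lemma qp_ratrN (x : rat) : ratr (- x) = - ratr x :> Qp.
Proof. by rewrite -mulN1r qp_ratrM -(rmorphN1 (intmul 1)) ratr_int mulN1r. Qed.

Lemma qp_ratr_eq0 (x : rat) : (ratr x == 0 :> Qp) = (x == 0).
Proof.
by rewrite /ratr mulf_eq0 invr_eq0 !qp_int_eq0 (negPf (denq_neq0 _)) orbF numq_eq0.
Qed.

Lemma qp_ratrV (x : rat) : ratr x^-1 = (ratr x)^-1 :> Qp.
Proof.
have [->|x0] := eqVneq x 0; first by rewrite invr0 -(mulr0z 1) ratr_int mulr0z invr0.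
apply: (mulfI (_ : ratr x != 0 :> Qp)); first by rewrite qp_ratr_eq0.
by rewrite -qp_ratrM !divff ?qp_ratr_eq0 // -(mulr1z 1) ratr_int.
Qed.

End Rational.

(** * The additive character and convergence of power series *)

Section AdditiveCharacter.
Variable R : realType.
Local Notation e := (@e R).
Local Notation normc := (@ComplexField.Normc.normc R).

Lemma eD x y : e (x + y) = e x * e y.
Proof. by rewrite /Defs.e mulrDr cosD sinD; simpc; congr Complex; ring. Qed.

Lemma e0 : e 0 = 1.
Proof. by rewrite /Defs.e mulr0 cos0 sin0. Qed.

Lemma eN x : e (- x) = (e x)^-1.
Proof.
have h : e (- x) * e x = 1 by rewrite -eD addNr e0.
have ex0 : e x != 0 by apply: contra_eq_neq h => ->; rewrite mulr0 eq_sym oner_neq0.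
by apply: (mulIf ex0); rewrite h mulVf.
Qed.

Lemma normc_e x : normc (e x) = 1.
Proof. by rewrite /= cos2Dsin2 sqrtr1. Qed.

Lemma eMn x n : e (x *+ n) = e x ^+ n.
Proof. by elim: n => [|n IH]; rewrite ?mulr0n ?e0 // mulrS eD IH exprS. Qed.

Lemma e_int (n : int) : e n%:~R = 1.
Proof.
have e1 : e 1 = 1 by rewrite /Defs.e mulr1 mulr_natl cos2pi sin2pi.
case: n => n; first by rewrite -pmulrn eMn e1 expr1n.
by rewrite NegzE mulrNz -pmulrn eN eMn e1 expr1n invr1.
Qed.

Variable p : prime_number.
Local Notation Zp := (padic_int p).
Local Notation Qp := (padic p).
Local Notation vge := (@vge R p).
Local Notation padic_e := (@padic_e R p).
Let pr0 := @qp_p_neq0 p.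
Let p_gt0 : (0 < p)%N. Proof. exact: prime_gt0 (prime_valP p). Qed.

(** Fractional parts exist: when the order is - (N + 1), the residue of the unit part modulo p^(N +
    1) serves as numerator. *)
Lemma qp_fracP (x : Qp) : exists (a : int) (N : nat) (z : Zp),
  x = a%:~R / p%:R ^+ N + zp_inj z.
Proof.
have [->|/qp_factor[m [u [_ ->]]]] := eqVneq x 0.
  by exists 0, 0%N, 0; rewrite [zp_inj 0]rmorph0 addr0 (_ : 0%:~R = 0) ?mul0r.
case: m => N.
  exists 0, 0%N, (p%:R ^+ N * u).
  by rewrite mulr0z mul0r add0r /zp_inj rmorphM rmorphXn /= rmorph_nat.
have [y uE] := zp_resB u N.+1.
exists (u N.+1), N.+1, y.
rewrite NegzE -exprnN [in LHS]uE /zp_inj rmorphD rmorphM rmorphXn /= rmorph_nat.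
by rewrite rmorph_int mulrDr mulKf ?expf_neq0 // mulrC.
Qed.

Lemma zp_int_dvd (a : int) (N : nat) (z : Zp) :
  a%:~R = p%:R ^+ N * z -> ((p ^ N)%:Z %| a)%Z.
Proof.
move=> /(congr1 (fun y : Zp => y N)); rewrite zp_intE -natrX pmulrn zp_mulE zp_intE.
by rewrite modzz mul0r mod0z => /dvdz_mod0P.
Qed.

(** [padic_frac] selects some representative. Two of them differ by an element of Z[1/p] lying in
    Z_p, hence by an integer, which [e] does not see. *)
Lemma padic_eE (x : Qp) (a : int) (N : nat) (z : Zp) :
  x = a%:~R / p%:R ^+ N + zp_inj z -> padic_e x = e (a%:~R / p%:R ^+ N).
Proof.
move=> xE; rewrite /Defs.padic_e /padic_frac.
have ratE (b : int) n : ratr (b%:~R / p%:R ^+ n) = b%:~R / p%:R ^+ n :> Qp.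
  rewrite -[p%:R ^+ n]natrX [X in _ / X]pmulrn qp_ratrE -?pmulrn ?natrX //.
  by rewrite eqz_nat -lt0n expn_gt0 p_gt0.
have ratE' (b : int) n : ratr (b%:~R / p%:R ^+ n) = b%:~R / p%:R ^+ n :> R.
  by rewrite rmorphM fmorphV rmorphXn /= ratr_int ratr_nat.
case: xgetP => [r _ [[b [n rE]] [w xE']]|].
  move: xE'; rewrite {}rE ratE ratE' xE => E.
  have E2 : (b * (p ^ N)%:Z - a * (p ^ n)%:Z)%:~R = p%:R ^+ (n + N) * (z - w) :> Zp.
    apply: zp_inj_inj; rewrite zp_inj_int zp_injM zp_inj_expp zp_injB.
    have -> : zp_inj z = b%:~R / p%:R ^+ n + zp_inj w - a%:~R / p%:R ^+ N.
      by rewrite -E; ring.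
    rewrite intrB !intrM -!pmulrn !natrX exprD.
    by apply: cross_sub; rewrite expf_neq0.
  have /dvdzP[q qE] := zp_int_dvd E2.
  suff -> : b%:~R / p%:R ^+ n = a%:~R / p%:R ^+ N + q%:~R :> R by rewrite eD e_int mulr1.
  have pn0 k : (p%:R ^+ k : R) != 0 by rewrite expf_neq0 // pnatr_eq0 -lt0n.
  move/(congr1 (fun z : int => z%:~R : R)): qE.
  rewrite intrB !intrM -!pmulrn !natrX exprD => qE.
  apply: (mulIf (pn0 n)); apply: (mulIf (pn0 N)).
  rewrite divfK // !mulrDl [a%:~R / _ * _]mulrAC divfK //.
  by rewrite -[LHS](subrK (a%:~R * p%:R ^+ n)) qE; ring.
move=> H; case: (H (a%:~R / p%:R ^+ N)); split; first by exists a, N.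
by exists z; rewrite ratE.
Qed.

Lemma padic_eD (x y : Qp) : padic_e (x + y) = padic_e x * padic_e y.
Proof.
have [a [N [z xE]]] := qp_fracP x; have [b [M [w yE]]] := qp_fracP y.
have pn0 k : (p%:R ^+ k : R) != 0 by rewrite expf_neq0 // pnatr_eq0 -lt0n.
rewrite (padic_eE xE) (padic_eE yE) -eD.
rewrite (@padic_eE _ (a * (p ^ M)%:Z + b * (p ^ N)%:Z) (N + M) (z + w)).
  congr e; rewrite intrD !intrM -!pmulrn !natrX exprD; field.
  by rewrite !pn0.
rewrite xE yE intrD !intrM -!pmulrn !natrX exprD zp_injD.
by apply: add_frac; rewrite expf_neq0.
Qed.

Lemma padic_e_int (x : Qp) : vge 0 x -> padic_e x = 1.
Proof.
move=> /vge0P[z ->]; rewrite (@padic_eE _ 0 0%N z) ?mulr0z ?mul0r ?e0 //.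
by rewrite add0r.
Qed.

Lemma padic_e_congr (x y : Qp) : vge 0 (x - y) -> padic_e x = padic_e y.
Proof. by move=> xy; rewrite -[x](subrK y) padic_eD padic_e_int // mul1r. Qed.

Lemma padic_e0 : padic_e 0 = 1.
Proof. by rewrite padic_e_int //; exact: vge0. Qed.

Lemma padic_eN x : padic_e (- x) = (padic_e x)^-1.
Proof.
have h : padic_e (- x) * padic_e x = 1 by rewrite -padic_eD addNr padic_e0.
have x0 : padic_e x != 0 by apply: contra_eq_neq h => ->; rewrite mulr0 eq_sym oner_neq0.
by apply: (mulIf x0); rewrite h mulVf.
Qed.

Lemma normc_padic_e x : normc (padic_e x) = 1.
Proof. exact: normc_e. Qed.

Lemma padic_e_div (a : int) N : padic_e (a%:~R / p%:R ^+ N) = e (a%:~R / p%:R ^+ N).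
Proof. by apply: (@padic_eE _ _ _ 0); rewrite /zp_inj rmorph0 addr0. Qed.

Lemma padic_eMn x n : padic_e (x *+ n) = padic_e x ^+ n.
Proof. by elim: n => [|n IH]; rewrite ?mulr0n ?padic_e0 // mulrS padic_eD IH exprS. Qed.

End AdditiveCharacter.

Section Convergence.
Local Open Scope classical_set_scope.
Variables (R : realType) (p : prime_number).
Local Notation Zp := (padic_int p).
Local Notation Qp := (padic p).
Local Notation vge := (@vge R p).
Local Notation padic_norm := (@padic_norm R p).
Let pr0 := @qp_p_neq0 p.
Let p_gt0 : (0 < p)%N. Proof. exact: prime_gt0 (prime_valP p). Qed.
Let p_gt1 : (1 < p)%N. Proof. exact: prime_gt1 (prime_valP p). Qed.

Lemma zp_vgeP (z : Zp) n : vge n%:R (zp_inj z) <-> z n = 0.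
Proof.
split => [/(vge_intP _ n%:Z)[y]|zn].
  rewrite -exprnP -zp_inj_expp -zp_injM => /zp_inj_inj ->.
  by rewrite -natrX pmulrn zp_mulE zp_intE modzz mul0r mod0z.
have [y ->] := zp_resB z n; rewrite zn add0r zp_injM zp_inj_expp.
by apply: vgeMr; [exact: vge_expn|exact: vge_zp].
Qed.

Lemma vge_unit_le (m n : int) (u : Zp) : u \is a GRing.unit ->
  vge n%:~R (p%:R ^ m * zp_inj u) -> n <= m.
Proof.
move=> uu H; rewrite leNgt; apply/negP => mn.
have /(vge_div_expz m) := H; rewrite mulrAC divff ?mul1r ?expfz_neq0 // => H1.
have : vge 1%:R (zp_inj u).
  by apply: vge_le H1; rewrite -intrB -[1%:R]/(1%:~R) ler_int; lia.
by move/zp_vgeP/eqP; move: uu; rewrite zp_unitE => /negPf ->.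
Qed.

Lemma padic_ordE (m : int) (u : Zp) : u \is a GRing.unit ->
  padic_ord (p%:R ^ m * zp_inj u) = m%:E.
Proof.
move=> uu; rewrite /padic_ord ifF; last first.
  rewrite mulf_eq0 expfz_eq0 (negPf pr0) andbF zp_inj0 /=.
  by apply/eqP => u0; move: uu; rewrite u0 unitr0.
congr (_%:E); apply: xget_unique => [|n /= [v vu E]]; first by exists u.
apply/eqP; rewrite eq_le; apply/andP; split.
  by apply: (vge_unit_le uu); rewrite E; exists n, v.
by apply: (vge_unit_le vu); rewrite -E; exists m, u.
Qed.

Lemma padic_ord_geP (N : int) (x : Qp) : (N%:E <= padic_ord x)%E <-> vge N%:~R x.
Proof.
have [->|x0] := eqVneq x 0.
  rewrite /padic_ord eqxx leey; split=> // _; exact: vge0.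
have [m [u [uu ->]]] := qp_factor x0; rewrite padic_ordE // lee_fin.
split=> [Nm|]; last exact: vge_unit_le.
by exists m, u; rewrite ler_int.
Qed.

Lemma padic_norm_leP (N : int) (x : Qp) : padic_norm x <= p%:R ^ (- N) <-> vge N%:~R x.
Proof.
have p1 : (1 : R) < p%:R by rewrite ltr1n.
rewrite -padic_ord_geP /Defs.padic_norm; have [->|x0] := eqVneq x 0.
  by rewrite /padic_ord eqxx leey exprz_ge0.
have [m [u [uu ->]]] := qp_factor x0; rewrite padic_ordE // lee_fin.
by rewrite ler_eXz2l // lerN2.
Qed.

Lemma padic_norm_ge0 (x : Qp) : 0 <= padic_norm x.
Proof. by rewrite /Defs.padic_norm; case: padic_ord => // m; rewrite exprz_ge0. Qed.

Lemma padic_norm_cvg0P (v : nat -> Qp) :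
  (padic_norm \o v) @ \oo --> (0 : R) <->
  forall N : nat, \forall n \near \oo, vge N%:R (v n).
Proof.
have p0 : (0 : R) < p%:R by rewrite ltr0n.
split=> [H N|H].
  have := (@cvgr0Pnorm_le _ _ _ _ eventually_filter _).1 H _ (exprz_gt0 (- N%:Z) p0).
  apply: filterS => n /=; rewrite ger0_norm ?padic_norm_ge0 //.
  by move=> H1; apply: (padic_norm_leP N%:Z _).1.
apply/cvgr0Pnorm_le => eps eps0.
pose N := (Num.truncn eps^-1).+1.
have := H N; apply: filterS => n /((padic_norm_leP N%:Z _).2) /= vN.
rewrite ger0_norm ?padic_norm_ge0 //; apply: le_trans vN _.
rewrite -exprnN -[leRHS]invrK lef_pV2 ?posrE ?invr_gt0 ?exprn_gt0 //.
apply: le_trans (ltW (truncnS_gt _)) _; rewrite -natrX ler_nat.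
exact: ltnW (ltn_expl _ _).
Qed.

Lemma padic_cvgP (u : nat -> Qp) l : padic_cvg R u l <->
  forall N : nat, \forall n \near \oo, vge N%:R (u n - l).
Proof. exact: (padic_norm_cvg0P (fun n => u n - l)). Qed.

(** Modulo p^N the partial sums are eventually constant, and these constants form a coherent
    sequence. *)
Lemma zp_series_cvg (z : nat -> Zp) :
  (forall N : nat, \forall n \near \oo, vge N%:R (zp_inj (z n))) ->
  exists l : Zp, forall N : nat, \forall n \near \oo,
    vge N%:R (zp_inj (\sum_(k < n) z k) - zp_inj l).
Proof.
move=> H.
have /choice[K KP] : forall N : nat, exists K : nat, forall n, (K <= n)%N -> z n N = 0.
  move=> N; have [K _ KP] := H N; exists K => n Kn; apply/zp_vgeP; exact: KP.
pose S n := \sum_(k < n) z k.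
have SE N n : (K N <= n)%N -> S n N = S (K N) N.
  move=> /subnK <-; elim: (n - K N)%N => [//|j IH].
  rewrite addSn /S big_ord_recr zp_addE [z _ _]KP ?leq_addl // addr0.
  by rewrite zp_small; exact: IH.
(* Taking the index beyond both thresholds lets [l n] and [l n.+1] be read off the same partial
   sum. *)
pose l n := S (maxn (K n) (K n.+1)) n.
have lE N n : (K N <= n)%N -> l N = S n N.
  by move=> Kn; rewrite /l SE ?leq_maxl // -(SE N n).
have lP n : (l n.+1 = l n %[mod (p ^ n)%:Z])%Z.
  rewrite (lE n.+1 (maxn (K n) (K n.+1))) ?leq_maxr // /l.
  by rewrite (@zp_mod _ _ n n.+1).
exists (zp_of lP) => N; exists (K N) => // n /= Kn.
have lN : zp_of lP N = S n N by rewrite /= (lE _ _ Kn) zp_small.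
by rewrite -zp_injB; apply/zp_vgeP; rewrite zp_addE zp_oppE lN modzDmr subrr mod0z.
Qed.

Lemma series_cvg (t : nat -> Qp) :
  (forall N : nat, \forall n \near \oo, vge N%:R (t n)) ->
  exists l : Qp, padic_cvg R (fun n => \sum_(k < n) t k) l.
Proof.
move=> H; have [k0 _ k0P] := H 0%N.
have /choice[z zE] : forall k, exists z, t (k0 + k)%N = zp_inj z.
  by move=> k; apply/(vge0P R); apply: k0P => /=; rewrite leq_addr.
have [l lP] : exists l : Zp, forall N : nat, \forall n \near \oo,
    vge N%:R (zp_inj (\sum_(k < n) z k) - zp_inj l).
  apply: zp_series_cvg => N; have [K _ KP] := H N; exists K => // n /= Kn.
  by rewrite -zE; apply: KP => /=; rewrite (leq_trans Kn) ?leq_addl.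
exists (\sum_(k < k0) t k + zp_inj l); apply/padic_cvgP => N.
have [K _ KP] := lP N; exists (k0 + K)%N => // n /= Kn.
have /KP : (K <= n - k0)%N by rewrite leq_subRL // (leq_trans _ Kn) ?leq_addr.
congr (vge _ _); rewrite opprD addrA; congr (_ - _).
rewrite -(subnKC (leq_trans (leq_addr K k0) Kn)) big_split_ord /= [X in X - _]addrC addrK.
rewrite addKn; elim: (n - k0)%N => [|j IH]; first by rewrite !big_ord0 /zp_inj rmorph0.
by rewrite !big_ord_recr /= zp_injD IH zE.
Qed.

(** By the ultrametric inequality one bound valid for each tail coefficient bounds the whole tail,
    and the limit is compared with a single far partial sum. *)
Lemma pseries_eval_trunc (f : nat -> Qp) (x : Qp) (K N : nat) : vge 0 x ->
  (forall M : nat, \forall n \near \oo, vge M%:R (f n)) ->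
  (forall k, (K <= k)%N -> vge N%:R (f k)) ->
  vge N%:R (pseries_eval R f x - \sum_(k < K) f k * x ^+ k).
Proof.
move=> x0 f0 fK.
have [l lP] : exists l, padic_cvg R (fun n => \sum_(k < n) f k * x ^+ k) l.
  apply: (@series_cvg (fun k => f k * x ^+ k)) => M; have [J _ JP] := f0 M; exists J => // n Jn.
  by move=> /=; apply: vgeMr; [exact: JP|exact: vgeX].
rewrite /pseries_eval; set L := xget _ _.
have /padic_cvgP/(_ N)[j _ jP] : padic_cvg R (fun n => \sum_(k < n) f k * x ^+ k) L.
  by rewrite /L; apply: (@xgetPex _ _ [set l | padic_cvg R _ l]); exists l.
have := jP (maxn j K); rewrite /= leq_maxl => /(_ isT) /vgeN; rewrite opprB.
move=> H; rewrite -[L](subrK (\sum_(k < maxn j K) f k * x ^+ k)) -addrA.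
apply: vgeD => //; rewrite -(subnKC (leq_maxr j K)) big_split_ord /= addrAC subrr add0r.
by apply: vge_sum => i _; apply: vgeMr; [apply: fK; rewrite leq_addr|exact: vgeX].
Qed.

End Convergence.

(** * Compositional inverses of power series *)

Section XAdic.
Variable F : fieldType.
Implicit Types q r m : {poly F}.

Lemma dvdp_XnP n q : reflect (forall j, (j < n)%N -> q`_j = 0) ('X^n %| q).
Proof.
apply: (iffP idP) => [/dvdpP[r ->] j jn|H]; first by rewrite coefMXn jn.
apply/dvdpP; exists (drop_poly n q).
rewrite -[LHS](poly_take_drop n) -[RHS]add0r; congr (_ + _).
by apply/polyP => j; rewrite coef_take_poly coef0; case: ifP => // /H.
Qed.

Lemma dvdp_XP q : ('X %| q) = (q`_0 == 0).
Proof.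
rewrite -['X]expr1; apply/dvdp_XnP/eqP => [->//|q0] j; by rewrite ltnS leqn0 => /eqP ->.
Qed.

Lemma dvdp_Xn_comp n q r : r`_0 = 0 -> 'X^n %| q -> 'X^n %| (q \Po r).
Proof.
move=> /eqP; rewrite -dvdp_XP => /(dvdp_exp2r n) rX /dvdpP[s ->].
by rewrite comp_polyM rmorphXn /= comp_polyX dvdp_mull.
Qed.

Lemma dvdp_compB q (a b : {poly F}) : a - b %| (q \Po a) - (q \Po b).
Proof.
rewrite !comp_polyE -sumrB; apply: (big_ind (fun x => a - b %| x)) => [|x y|i _]; first exact: dvdp0.
- exact: dvdp_add.
- by rewrite -scalerBr -mul_polyC dvdp_mull // subrXX dvdp_mulr.
Qed.

Lemma coef0_comp q r : r`_0 = 0 -> (q \Po r)`_0 = q`_0.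
Proof. by rewrite -!horner_coef0 horner_comp => ->. Qed.

(** Write q = s 'X and let d be the correction. The new error is d (s o (m + d) - c) + m (s o (m +
    d) - s o m). In each product one factor is divisible by 'X^n and the other by 'X. Dividing by
    the fixed slope c, rather than by a derivative at m, gains one degree per step and keeps
    coefficient bounds intact when c is a unit. *)
Lemma newton_step n c q m : (0 < n)%N -> c != 0 -> q`_0 = 0 -> q`_1 = c -> m`_0 = 0 ->
  'X^n %| (q \Po m) - 'X ->
  'X^(n.+1) %| (q \Po (m + c^-1 *: ('X - (q \Po m)))) - 'X.
Proof.
move=> n0 c0 /eqP; rewrite -dvdp_XP => /dvdpP[s ->] sc /eqP m0 mX.
set d := c^-1 *: _.
have dX : 'X^n %| d by rewrite dvdpZr ?invr_eq0 // -dvdpNr opprB.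
have mdX : 'X %| m + d.
  by rewrite dvdp_add ?dvdp_XP // -dvdp_XP; apply: dvdp_trans dX; rewrite dvdp_exp.
have -> : ((s * 'X) \Po (m + d)) - 'X =
    d * ((s \Po (m + d)) - c%:P) + m * ((s \Po (m + d)) - (s \Po m)).
  have : c%:P * d = 'X - ((s * 'X) \Po m) by rewrite mul_polyC scalerA divff // scale1r.
  rewrite !comp_polyM !comp_polyX => E.
  rewrite mulrBr [d * c%:P]mulrC E; ring.
rewrite exprSr dvdp_add //.
  apply: dvdp_mul => //; rewrite dvdp_XP coefB coefC /= coef0_comp; last by apply/eqP; rewrite -dvdp_XP.
  by move: sc; rewrite coefMX /= => ->; rewrite subrr.
rewrite [m * _]mulrC; apply: dvdp_mul; last by rewrite dvdp_XP.
apply: dvdp_trans (dvdp_compB _ _ _); by rewrite addrAC subrr add0r.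
Qed.

Section Binomial.
Hypothesis char0 : forall n, n.+1%:R != 0 :> F.

(** The coefficients of (1 + 'X)^a, given by their recursion so that the exponent may be any field
    element. *)
Definition binomial_seq (a : F) (b : nat -> F) : Prop :=
  b 0%N = 1 /\ forall k, k.+1%:R * b k.+1 = (a - k%:R) * b k.

Definition trunc_series (K : nat) (b : nat -> F) : {poly F} := \poly_(k < K.+1) b k.

Lemma trunc_series_ode K a b : binomial_seq a b ->
  'X^K %| (1 + 'X) * (trunc_series K b)^`() - a *: trunc_series K b.
Proof.
move=> [b0 bS]; apply/dvdp_XnP => j jK.
rewrite coefB coefZ mulrDl mul1r coefD coefXM !coef_deriv !coef_poly.
rewrite !ltnS jK (ltnW jK) -mulr_natl bS.
case: j jK => [|j] jK /=; first by rewrite addr0 subr0 subrr.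
by rewrite (ltnW jK) -mulr_natl; ring.
Qed.

(* Both sides solve the first order equation (1 + 'X) P^`() = P. *)
Lemma trunc_series_comp K a a' b b' : a * a' = 1 ->
  binomial_seq a b -> binomial_seq a' b' ->
  'X^(K.+1) %| (trunc_series K b \Po (trunc_series K b' - 1)) - (1 + 'X).
Proof.
move=> aa' bP bP'; have := trunc_series_ode K bP; have := trunc_series_ode K bP'.
have B0 : (trunc_series K b)`_0 = 1 by rewrite coef_poly /= bP.1.
have B0' : (trunc_series K b')`_0 = 1 by rewrite coef_poly /= bP'.1.
move: B0 B0'; set P := trunc_series K b; set P' := trunc_series K b'.
move=> P0 P0' ode' ode.
have P1 : (P' - 1)`_0 = 0 by rewrite coefB P0' coef1 subrr.
set q := P \Po _.
have q'E : q^`() = (P^`() \Po (P' - 1)) * P'^`() by rewrite deriv_comp derivB -polyC1 derivC subr0.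
have ode1 : 'X^K %| P' * (P^`() \Po (P' - 1)) - a *: q.
  have X1 : (1 + 'X) \Po (P' - 1) = P'.
    by rewrite comp_polyD comp_polyX -polyC1 comp_polyC addrC subrK.
  by have := dvdp_Xn_comp P1 ode; rewrite comp_polyB comp_polyM X1 comp_polyZ.
(* [P'] has constant term 1, so it is coprime to 'X^K and may be multiplied in. The product is a
   combination of the two differential equations, the exponents meeting in a a' = 1. *)
have : 'X^K %| (1 + 'X) * q^`() - q.
  have cop : coprimep 'X^K P'.
    apply: coprimep_expl; rewrite coprimep_sym coprimepX /root horner_coef0 P0'.
    exact: oner_neq0.
  rewrite -(Gauss_dvdpr _ cop).
  have -> : P' * ((1 + 'X) * q^`() - q) =
     (P^`() \Po (P' - 1)) * P' * ((1 + 'X) * P'^`() - a' *: P') +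
     a' *: P' * (P' * (P^`() \Po (P' - 1)) - a *: q).
    rewrite q'E -!mul_polyC;
    have : a'%:P * a%:P = 1 :> {poly F} by rewrite -polyCM mulrC aa'.
    move: (a'%:P) (a%:P) => A' A AA.
    transitivity (P' * ((1 + 'X) * ((P^`() \Po (P' - 1)) * P'^`())) - A' * A * (P' * q)); last by ring.
    by rewrite AA; ring.
  by rewrite dvdp_add // dvdp_mull.
move/dvdp_XnP => H; have q0 : q`_0 = 1 by rewrite coef0_comp.
have qS j : (j < K)%N -> j.+1%:R * q`_j.+1 = (1 - j%:R) * q`_j.
  move=> jK; have := H j jK; rewrite coefB mulrDl mul1r coefD coefXM !coef_deriv.
  move/eqP; rewrite subr_eq0 => /eqP; case: j jK => [|j] jK /= E.
    by rewrite mul1r subr0 mul1r -E addr0.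
  by apply/eqP; rewrite mulrBl mul1r eq_sym subr_eq !mulr_natl E.
(* The recursion gives q_0 = q_1 = 1; then the factor 1 - 1 kills q_2, and with it all later
   coefficients. *)
apply/dvdp_XnP => j; rewrite ltnS => jK.
rewrite coefB coefD coef1 coefX.
case: j jK => [|j]; first by rewrite q0 addr0 subrr.
elim: j => [|j IH] jK.
  have := qS 0%N jK; rewrite q0 subr0 !mul1r => ->; by rewrite add0r subrr.
have := IH (ltnW jK); rewrite /= !add0r; case: (j) IH jK => [|i] IH jK E.
  have := qS 1%N jK; rewrite subrr mul0r => /eqP; rewrite mulf_eq0 (negPf (char0 _)) /=.
  by move/eqP => ->; rewrite subrr.
have := qS i.+2 jK; move: E; rewrite subr0 => ->; rewrite mulr0 => /eqP.
by rewrite mulf_eq0 (negPf (char0 _)) /= => /eqP ->; rewrite subrr.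
Qed.

End Binomial.
End XAdic.

(** * Gauss norms and inversion with bounds *)

Section GaussBound.
Variables (R : realType) (p : prime_number) (la : R).
Local Notation Zp := (padic_int p).
Local Notation Qp := (padic p).
Local Notation vge := (@vge R p).
Implicit Types (c d : R) (q r m : {poly Qp}).

(** The Gauss norm of q on the disc of radius p^la is at most p^(-c). Both numbers are real since
    rho enters the slopes. *)
Definition gauss c q := forall j, vge (c + j%:R * la) q`_j.

Lemma gauss_le c d q : c <= d -> gauss d q -> gauss c q.
Proof. by move=> cd qd j; apply: vge_le (qd j); rewrite lerD2r. Qed.

Lemma gauss0 c : gauss c 0.
Proof. by move=> j; rewrite coef0; exact: vge0. Qed.

Lemma gaussD c q r : gauss c q -> gauss c r -> gauss c (q + r).
Proof. by move=> cq cr j; rewrite coefD; exact: vgeD. Qed.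

Lemma gaussN c q : gauss c q -> gauss c (- q).
Proof. by move=> cq j; rewrite coefN; exact: vgeN. Qed.

Lemma gaussB c q r : gauss c q -> gauss c r -> gauss c (q - r).
Proof. by move=> cq cr; apply: gaussD => //; exact: gaussN. Qed.

Lemma gaussM c d q r : gauss c q -> gauss d r -> gauss (c + d) (q * r).
Proof.
move=> cq dr j; rewrite coefM; apply: vge_sum => i _.
rewrite (_ : c + d + j%:R * la = (c + (i : nat)%:R * la) + (d + (j - i)%:R * la)).
  exact: vgeM.
by rewrite natrB -1?ltnS //; ring.
Qed.

Lemma gaussZ c d (a : Qp) q : vge d a -> gauss c q -> gauss (d + c) (a *: q).
Proof. by move=> da cq j; rewrite coefZ -addrA; exact: vgeM. Qed.

Lemma gauss1 : gauss 0 1.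
Proof.
move=> j; rewrite coef1; case: eqP => [->|_]; last exact: vge0.
by rewrite mul0r addr0; exact: (vge_nat R p 1).
Qed.

Lemma gaussX : gauss (- la) 'X.
Proof.
move=> j; rewrite coefX; case: eqP => [->|_]; last exact: vge0.
by rewrite mul1r addNr; exact: (vge_nat R p 1).
Qed.

Lemma gauss_exp c q n : gauss c q -> gauss (c *+ n) (q ^+ n).
Proof.
move=> cq; elim: n => [|n IH]; first exact: gauss1.
by rewrite exprS mulrS; exact: gaussM.
Qed.

Lemma gauss_sum c (I : Type) (s : seq I) (P : pred I) (f : I -> {poly Qp}) :
  (forall i, P i -> gauss c (f i)) -> gauss c (\sum_(i <- s | P i) f i).
Proof.
move=> H; apply: (big_ind (gauss c)) => //; [exact: gauss0|exact: gaussD].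
Qed.

(** [gauss (- la) r] says that r maps the disc of radius p^la into itself, so composing with r
    cannot increase the norm. *)
Lemma gauss_comp c q r : gauss c q -> gauss (- la) r -> gauss c (q \Po r).
Proof.
move=> cq cr; rewrite comp_polyE; apply: gauss_sum => i _.
have := gaussZ (cq i) (gauss_exp i cr).
by rewrite mulNrn mulr_natl addrK.
Qed.

(** A Lipschitz estimate: the relative closeness d of a and b is inherited by q o a and q o b,
    because a^i - b^i contains a - b once and i - 1 factors of norm at most p^la. *)
Lemma gauss_compB c d q (a b : {poly Qp}) : gauss c q ->
  gauss (- la) a -> gauss (- la) b -> gauss (d - la) (a - b) ->
  gauss (c + d) ((q \Po a) - (q \Po b)).
Proof.
move=> cq ga gb gab; rewrite !comp_polyE -sumrB; apply: gauss_sum => i _.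
rewrite -scalerBr; have [->|i0] := posnP i; first by rewrite subrr scaler0; exact: gauss0.
rewrite (_ : c + d = c + (i : nat)%:R * la + (d - (i : nat)%:R * la)); last by ring.
apply: gaussZ (cq i) _; rewrite subrXX.
rewrite (_ : d - _ = d - la + (- la) *+ i.-1); last first.
  by rewrite mulr_natl mulNrn -[in LHS](prednK i0) mulrS; ring.
apply: gaussM => //; apply: gauss_sum => j _.
rewrite -(_ : (i.-1 - j + j)%N = i.-1); last by rewrite subnK // -ltnS prednK.
rewrite mulrnDr; apply: gaussM; last exact: gauss_exp.
by rewrite addnK -subn1 -subnDA add1n; exact: gauss_exp.
Qed.

Lemma coef_deriv_gauss c q : gauss c q -> gauss (c + la) q^`().
Proof.
move=> cq j; rewrite coef_deriv; apply: vge_mulrn.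
by have := cq j.+1; rewrite -natr1; congr (vge _ _); ring.
Qed.

(** Newton steps starting from 0. The correction is scaled by the integral number 1 / q_1, so the
    bound [gauss (- la)] is kept without loss at each step. *)
Lemma inverse_series K q : q`_0 = 0 -> q`_1 != 0 -> vge 0 (q`_1)^-1 ->
  gauss (- la) q ->
  exists m, [/\ m`_0 = 0, 'X^(K.+1) %| (q \Po m) - 'X & gauss (- la) m].
Proof.
move=> q0 q1 v1 gq; elim: K => [|K [m [m0 mX gm]]].
  exists 0; split; [by rewrite coef0| |exact: gauss0].
  by rewrite expr1 dvdp_XP coefB coefX subr0 coef0_comp ?coef0 ?q0.
exists (m + (q`_1)^-1 *: ('X - (q \Po m))); split; last first.
- apply: gaussD => //; rewrite -[- la]add0r; apply: gaussZ => //.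
  by apply: gaussB; [exact: gaussX|exact: gauss_comp].
- exact: newton_step.
- by rewrite coefD coefZ coefB coefX coef0_comp // q0 subr0 mulr0 addr0.
Qed.

(* With T = 'X - (q - q0) \Po m, one has q0 \Po m = T and hence m = r0 \Po T
   modulo 'X^(K.+1), while T is close to 'X. *)
Lemma inverse_compare K c (q q0 r0 m : {poly Qp}) : 0 <= c ->
  q0`_0 = 0 -> m`_0 = 0 ->
  'X^(K.+1) %| (r0 \Po q0) - 'X -> 'X^(K.+1) %| (q \Po m) - 'X ->
  gauss (- la) r0 -> gauss (- la) m -> gauss (c - la) (q - q0) ->
  forall j, (j <= K)%N -> vge (c - la + j%:R * la) (m`_j - r0`_j).
Proof.
move=> c0 q00 m0 rq qm gr gm gE j jK; set E := q - q0.
set T := 'X - (E \Po m).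
have gET : gauss (c - la) (E \Po m) by exact: gauss_comp.
have gT : gauss (- la) T.
  by apply: gaussB; [exact: gaussX|apply: gauss_le gET; rewrite lerDr].
have mE : 'X^(K.+1) %| m - (r0 \Po T).
  rewrite -[m](subrK (r0 \Po (q0 \Po m))) -addrA; apply: dvdp_add.
    have := dvdp_Xn_comp m0 rq.
    by rewrite comp_polyB comp_polyX comp_polyA -dvdpNr opprB.
  apply: dvdp_trans (dvdp_compB _ _ _).
  suff -> : (q0 \Po m) - T = (q \Po m) - 'X by [].
  rewrite /T opprB /E comp_polyB; move: (q0 \Po m) (q \Po m) => A B.
  by rewrite addrA [A + _]addrC subrK.
have gTX : gauss (c - la) (T - 'X) by rewrite addrAC subrr add0r; exact: gaussN.
have := gauss_compB gr gT gaussX gTX; rewrite comp_polyXr => /(_ j).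
rewrite coefB [- la + c]addrC; move/dvdp_XnP/(_ j jK): mE; rewrite coefB => /eqP.
by rewrite subr_eq0 => /eqP <-.
Qed.

End GaussBound.

(** * Binomial coefficients *)

Section FactorialValuation.
Variable p : prime_number.
Let p_gt0 : (0 < p)%N. Proof. exact: prime_gt0 (prime_valP p). Qed.
Let p_gt1 : (1 < p)%N. Proof. exact: prime_gt1 (prime_valP p). Qed.

(** Legendre's formula: (p - 1) ord_p n! is n minus the digit sum of n, which is at least 1. In the
    induction the term [maxn (n %/ p ^ K) 1] is the room still available for the remaining
    quotients. *)
Lemma logn_fact_le n : (0 < n)%N -> (p.-1 * logn p n`! <= n.-1)%N.
Proof.
move=> n0; rewrite logn_fact ?prime_valP //.
have H K : (p.-1 * (\sum_(1 <= k < K.+1) n %/ p ^ k) + maxn (n %/ p ^ K) 1 <= n)%N.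
  elim: K => [|K IH]; first by rewrite big_geq // muln0 expn0 divn1 geq_max leqnn.
  rewrite big_nat_recr //= mulnDr -addnA; apply: leq_trans IH; rewrite leq_add2l.
  rewrite expnSr divnMA; set m := (n %/ p ^ K)%N.
  have [->|m0] := posnP (m %/ p)%N; first by rewrite muln0 leq_maxr.
  rewrite (maxn_idPl m0) addnC -mulSn prednK // (leq_trans _ (leq_maxl _ _)) //.
  by rewrite mulnC leq_divM.
have := leq_trans (leq_add (leqnn _) (leq_maxr _ _)) (H n).
by rewrite addn1 -[(_ <= n.-1)%N]ltnS prednK.
Qed.

Variable R : realType.
Local Notation rho := (rho R p).

Lemma rho_gt0 : 0 < rho.
Proof. by rewrite invr_gt0 subr_gt0 ltr1n. Qed.

Lemma rho_le1 : rho <= 1.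
Proof. by rewrite invf_le1 ?subr_gt0 ?ltr1n // lerBrDr -[1 + 1]/(2%:R) ler_nat. Qed.

Lemma logn_fact_rho n : (0 < n)%N -> (logn p n`!)%:R <= (n%:R - 1) * rho.
Proof.
move=> n0; rewrite ler_pdivlMr ?subr_gt0 ?ltr1n //.
have predE m : (0 < m)%N -> m.-1%:R = m%:R - 1 :> R by move=> m0; rewrite -subn1 natrB.
by have := logn_fact_le n0; rewrite -(ler_nat R) natrM !predE // mulrC.
Qed.

Lemma logn_le_rho n : (0 < n)%N -> (logn p n)%:R <= (n%:R - 1) * rho.
Proof.
move=> n0; apply: le_trans (logn_fact_rho n0); rewrite ler_nat.
by apply: dvdn_leq_log; [exact: fact_gt0|case: n n0 => // n _; rewrite factS dvdn_mulr].
Qed.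

End FactorialValuation.

Section BinomialValuation.
Variables (R : realType) (p : prime_number).
Local Notation Zp := (padic_int p).
Local Notation Qp := (padic p).
Local Notation vge := (@vge R p).
Local Notation rho := (rho R p).
Let pr0 := @qp_p_neq0 p.
Let p_gt0 : (0 < p)%N. Proof. exact: prime_gt0 (prime_valP p). Qed.
Let p_gt1 : (1 < p)%N. Proof. exact: prime_gt1 (prime_valP p). Qed.

Lemma gbinom_seq (y : rat) : binomial_seq (ratr y : Qp) (fun k => ratr (gbinom y k)).
Proof.
split=> [|k]; first by rewrite /gbinom big_ord0 -(mulr1z 1) ratr_int.
rewrite /gbinom big_ord_recr /= !qp_ratrM qp_ratrV qp_ratrD qp_ratrN !ratr_nat.
move: (ratr _) (ratr y) => b a; have := @qp_natr_neq0 p k.+1 isT.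
move: (k.+1%:R) (a - _) => c d c0.
by rewrite mulrCA [c * _]mulrC divfK // mulrC.
Qed.

Lemma ratr_factor (y : rat) : y != 0 ->
  exists2 u : Zp, u \is a GRing.unit & ratr y = p%:R ^ (ordq p y) * zp_inj u.
Proof.
move=> y0; have d0 : (0 < `|denq y|)%N by rewrite absz_gt0 denq_neq0.
have n0 : (0 < `|numq y|)%N by rewrite absz_gt0 numq_eq0.
have [u uu uE] := natr_factor p n0; have [v vv vE] := natr_factor p d0.
have [b nE] : exists b : bool, numq y = (-1) ^+ b * `|numq y|%N%:Z.
  by exists (numq y < 0)%R; exact: intEsign.
exists ((-1) ^+ b * (u / v)).
  by rewrite unitrM unitrX ?unitrN1 // unitrM uu unitrV.
rewrite /ratr -absz_denq {1}nE rmorphMsign /= -!pmulrn uE vE.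
have zV : zp_inj v^-1 = (zp_inj v)^-1 by rewrite /zp_inj rmorphV.
have zs : zp_inj ((-1) ^+ b : Zp) = (-1) ^+ b.
  by rewrite /zp_inj rmorphXn rmorphN1.
rewrite !zp_injM zV zs /ordq expfzDr // -exprnP -exprnN invfM.
move: ((-1) ^+ _) (p%:R ^+ _) (_^-1) (zp_inj u) (_^-1) => A B C D E.
by rewrite -!mulrA mulrCA; congr (_ * _); rewrite [RHS]mulrCA; congr (_ * _); rewrite mulrCA.
Qed.

Lemma prod_ffact (F : comNzRingType) n k :
  \prod_(j < k) (n%:R - j%:R) = (n ^_ k)%:R :> F.
Proof.
elim: k => [|k IH]; first by rewrite big_ord0 ffactn0.
rewrite big_ord_recr /= IH ffactnSr natrM; have [kn|nk] := leqP k n; first by rewrite natrB.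
by rewrite ffact_small // !mul0r.
Qed.

(** Integrality of the binomial coefficient of a p-adic integer: replace x by a natural number
    congruent to it modulo the power of p in k!, for which the coefficient is an integer. *)
Lemma vge_falling (x : Qp) k : vge 0 x ->
  vge (logn p k`!)%:R (\prod_(j < k) (x - j%:R)).
Proof.
move=> x0; have /vge0P[z xE] := x0; set L := logn p k`!.
have a0 : 0 <= z L by rewrite -zp_small modz_ge0 // eqz_nat -lt0n expn_gt0 p_gt0.
pose n := `|z L|%N.
have xn : vge L%:R (x - n%:R).
  have [y zE] := zp_resB z L.
  have -> : x - n%:R = p%:R ^+ L * zp_inj y.
    rewrite xE {1}zE zp_injD zp_inj_int zp_injM zp_inj_expp.
    by rewrite [n%:R]pmulrn gez0_abs // addrC addKr.
  by apply: vgeMr; [exact: vge_expn|exact: vge_zp].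
have H i : vge L%:R (\prod_(j < i) (x - j%:R) - \prod_(j < i) (n%:R - j%:R)).
  elim: i => [|i IH]; first by rewrite !big_ord0 subrr; exact: vge0.
  rewrite !big_ord_recr /=; have IHn : vge 0 (\prod_(j < i) (n%:R - j%:R) : Qp).
    by rewrite prod_ffact; exact: vge_nat.
  move: IH IHn; set A := \prod_(j < i) (x - j%:R); set B := \prod_(j < i) _ => IH B0.
  have -> : A * (x - i%:R) - B * (n%:R - i%:R) = (A - B) * (x - i%:R) + B * (x - n%:R).
    by move: (i%:R) (n%:R) => i' n'; ring.
  apply: vgeD; last exact: vgeMl.
  by apply: vgeMr => //; apply: vgeB => //; exact: vge_nat.
rewrite -[X in vge _ X](subrK (\prod_(j < k) (n%:R - j%:R))); apply: vgeD => //.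
rewrite prod_ffact -bin_ffact natrM; apply: vgeMl; first exact: vge_nat.
have [u _ ->] := natr_factor p (fact_gt0 k).
by apply: vgeMr; [exact: vge_expn|exact: vge_zp].
Qed.

Lemma ratr_gbinomE (x : rat) k :
  ratr (gbinom x k) = (\prod_(j < k) (ratr x - j%:R)) / k`!%:R :> Qp.
Proof.
elim: k => [|k IH].
  by rewrite /gbinom !big_ord0 fact0 invr1 mulr1 -(mulr1z 1) ratr_int.
rewrite /gbinom !big_ord_recr /= !qp_ratrM -/(gbinom x k) IH qp_ratrV qp_ratrD qp_ratrN.
rewrite !ratr_nat factS natrM invfM.
move: (\prod_(j < k) _) (_^-1) (_^-1) (ratr x - _) => A B C D.
by rewrite -!mulrA; congr (_ * _); rewrite mulrCA [B * C]mulrC.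
Qed.

(** The absorption identity, used to extract the factor x when it has positive order. *)
Lemma gbinomS (x : rat) k : gbinom x k.+1 = x / k.+1%:R * gbinom (x - 1) k.
Proof.
have kS0 n : n.+1%:R != 0 :> rat by rewrite pnatr_eq0.
elim: k => [|k IH]; rewrite /gbinom big_ord_recr /= -/(gbinom x _).
  by rewrite /gbinom !big_ord0; ring.
rewrite IH /gbinom [in RHS]big_ord_recr /=; move: (\prod_(j < k) _) => A.
have := kS0 k.+1; have := kS0 k; rewrite -[in k.+2%:R]natr1 -[in k.+1%:R]natr1.
move: (k%:R) => a a1 a2; field; rewrite a1 a2 //.
Qed.

(** Three regimes. If ord y < 0, p^iota clears every factor of the falling product and only 1/k!
    costs. If ord y > 0, absorption extracts y / k, which gains iota' and costs ord k. If ord y = 0,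
    the binomial coefficient is integral. Both ord k! and ord k are at most (k - 1) rho. *)
Lemma gbinom_vge (y : rat) (kappa k : nat) : y != 0 -> (0 < k)%N ->
  vge ((k%:R - 1) * (kappa%:R - rho_at R p y) + kappa%:R + (iotap p y)%:~R)
    (ratr (gbinom (- y) k) * (p%:R ^ (iotam p y + kappa%:Z)) ^+ k).
Proof.
move=> y0 k0; have [u uu yE] := ratr_factor y0.
have k1 : 1 <= k%:R :> R by rewrite ler1n.
have fV n : vge (- (logn p n`!)%:R) (n`!%:R^-1) by exact: vge_natV.
have logk := logn_fact_rho p R k0; have logk' := logn_le_rho p R k0.
have pk m : vge (m%:R * kappa%:R) ((p%:R ^+ kappa) ^+ m).
  by rewrite -natrM mulnC -exprM; exact: vge_expn.
rewrite /rho_at; case: (ltgtP (ordq p y) 0) => o0 /=.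
- have [I IE] : exists I : nat, - ordq p y = I%:Z by exists `|ordq p y|%N; lia.
  have -> : iotam p y = I%:Z by rewrite /iotam IE; lia.
  have -> : iotap p y = 0 by rewrite /iotap; lia.
  rewrite addr0 -PoszD -exprnP ratr_gbinomE exprD exprMn_comm; last exact: mulrC.
  have -> : (\prod_(j < k) (ratr (- y) - j%:R)) / k`!%:R * ((p%:R ^+ I) ^+ k * (p%:R ^+ kappa) ^+ k)
      = (\prod_(j < k) ((ratr (- y) - j%:R) * p%:R ^+ I)) * (k`!%:R^-1 * (p%:R ^+ kappa) ^+ k) :> Qp.
    rewrite big_split /= prodr_const card_ord.
    move: (\prod_(j < k) _) (_^-1) (_ ^+ k) (_ ^+ k) => A B C D.
    by rewrite -!mulrA; congr (_ * _); rewrite mulrCA.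
  apply: vgeMl.
    apply: (big_ind (vge 0)) => [|a b a0 b0|j _]; [exact: (vge_nat R p 1)|exact: vgeMl|].
    rewrite mulrBl; apply: vgeB.
      rewrite qp_ratrN yE mulNr; apply: vgeN; rewrite mulrAC exprnP -expfzDr // -IE subrr.
      by rewrite expr0z mul1r; exact: vge_zp.
    by apply: vgeMl; [exact: vge_nat|apply: vgeX; exact: vge_nat].
  apply: vge_le (vgeM (fV k) (pk k)); rewrite mulrBr; lra.
- have [I IE] : exists I : nat, ordq p y = I%:Z by exists `|ordq p y|%N; lia.
  have -> : iotam p y = 0 by rewrite /iotam IE; lia.
  have -> : iotap p y = I%:Z by rewrite /iotap; lia.
  case: k k0 k1 logk logk' => // k _ k1 logk logk'.
  rewrite add0r -exprnP gbinomS !qp_ratrM qp_ratrV ratr_nat qp_ratrN yE IE -exprnP.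
  have H1 : vge I%:R (- (p%:R ^+ I * zp_inj u)).
    by apply: vgeN; apply: vgeMr; [exact: vge_expn|exact: vge_zp].
  have y1 : vge 0 (ratr (- y - 1)).
    rewrite qp_ratrD !qp_ratrN -[1]/(1%:R) ratr_nat; apply: vgeB; last exact: vge_nat.
    by rewrite yE IE -exprnP; apply: vgeN; apply: vgeMl; [apply: vgeX; exact: vge_nat|exact: vge_zp].
  have H2 : vge 0 (ratr (gbinom (- y - 1) k)).
    rewrite ratr_gbinomE; rewrite -(subrr (logn p k`!)%:R); apply: vgeM; last exact: fV.
    exact: vge_falling.
  apply: vge_le (vgeM (vgeMr (vgeM H1 (vge_natV R p k.+1)) H2) (pk k.+1)).
  rewrite mulrBr; lra.
- have -> : iotam p y = 0 by rewrite /iotam o0.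
  have -> : iotap p y = 0 by rewrite /iotap o0.
  rewrite add0r -exprnP ratr_gbinomE.
  have y1 : vge 0 (ratr (- y)).
    by rewrite qp_ratrN yE o0 expr0z mul1r; apply: vgeN; exact: vge_zp.
  apply: vge_le (vgeM (vgeM (vge_falling k y1) (fV k)) (pk k)).
  rewrite subr0 addr0 subrr add0r; lra.
Qed.

End BinomialValuation.

(** * Stationary phase *)

Lemma sum_ord_mul (V : nmodType) n k (f : nat -> V) :
  \sum_(m < n * k) f m = \sum_(t < k) \sum_(a < n) f (a + n * t)%N.
Proof.
elim: k => [|k IH]; first by rewrite muln0 !big_ord0.
rewrite mulnSr big_split_ord big_ord_recr /= IH; congr (_ + _).
by apply: eq_bigr => i _; rewrite addnC.
Qed.

Lemma sum_periodic_shift (V : zmodType) X (f : nat -> V) a :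
  (forall m, f (m + X)%N = f m) -> \sum_(m < X) f (a + m)%N = \sum_(m < X) f m.
Proof.
move=> per; elim: a => [//|a IH]; rewrite -IH.
case: X per {IH} => [|X] per; first by rewrite !big_ord0.
rewrite big_ord_recr big_ord_recl /= addn0 addrC -(per a) addSnnS; congr (_ + _).
by apply: eq_bigr => i _; rewrite /bump add1n addSnnS.
Qed.

Section ExpNonTrivial.
Variable R : realType.

Lemma e_eq1 (x : R) : 0 < x < 1 -> e x != 1.
Proof.
move=> /andP[x0 x1]; apply/eqP => /(congr1 (@complex.Re R)) /= c1.
have : 0 < sin (pi * x).
  by apply: sin_gt0_pi; rewrite mulr_gt0 ?pi_gt0 //= -[ltRHS]mulr1 ltr_pM2l ?pi_gt0.
have := cos2Dsin2 (pi * x); have := cosD (pi * x) (pi * x).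
rewrite (_ : pi * x + pi * x = 2 * pi * x) ?c1; last by ring.
by rewrite -!expr2; nra.
Qed.

Lemma geom_sum_root (F : idomainType) (z : F) n : z ^+ n = 1 -> z != 1 -> \sum_(t < n) z ^+ t = 0.
Proof.
move=> zn z1; have := subrX1 z n; rewrite zn subrr => /esym/eqP.
by rewrite mulf_eq0 subr_eq0 (negPf z1) => /eqP.
Qed.

End ExpNonTrivial.

Section StationaryPhase.
Variables (R : realType) (p : prime_number).
Local Notation Zp := (padic_int p).
Local Notation Qp := (padic p).
Local Notation vge := (@vge R p).
Local Notation padic_e := (@padic_e R p).
Let pr0 := @qp_p_neq0 p.
Let p_gt0 : (0 < p)%N. Proof. exact: prime_gt0 (prime_valP p). Qed.
Let p_gt1 : (1 < p)%N. Proof. exact: prime_gt1 (prime_valP p). Qed.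

Lemma vge_divX (x : Qp) n : vge n%:R x <-> vge 0 (x / p%:R ^+ n).
Proof.
split=> [/(vge_div_expz n)|H]; first by rewrite subrr.
rewrite -[x](divfK (_ : p%:R ^+ n != 0)) ?expf_neq0 //.
by apply: vgeMl => //; exact: vge_expn.
Qed.

(** The character is faithful modulo Z_p: reduce the fractional part to r / p^N in [0, 1), where [e]
    takes the value 1 only at 0. *)
Lemma padic_e_eq1 (x : Qp) : padic_e x = 1 -> vge 0 x.
Proof.
have [a [N [z xE]]] := qp_fracP x; rewrite (padic_eE R xE) => e1.
have pN0 : (p ^ N)%:Z != 0 by rewrite eqz_nat -lt0n expn_gt0 p_gt0.
have [q [r [aE r_ge0 r_lt]]] : exists q r, [/\ a = q * (p ^ N)%:Z + r, 0 <= r & r < (p ^ N)%:Z].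
  exists (a %/ (p ^ N)%:Z)%Z, (a %% (p ^ N)%:Z)%Z; split; first exact: divz_eq.
    by rewrite modz_ge0.
  by rewrite ltz_pmod // ltz_nat expn_gt0 p_gt0.
have pR : (0 : R) < p%:R ^+ N by rewrite exprn_gt0 // ltr0n.
have r0 : r == 0.
  apply/negPn/negP => r0; have : e (r%:~R / p%:R ^+ N : R) != 1.
    apply: e_eq1; apply/andP; split.
      by rewrite divr_gt0 // ltr0z lt_neqAle eq_sym r0.
    by rewrite ltr_pdivrMr // mul1r -natrX pmulrn ltr_int.
  rewrite (_ : r%:~R / p%:R ^+ N = a%:~R / p%:R ^+ N + (- q)%:~R).
    by rewrite eD e_int mulr1 e1 eqxx.
  rewrite aE intrD intrM -pmulrn natrX mulrDl mulfK ?gt_eqF // rmorphN /=; ring.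
rewrite xE; apply: vgeD; last exact: vge_zp.
rewrite aE (eqP r0) addr0 intrM -pmulrn natrX mulfK ?expf_neq0 //; exact: vge_int.
Qed.

Lemma sum_padic_e (y : Qp) n : vge 0 y ->
  \sum_(t < p ^ n) padic_e (y * t%:R / p%:R ^+ n) =
  if `[< vge n%:R y >] then (p ^ n)%:R else 0.
Proof.
move=> y0; have -> : \sum_(t < p ^ n) padic_e (y * t%:R / p%:R ^+ n) =
    \sum_(t < p ^ n) padic_e (y / p%:R ^+ n) ^+ t.
  by apply: eq_bigr => t _; rewrite -padic_eMn mulr_natr mulrnAl.
case: asboolP => [/vge_divX yn|yn].
  rewrite padic_e_int // (eq_bigr (fun=> 1)) ?sumr_const ?card_ord // => t _.
  exact: expr1n.
apply: geom_sum_root.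
  rewrite -padic_eMn -mulrnAl -[y *+ _]mulr_natr natrX mulfK ?expf_neq0 //.
  exact: padic_e_int.
by apply/eqP => /padic_e_eq1/vge_divX.
Qed.

(** [Phi] plays the derivative of [H]. Modulo p^s, [H] is affine on cosets of p^b Z_p and quadratic
    on cosets of p^b' Z_p, where [eta] is the same for all cosets; this uniformity makes the
    resulting constant independent of h. *)
Variables (H Phi : {poly Qp}) (eta : Qp) (s b b' : nat).
Hypotheses (sE : s = (b + b')%N) (b'b : (b' <= b)%N).
Hypothesis Phi_int : forall a, vge 0 a -> vge 0 Phi.[a].
Hypothesis taylor1 : forall a t, vge 0 a -> vge 0 t ->
  vge s%:R (H.[a + p%:R ^+ b * t] - H.[a] - Phi.[a] * (p%:R ^+ b * t)).
Hypothesis taylor2 : forall a t, vge 0 a -> vge 0 t ->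
  vge s%:R (H.[a + p%:R ^+ b' * t] - H.[a] - Phi.[a] * (p%:R ^+ b' * t) - eta * t ^+ 2).
Hypothesis Phi_iso : forall a t, vge 0 a -> vge 0 t ->
  vge b'%:R (Phi.[a + t] - Phi.[a]) <-> vge b'%:R t.

Definition phase (h : int) (x : Qp) := padic_e ((H.[x] - h%:~R * x) / p%:R ^+ s).

Lemma phase_shift h a t : vge 0 a -> vge 0 t ->
  phase h (a + p%:R ^+ b * t) = phase h a * padic_e ((Phi.[a] - h%:~R) * t / p%:R ^+ b').
Proof.
move=> a0 t0; rewrite /phase -padic_eD; apply: padic_e_congr.
have -> : (Phi.[a] - h%:~R) * t / p%:R ^+ b' = (Phi.[a] - h%:~R) * (p%:R ^+ b * t) / p%:R ^+ s.
  have := @expf_neq0 Qp p%:R b pr0; have := @expf_neq0 Qp p%:R b' pr0.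
  rewrite sE exprD; move: (p%:R ^+ b) (p%:R ^+ b') (_ - _) => B B' D B'0 B0.
  by rewrite invfM -!mulrA; congr (_ * _); rewrite [RHS]mulrCA mulVKf.
rewrite -mulrDl -mulrBl; apply/vge_divX; have := taylor1 a0 t0.
congr (vge _ _); move: (_ * t) (H.[_]) (H.[_]) (Phi.[_]) (h%:~R) => T A B P h'.
ring.
Qed.

Lemma phase_period h a t : vge 0 a -> vge 0 t -> phase h (a + p%:R ^+ s * t) = phase h a.
Proof.
move=> a0 t0; rewrite sE exprD -mulrA phase_shift //; last first.
  by apply: vgeMl => //; apply: vgeX; exact: vge_nat.
rewrite [_ * (_ * t)]mulrCA [_ * (_ * _)]mulrC mulfK ?expf_neq0 // padic_e_int ?mulr1 //.
by apply: vgeMr => //; apply: vgeB; [exact: Phi_int|exact: vge_int].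
Qed.

(* Summing over the residues x + a + p^b t with t < p^b' kills all a outside p^b' Z_p,
   and on the remaining a the phase is quadratic with a coefficient independent of h. *)
Lemma stationary_phase : exists G, forall (h : int) (x : Qp),
  vge 0 x -> vge s%:R (Phi.[x] - h%:~R) ->
  \sum_(m < p ^ s) phase h m%:R = G * phase h x.
Proof.
exists ((p ^ b')%:R * \sum_(t < p ^ (b - b')) padic_e (eta * t%:R ^+ 2 / p%:R ^+ s)).
move=> h x x0 xh.
have /vge0P[z xE] := x0; have [y zE] := zp_resB z s.
have a0 : 0 <= z s by rewrite -zp_small modz_ge0 // eqz_nat -lt0n expn_gt0 p_gt0.
have {}xE : x = `|z s|%N%:R + p%:R ^+ s * zp_inj y.
  by rewrite xE {1}zE zp_injD zp_inj_int zp_injM zp_inj_expp [`|_|%N%:R]pmulrn gez0_abs.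
have natv n : vge 0 n%:R by exact: vge_nat.
have -> : \sum_(m < p ^ s) phase h m%:R = \sum_(m < p ^ s) phase h (x + m%:R).
  rewrite -(sum_periodic_shift `|z s|%N (f := fun m : nat => phase h m%:R)) => [|m].
    apply: eq_bigr => m _; rewrite xE addrAC -natrD phase_period //; exact: vge_zp.
  by rewrite natrD natrX -[p%:R ^+ s]mulr1 phase_period //; exact: (natv 1%N).
rewrite [in LHS]sE expnD (sum_ord_mul _ _ (fun m => phase h (x + m%:R))) exchange_big /=.
have inner (a : 'I_(p ^ b)) : \sum_(t < p ^ b') phase h (x + (a + p ^ b * t)%:R) =
    phase h (x + a%:R) * (if (p ^ b' %| a)%N then (p ^ b')%:R else 0).
  have xa : vge 0 (x + a%:R) by exact: vgeD.
  have pa : vge 0 (Phi.[x + a%:R] - h%:~R) by apply: vgeB; [exact: Phi_int|exact: vge_int].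
  have := sum_padic_e b' pa.
  (* At the stationary point Phi(x) = h modulo p^b', so the condition compares Phi(x + a) with
     Phi(x), and [Phi_iso] reads it as a condition on a alone. *)
  have -> : `[< vge b'%:R (Phi.[x + a%:R] - h%:~R) >] = (p ^ b' %| a)%N.
    have xh' : vge b'%:R (Phi.[x] - h%:~R).
      by apply: vge_le xh; rewrite ler_nat sE leq_addl.
    have xi := Phi_iso x0 (natv a).
    have vd : vge b'%:R (a%:R : Qp) <-> (p ^ b' %| a)%N.
      rewrite -zp_inj_nat zp_vgeP [a%:R]pmulrn zp_intE; split.
        by move/dvdz_mod0P; rewrite dvdzE.
      by move=> d; apply/dvdz_mod0P; rewrite dvdzE.
    apply/asboolP/idP => [Hv|/vd/xi Hv].
      apply/vd/xi; have := vgeB Hv xh'; congr (vge _ _).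
      by rewrite opprB addrA subrK.
    by have := vgeD Hv xh'; rewrite addrA subrK.
  move=> <-; rewrite mulr_sumr; apply: eq_bigr => t _.
  by rewrite natrD natrM natrX addrA phase_shift.
rewrite (eq_bigr _ (fun a _ => inner a)).
set f := fun a : nat => phase h (x + a%:R) * (if (p ^ b' %| a)%N then (p ^ b')%:R else 0).
have -> : \sum_(a < p ^ b) f a = \sum_(a < p ^ (b' + (b - b'))) f a by rewrite subnKC.
rewrite expnD sum_ord_mul /f.
rewrite -mulrA mulr_suml mulr_sumr; apply: eq_bigr => t _.
have [q qE] : exists q, (p ^ b')%N = q.+1 by exists (p ^ b').-1; rewrite prednK // expn_gt0 p_gt0.
rewrite qE big_ord_recl /= add0n dvdn_mulr // big1 ?addr0 => [|i _]; last first.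
  by rewrite dvdn_addl ?dvdn_mulr // gtnNdvd ?mulr0 // /bump add1n ltnS.
rewrite mulrC; congr (_ * _); rewrite -qE natrM natrX /phase -padic_eD.
apply: padic_e_congr; rewrite -mulrDl -mulrBl; apply/vge_divX.
(* The linear Taylor term at x cancels against h because Phi(x) = h modulo p^s; only the quadratic
   term is left. *)
have := vgeD (taylor2 x0 (natv t)) (vgeMr xh (vgeMl (vgeX b' (natv p)) (natv t))).
congr (vge _ _); move: (_ * t%:R) (H.[_]) (H.[_]) (Phi.[_]) (h%:~R) (eta * _) => T A B P h' E.
ring.
Qed.

End StationaryPhase.

Section Antiderivative.
Variable F : fieldType.
Hypothesis char0 : forall n, n.+1%:R != 0 :> F.

Definition antideriv (q : {poly F}) : {poly F} := \poly_(i < (size q).+1) (q`_i.-1 / i%:R).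

Lemma coef_antideriv (q : {poly F}) i : (antideriv q)`_i.+1 = q`_i / i.+1%:R.
Proof.
rewrite coef_poly ltnS; case: ltnP => // /(nth_default 0) ->; by rewrite mul0r.
Qed.

Lemma coef0_antideriv (q : {poly F}) : (antideriv q)`_0 = 0.
Proof. by rewrite coef_poly /= invr0 mulr0. Qed.

Lemma deriv_antideriv (q : {poly F}) : (antideriv q)^`() = q.
Proof. by apply/polyP => i; rewrite coef_deriv coef_antideriv -(mulr_natr (_ / _)) divfK. Qed.

Lemma coef_of_deriv (q : {poly F}) j : q`_j.+1 = (deriv q)`_j / j.+1%:R.
Proof. by rewrite coef_deriv -(mulr_natr q`_j.+1) mulfK. Qed.

(** The denominator j + 1 created by integration is traded for i + 2, the exponent of x in the same
    term, so that a small x can absorb it however large j is. *)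
Lemma taylor_monomial (a x : F) j :
  ((a + x) ^+ j.+1 - a ^+ j.+1) / j.+1%:R - a ^+ j * x =
  \sum_(i < j) ('C(j, i.+1)%:R / i.+2%:R) * a ^+ (j - i.+1) * x ^+ i.+2.
Proof.
rewrite exprDn big_ord_recl /= subn0 expr0 mulr1 bin0 mulr1n addrAC subrr add0r.
rewrite mulr_suml big_ord_recl /= /bump /= add1n subSS subn0 expr1 bin1.
rewrite -mulr_natr mulfK // addrAC subrr add0r; apply: eq_bigr => i _.
rewrite /bump /= !add1n subSS -mulr_natl.
have E : 'C(j.+1, i.+2)%:R / j.+1%:R = 'C(j, i.+1)%:R / i.+2%:R :> F.
  apply/eqP; rewrite eqr_div // -!natrM; apply/eqP; congr (_%:R).
  by rewrite [RHS]mulnC mulnC -mul_bin_diag.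
rewrite -E; move: ('C(_, _)%:R) (_^-1) (a ^+ _) (x ^+ _) => A B C D; ring.
Qed.

Lemma horner_antideriv_taylor (q : {poly F}) a x :
  (antideriv q).[a + x] - (antideriv q).[a] - q.[a] * x =
  \sum_(j < size q) \sum_(i < j)
     q`_j * ('C(j, i.+1)%:R / i.+2%:R * a ^+ (j - i.+1) * x ^+ i.+2).
Proof.
have hE y : (antideriv q).[y] = \sum_(j < size q) q`_j * (y ^+ j.+1 / j.+1%:R).
  rewrite (@horner_coef_wide _ (size q).+1) ?size_poly // big_ord_recl.
  rewrite coef0_antideriv mul0r add0r; apply: eq_bigr => j _.
  by rewrite lift0 coef_antideriv mulrAC mulrA.
rewrite !hE horner_coef mulr_suml -!sumrB; apply: eq_bigr => j _.
rewrite -mulr_sumr -taylor_monomial -mulrA -!mulrBr; congr (_ * (_ - _)).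
by rewrite mulrBl.
Qed.

End Antiderivative.

(** * Stationary phase from coefficient bounds *)

Section TaylorBounds.
Variables (R : realType) (p : prime_number).
Local Notation Zp := (padic_int p).
Local Notation Qp := (padic p).
Local Notation vge := (@vge R p).
Local Notation padic_e := (@padic_e R p).
Let pr0 := @qp_p_neq0 p.
Let p_gt0 : (0 < p)%N. Proof. exact: prime_gt0 (prime_valP p). Qed.
Let p_gt1 : (1 < p)%N. Proof. exact: prime_gt1 (prime_valP p). Qed.
Let char0 n : n.+1%:R != 0 :> Qp. Proof. exact: qp_natr_neq0. Qed.

Lemma horner_vge0 (q : {poly Qp}) a : (forall j, vge 0 q`_j) -> vge 0 a -> vge 0 q.[a].
Proof.
by move=> q0 a0; rewrite horner_coef; apply: vge_sum => i _; apply: vgeMl => //; exact: vgeX.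
Qed.

Lemma vge_unitD (u : Zp) x : u \is a GRing.unit -> vge 1 x -> 
  exists2 v : Zp, v \is a GRing.unit & zp_inj u + x = zp_inj v.
Proof.
move=> uu x1; have /vge0P[z zE] : vge 0 x by apply: vge_le x1; exact: ler01.
move: x1; rewrite zE => /(zp_vgeP _ _ 1%N) z1.
exists (u + z); last by rewrite zp_injD.
by move: uu; rewrite !zp_unitE zp_addE z1 addr0 zp_small.
Qed.

Variables (Phi : {poly Qp}) (c1 : Zp).
Hypotheses (Phi0 : Phi`_0 = 0) (Phi1 : Phi`_1 = zp_inj c1) (c1u : c1 \is a GRing.unit).
Hypothesis Phi_ge1 : forall j, (1 < j)%N -> vge 1 Phi`_j.

Let Phi_coef0 j : vge 0 Phi`_j.
Proof.
case: j => [|[|j]]; [by rewrite Phi0; exact: vge0|by rewrite Phi1; exact: vge_zp|].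
by apply: vge_le (Phi_ge1 (isT : (1 < j.+2)%N)); exact: ler01.
Qed.

(** The difference quotient is [c1] plus multiples of p, hence a unit. *)
Lemma horner_isometry n a t : vge 0 a -> vge 0 t ->
  vge n%:R (Phi.[a + t] - Phi.[a]) <-> vge n%:R t.
Proof.
move=> a0 t0; have at0 : vge 0 (a + t) by exact: vgeD.
have [w w1 wE] : exists2 w, vge 1 w & Phi.[a + t] - Phi.[a] = t * (zp_inj c1 + w).
  have H (q : {poly Qp}) : (forall j, vge 1 q`_j) -> exists2 w, vge 1 w & q.[a + t] - q.[a] = t * w.
    move=> q1; exists (\sum_(j < size q) q`_j * \sum_(i < j) (a + t) ^+ (j.-1 - i) * a ^+ i).
      apply: vge_sum => j _; apply: vgeMr => //; apply: vge_sum => i _.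
      by apply: vgeMl; exact: vgeX.
    rewrite !horner_coef -sumrB mulr_sumr; apply: eq_bigr => j _.
    by rewrite -mulrBr subrXX [a + t]addrC addrK mulrCA.
  have [|w w1 wE] := H (Phi - (zp_inj c1) *: 'X).
    move=> [|[|j]]; rewrite coefB coefZ coefX.
    - by rewrite Phi0 mulr0 subrr; exact: vge0.
    - by rewrite Phi1 mulr1 subrr; exact: vge0.
    - by rewrite mulr0 subr0; exact: Phi_ge1.
  exists w => //; rewrite mulrDr -wE !hornerD !hornerN !hornerZ !hornerX.
  move: (Phi.[_]) (Phi.[_]) (zp_inj c1) => A B C; ring.
have [v vu vE] := vge_unitD c1u w1; rewrite wE vE; split=> H.
  have := vgeMr H (vge_unitV R vu); rewrite mulfK //.
  by rewrite zp_inj0; apply: contraTneq vu => ->; rewrite unitr0.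
by apply: vgeMr => //; exact: vge_zp.
Qed.

Variables (s b b' : nat).
Hypotheses (sE : s = (b + b')%N) (b'b : (b' <= b)%N) (sb : (s + logn p 2 <= 2 * b)%N).
Hypothesis Phi_cubic : forall i j, (0 < i)%N -> (i < j)%N ->
  vge s%:R (Phi`_j / i.+2%:R * (p%:R ^+ b') ^+ i.+2).
Hypothesis Phi_quad : forall j, (1 < j)%N ->
  vge s%:R (Phi`_j * j%:R / 2%:R * (p%:R ^+ b') ^+ 2).

(** At scale p^b the quadratic Taylor terms vanish modulo p^s because s + ord_p 2 <= 2b, and the
    others by [Phi_cubic]. At scale p^b' the only survivor is the term of Phi_1, which gives eta =
    Phi_1 p^(2b') / 2; [Phi_quad] removes the dependence of the second derivative on the base
    point. *)
Lemma stationary_phase_coef :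
  (forall h x t, vge 0 x -> vge 0 t ->
    phase R (antideriv Phi) s h (x + p%:R ^+ s * t) = phase R (antideriv Phi) s h x) /\
  exists G, forall (h : int) (x : Qp), vge 0 x -> vge s%:R (Phi.[x] - h%:~R) ->
  \sum_(m < p ^ s) phase R (antideriv Phi) s h m%:R = G * phase R (antideriv Phi) s h x.
Proof.
have natv n : vge 0 n%:R by exact: vge_nat.
have pX (c : nat) n : vge 0 ((p%:R ^+ c) ^+ n : Qp) by apply: vgeX; apply: vgeX.
have rearr (f c y a q t : Qp) n : f * (c * y * a * (q * t) ^+ n) = f * y * q ^+ n * (c * a * t ^+ n).
  by rewrite exprMn_comm; [ring|exact: mulrC].
have Phi_int a : vge 0 a -> vge 0 Phi.[a] by exact: horner_vge0.
have taylor1 a t : vge 0 a -> vge 0 t -> vge s%:R ((antideriv Phi).[a + p%:R ^+ b * t] -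
    (antideriv Phi).[a] - Phi.[a] * (p%:R ^+ b * t)).
  move=> a0 t0; rewrite horner_antideriv_taylor //.
  apply: vge_sum => j _; apply: vge_sum => i _.
  have H : vge s%:R (Phi`_j / i.+2%:R * (p%:R ^+ b) ^+ i.+2).
    case: (nat_of_ord i) (ltn_ord i) => [|i'] ij.
      have := vgeM (vgeM (Phi_coef0 j) (vge_natV R p 2)) (vge_expn R p (b * 2)).
      rewrite exprM; apply: vge_le.
      by move: sb; rewrite -(ler_nat R) natrD !natrM; lra.
    rewrite -(subnK b'b) exprD exprMn_comm; last exact: mulrC.
    by rewrite mulrCA; apply: vgeMl; [exact: pX|exact: Phi_cubic].
  rewrite rearr; apply: vgeMr => //.
  by apply: vgeMl; [apply: vgeMl; [exact: natv|exact: vgeX]|exact: vgeX].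
split; first by move=> h x t; exact: (phase_period sE Phi_int taylor1).
apply: (stationary_phase sE b'b (eta := Phi`_1 / 2%:R * (p%:R ^+ b') ^+ 2) Phi_int taylor1).
- move=> a t a0 t0; rewrite horner_antideriv_taylor //.
  set Y := _ * t ^+ 2.
  have YE : Y = \sum_(j < size Phi) (if j == 1%N :> nat then Y else 0).
    rewrite -big_mkcond (big_ord1_eq _ (fun=> Y)); case: ltnP => // /(nth_default 0) f1.
    by rewrite /Y f1 !mul0r.
  rewrite {1}YE -sumrB; apply: vge_sum => j _.
  case: (nat_of_ord j) => [|[|j']] /=.
  + by rewrite big_ord0 subrr; exact: vge0.
  + rewrite big_ord1 binn rearr subnn expr0 mulr1 mul1r subrr; exact: vge0.
  + rewrite subr0; apply: vge_sum => i _; rewrite rearr.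
    case: (nat_of_ord i) (ltn_ord i) => [|i'] ij; last first.
      apply: vgeMr; first exact: (@Phi_cubic i'.+1 j'.+2).
      by apply: vgeMl; [apply: vgeMl; [exact: natv|exact: vgeX]|exact: vgeX].
    rewrite bin1; have := Phi_quad (isT : (1 < j'.+2)%N).
    have H : vge 0 (a ^+ (j'.+2 - 1) * t ^+ 2) by apply: vgeMl; apply: vgeX.
    move/vgeMr/(_ H); congr (vge _ _).
    move: (_ ^+ (_ - _)) (t ^+ 2) ((p%:R ^+ b') ^+ 2) (_^-1) (j'.+2%:R) Phi`_j'.+2 => A B C D E G.
    ring.
- by move=> a t; exact: horner_isometry.
Qed.

End TaylorBounds.

(** * Stationary phase for phases of class F *)

Section ClassStationaryPhase.
Variables (R : realType) (p : prime_number).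
Local Notation Zp := (padic_int p).
Local Notation Qp := (padic p).
Local Notation vge := (@vge R p).
Local Notation rho := (rho R p).
Let p_gt0 : (0 < p)%N. Proof. exact: prime_gt0 (prime_valP p). Qed.
Let p_gt1 : (1 < p)%N. Proof. exact: prime_gt1 (prime_valP p). Qed.

Lemma rho_p2 : p = 2%N :> nat -> rho = 1.
Proof. by move=> p2; rewrite /Defs.rho p2 (_ : 2%:R - 1 = 1) ?invr1 //; lra. Qed.

Lemma rho_p3 : p = 3%N :> nat -> rho = 2^-1.
Proof. by move=> p3; rewrite /Defs.rho p3 (_ : 3%:R - 1 = 2) //; lra. Qed.

Lemma rho_p5 : (4 < p)%N -> rho <= 4^-1.
Proof.
move=> p5; rewrite /Defs.rho lef_pV2 ?posrE ?subr_gt0 ?ltr1n //.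
by rewrite lerBrDr (_ : 4 + 1 = 5%:R) ?ler_nat //; lra.
Qed.

Lemma prime_cases : [\/ p = 2%N :> nat, p = 3%N :> nat | (4 < p)%N].
Proof.
by have := prime_valP p; case: (prime_val p) => [|[|[|[|[|q]]]]] // _; [constructor 1|constructor 2|constructor 3].
Qed.

Variables (Phi : {poly Qp}) (A E : nat -> Qp) (c1 : Zp) (kappa s : nat).
Hypotheses (Phi0 : Phi`_0 = 0) (Phi1 : Phi`_1 = zp_inj c1) (c1u : c1 \is a GRing.unit).
Hypothesis PhiE : forall j, (1 < j)%N -> Phi`_j = A j + E j.
Hypothesis A_ge : forall j, (1 < j)%N -> vge ((j%:R - 1) * (kappa%:R - rho)) (A j).
Hypothesis E_ge : forall j, (1 < j)%N -> vge (1 + (j%:R - 1) * rho) (E j).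
Hypotheses (kappa_ge : (1 + logn p 4 <= kappa)%N) (s_ge : (1 + logn p 12 <= s)%N).

Lemma Phi_vge (j : nat) (m : int) : (1 < j)%N ->
  m%:~R - 1 < (j%:R - 1) * (kappa%:R - rho) -> m%:~R - 1 < 1 + (j%:R - 1) * rho ->
  vge m%:~R Phi`_j.
Proof.
move=> j1 mA mE; rewrite PhiE //; apply: vgeD.
  exact: vge_ceil mA (A_ge j1).
exact: vge_ceil mE (E_ge j1).
Qed.

(** [b'] is the largest integer with 2b' <= s - ord_p 2, that is, with s + ord_p 2 <= 2b. *)
Let eps := logn p 2.
Let b' := ((s - eps)./2)%N.
Let b := (s - b')%N.

Let s_le : (eps <= s)%N -> (s <= b'.*2 + 1 + eps)%N.
Proof. by rewrite /b' => ?; lia. Qed.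

Let cubic i j : (eps <= s)%N -> (i < j)%N ->
  1 + (logn p 2)%:R + (logn p i.+2)%:R - i%:R * b'%:R - 1 < (j%:R - 1) * (kappa%:R - rho) ->
  1 + (logn p 2)%:R + (logn p i.+2)%:R - i%:R * b'%:R - 1 < 1 + (j%:R - 1) * rho ->
  (1 < j)%N ->
  vge s%:R (Phi`_j / i.+2%:R * (p%:R ^+ b') ^+ i.+2).
Proof.
move=> es ij hA hE j1; set L := logn p i.+2.
(* This is the order required of Phi_j: adding (i + 2) b' - ord(i + 2) gives 2b' + 1 + ord_p 2,
   which is at least s. *)
pose m : int := 1 + (logn p 2)%:Z + L%:Z - (i * b')%N%:Z.
have mR : m%:~R = 1 + (logn p 2)%:R + L%:R - i%:R * b'%:R :> R.
  by rewrite /m intrD rmorphN /= PoszM intrM !intrD.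
have v1 : vge m%:~R Phi`_j by apply: Phi_vge; rewrite ?mR.
have := vgeM (vgeM v1 (vge_natV R p i.+2)) (vge_expn R p (b' * i.+2)).
rewrite exprM; apply: vge_le; rewrite mR -/L.
have := s_le es; rewrite -(ler_nat R) !natrD -mul2n natrM => sR.
rewrite natrM -/eps -!natr1; move: sR; rewrite /eps; lra.
Qed.

Let quad j c : (eps <= s)%N -> vge (c%:R) (Phi`_j) -> (s <= b'.*2 + c + logn p j - eps)%N ->
  (eps <= c)%N -> (0 < j)%N ->
  vge s%:R (Phi`_j * j%:R / 2%:R * (p%:R ^+ b') ^+ 2).
Proof.
move=> es vc sc ec j0; have [u _ ->] := natr_factor p j0.
have := vgeM (vgeM (vgeM vc (vgeMr (vge_expn R p (logn p j)) (vge_zp R u))) (vge_natV R p 2))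
  (vge_expn R p (b' * 2)).
rewrite exprM; apply: vge_le; rewrite -/eps.
rewrite -natrD -natrB ?(leq_trans ec) ?leq_addr // -natrD ler_nat; lia.
Qed.

Lemma stationary_phase_class :
  (forall h x t, vge 0 x -> vge 0 t ->
    phase R (antideriv Phi) s h (x + p%:R ^+ s * t) = phase R (antideriv Phi) s h x) /\
  exists G, forall (h : int) (x : Qp), vge 0 x -> vge s%:R (Phi.[x] - h%:~R) ->
  \sum_(m < p ^ s) phase R (antideriv Phi) s h m%:R = G * phase R (antideriv Phi) s h x.
Proof.
have rho0 := rho_gt0 p R; have rho1 := rho_le1 p R.
have natR i : (0 : R) <= i%:R by [].
have ltR i j : (i < j)%N -> (i%:R : R) + 1 <= j%:R by rewrite natr1 ler_nat.
have [p2|p_odd] := eqVneq (p : nat) 2%N.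
  have rE := rho_p2 p2.
  have k3 : (3 <= kappa)%N by move: kappa_ge; rewrite p2.
  have s3 : (3 <= s)%N by move: s_ge; rewrite p2.
  have epsE : eps = 1%N by rewrite /eps p2.
  have es : (eps <= s)%N by lia.
  have b'1 : (1 <= b')%N by rewrite /b'; lia.
  have b'1R : 1 <= b'%:R :> R by rewrite ler1n.
  have k3R : 3 <= kappa%:R :> R by rewrite (ler_nat R 3).
  apply: (@stationary_phase_coef _ _ Phi c1 _ _ _ _ s b b') => //.
  - by move=> j j1; have := ltR _ _ j1 => j1R; apply: (Phi_vge (m := 1)) => //; rewrite rE; nra.
  - by rewrite subnK // /b'; lia.
  - by rewrite /b /b'; lia.
  - by rewrite -/eps epsE /b /b'; lia.
  - move=> i j i0 ij; have j1 : (1 < j)%N by lia.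
    have HL : (logn p i.+2 < 2 * i)%N.
      have : (logn p i.+2 < i.+2)%N.
        by apply: leq_trans (dvdn_leq _ (pfactor_dvdnn p i.+2)) => //; exact: ltn_expl.
      by case: i i0 {ij} => [|[|i]] // _; [rewrite p2|lia].
    have LR := ltR _ _ HL; rewrite natrM in LR.
    have iR : 1 <= i%:R :> R by rewrite ler1n.
    have ijR := ltR _ _ ij.
    have ibR : i%:R <= i%:R * b'%:R :> R by rewrite ler_peMr.
    have kR : i%:R * 2 <= (j%:R - 1) * (kappa%:R - 1) :> R by apply: ler_pM => //; lra.
    by apply: cubic => //; rewrite -/eps epsE rE; lra.
  (* For p = 2 the halved quadratic term is paid for at j = 2 by the factor j itself, and from j = 3
     on by ord Phi_j >= 3. *)
  - move=> j j1; have j1R := ltR _ _ j1; have [j2|j3] := ltnP 2 j; last first.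
      have -> : j = 2%N by lia.
      apply: (quad (c := 2)) => //; last by rewrite epsE.
        by apply: (Phi_vge (m := 2)) => //; rewrite rE; nra.
      have := s_le es; rewrite epsE p2 (_ : logn 2 2 = 1%N) //; lia.
    have j2R := ltR _ _ j2.
    apply: (quad (c := 3)) => //; [|by have := s_le es; rewrite epsE; lia|by rewrite epsE|lia].
    by apply: (Phi_vge (m := 3)) => //; rewrite rE; nra.
have epsE : eps = 0%N.
  rewrite /eps lognE; case: and3P => // -[_ _]; rewrite dvdn_prime2 ?prime_valP //.
  by rewrite (negPf p_odd).
have es : (eps <= s)%N by rewrite epsE.
have k1R : 1 <= kappa%:R :> R by rewrite ler1n; lia.
have rho2 : rho <= 2^-1.
  case: prime_cases => [/eqP|/rho_p3 ->|/rho_p5] //; first by rewrite (negPf p_odd).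
  by move=> h; apply: le_trans h _; lra.
have kr j : (1 < j)%N -> (j%:R - 1) * (1 - rho) <= (j%:R - 1) * (kappa%:R - rho) :> R.
  by move=> j1; have j1R := ltR _ _ j1; rewrite ler_wpM2l //; lra.
have v1 j : (1 < j)%N -> vge 1 Phi`_j.
  move=> j1; have j1R := ltR _ _ j1; have krj := kr _ j1.
  by apply: (Phi_vge (m := 1)) => //; nra.
apply: (@stationary_phase_coef _ _ Phi c1 _ _ _ _ s b b') => //.
- by rewrite subnK // /b'; lia.
- by rewrite /b /b'; lia.
- by rewrite -/eps epsE /b /b'; lia.
- move=> i j i0 ij; have j1 : (1 < j)%N by lia.
  have LR : (logn p i.+2)%:R <= (i%:R + 1) * rho.
    by have := logn_le_rho p R (isT : (0 < i.+2)%N); rewrite -!natr1 addrK.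
  have iR : 1 <= i%:R :> R by rewrite ler1n.
  have ijR := ltR _ _ ij.
  have krj := kr _ j1.
  have ir : i%:R * rho <= (j%:R - 1) * rho by rewrite ler_wpM2r //; lra.
  have ir' : i%:R * (1 - rho) <= (j%:R - 1) * (1 - rho) by rewrite ler_wpM2r //; lra.
  have ib0 : 0 <= i%:R * b'%:R :> R by rewrite mulr_ge0.
  apply: cubic => //; rewrite -/eps epsE; last by lra.
  suff : (logn p i.+2)%:R - i%:R * b'%:R < i%:R * (1 - rho) by lra.
  (* For p >= 5 the inequality holds even with b' = 0, since rho <= 1/4. For p = 3 one needs b' >=
     1, hence s >= 2: this is the factor 3 of 12. *)
  case: prime_cases => [/eqP|p3|/rho_p5 r4].
  + by rewrite (negPf p_odd).
  + have s2 : (2 <= s)%N by move: s_ge; rewrite p3.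
    have b'1 : (1 <= b')%N by rewrite /b' epsE subn0 half_gt0.
    have ibR : i%:R <= i%:R * b'%:R :> R by rewrite ler_peMr // ler1n.
    have rE := rho_p3 p3; rewrite rE in LR *; lra.
  + nra.
- move=> j j1; apply: (quad (c := 1)) => //; [exact: v1| |by rewrite epsE|lia].
  by have := s_le es; rewrite epsE; lia.
Qed.

End ClassStationaryPhase.

(** * The dual power series *)

Section TruncatedSeries.
Local Open Scope classical_set_scope.
Variables (R : realType) (p : prime_number).
Local Notation Zp := (padic_int p).
Local Notation Qp := (padic p).
Local Notation vge := (@vge R p).
Local Notation rho := (rho R p).
Let pr0 := @qp_p_neq0 p.
Let p_gt0 : (0 < p)%N. Proof. exact: prime_gt0 (prime_valP p). Qed.
Let p_gt1 : (1 < p)%N. Proof. exact: prime_gt1 (prime_valP p). Qed.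

(** If a = ord_p(j + 1), then C(a, 2) <= 2^a <= j + 1, and the left side outgrows every multiple of
    a. So a is at most half of (j + 1) la up to a constant. *)
Lemma logn_sublinear (la c : R) : 0 < la -> exists K, forall j, (K < j)%N ->
  c <= (j%:R - 1) * la - (logn p j.+1)%:R.
Proof.
move=> la0; pose M := (Num.truncn (2 + 4 / la)).+1.
have ML : 2 + 4 / la <= M%:R by exact/ltW/truncnS_gt.
have la4 : 0 < 4 / la by rewrite divr_gt0.
have lE a : (M <= a)%N -> a%:R * 2 / la <= 'C(a, 2)%:R :> R.
  move=> Ma; have MR : M%:R <= a%:R :> R by rewrite ler_nat.
  have : 'C(a, 2)%:R * 2 = a%:R * (a%:R - 1) :> R.
    have := bin2 a; have := mul_bin_diag a 1; rewrite bin1.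
    move=> E _; rewrite -natrM mulnC -E natrM -subn1 natrB //.
    by apply: leq_trans Ma; rewrite /M.
  have : a%:R * (4 / la) <= a%:R * (a%:R - 1) :> R by rewrite ler_wpM2l //; lra.
  have -> : a%:R * 2 / la = a%:R * (4 / la) / 2 :> R by field; lra.
  lra.
have main j : (logn p j.+1)%:R <= (j%:R + 1) * la / 2 + M%:R.
  set a := logn p j.+1.
  have j0 : 0 <= j%:R :> R by [].
  have [aM|Ma] := leqP a M.
    have : (a%:R : R) <= M%:R by rewrite ler_nat.
    have : 0 <= (j%:R + 1) * la / 2 by rewrite !mulr_ge0 ?addr_ge0 // ltW.
    lra.
  have C2 : ('C(a, 2) <= j.+1)%N.
    apply: leq_trans (_ : 2 ^ a <= _)%N; last first.
      apply: leq_trans (dvdn_leq _ (pfactor_dvdnn p j.+1)) => //.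
      by rewrite leq_exp2r //; apply: leq_trans Ma.
    elim: (a) => // n IH; rewrite binS bin1 expnS mul2n -addnn leq_add //.
    exact: ltnW (ltn_expl _ _).
  have := lE a (ltnW Ma); have : 'C(a, 2)%:R <= j%:R + 1 :> R by rewrite natr1 ler_nat.
  have M0 : 0 <= M%:R :> R by [].
  move=> h1 h2; have h3 := le_trans h2 h1.
  have : a%:R <= (j%:R + 1) * la / 2 :> R.
    by move: h3; rewrite ler_pdivrMr //; lra.
  lra.
pose K := Num.truncn ((c + M%:R + 2 * la) * 2 / la).
exists K => j Kj; have := main j.
have : (c + M%:R + 2 * la) * 2 / la <= j%:R.
  apply: ltW; apply: lt_le_trans (truncnS_gt _) _; by rewrite ler_nat.
rewrite ler_pdivrMr //; nra.
Qed.

Lemma qp_vge_nat (x : Qp) : exists n : nat, vge (- n%:R) x.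
Proof.
have [->|/qp_factor[m [u [_ ->]]]] := eqVneq x 0; first by exists 0%N; exact: vge0.
exists `|m|%N; exists m, u; split=> //.
by rewrite pmulrn -rmorphN ler_int; lia.
Qed.

(** Only finitely many coefficients fail to be integral, so one power of p clears all denominators;
    this yields the first clause of [classF_with]. *)
Lemma bounded_series (f : nat -> Qp) :
  (forall N : nat, \forall n \near \oo, vge N%:R (f n)) ->
  exists (c : Qp) (a : nat -> Zp), [/\ c != 0, I0 R a & forall k, f k = c * zp_inj (a k)].
Proof.
move=> f0; have [k0 _ k0P] := f0 0%N.
have /choice[N NP] : forall k, exists n : nat, vge (- n%:R) (f k) by move=> k; exact: qp_vge_nat.
pose M := (\max_(k < k0) N k)%N.
have fM k : vge (- M%:R) (f k).
  have [kk0|kk0] := ltnP k k0.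
    by apply: vge_le (NP k); rewrite lerN2 ler_nat; exact: (leq_bigmax (Ordinal kk0)).
  by apply: vge_le (k0P k kk0); rewrite oppr_le0.
have /choice[a aP] : forall k, exists z : Zp, f k = (p%:R ^+ M)^-1 * zp_inj z.
  move=> k; have := vgeM (vge_expn R p M) (fM k); rewrite subrr => /vge0P[z zE].
  by exists z; rewrite -zE mulKf ?expf_neq0.
exists (p%:R ^+ M)^-1, a; split=> //; first by rewrite invr_neq0 ?expf_neq0.
apply/(padic_norm_cvg0P R (fun k => zp_inj (a k))) => L.
have [k1 _ k1P] := f0 L; exists k1 => // k /= kk1.
have -> : zp_inj (a k) = p%:R ^+ M * f k by rewrite aP mulVKf ?expf_neq0.
by apply: vgeMl; [apply: vgeX; exact: vge_nat|exact: k1P].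
Qed.

Lemma I0_ge (la : R) (a : nat -> Zp) : I0_ la a <-> I0 R a /\ forall k, vge (k%:R * la) (zp_inj (a k)).
Proof.
split=> -[a0 ak]; split=> // k; last first.
  by apply/(padic_ord_geP R); apply: vge_ceil (ak k); have := ceilB1_lt (k%:R * la); rewrite intrB.
by apply: vge_le ((padic_ord_geP R _ _).1 (ak k)); exact: ceil_ge.
Qed.

Lemma coef_trunc_scaleX (F : fieldType) K (b : nat -> F) (c : F) :
  trunc_series K b \Po (c *: 'X) = trunc_series K (fun k => b k * c ^+ k).
Proof.
rewrite /trunc_series !poly_def raddf_sum; apply: eq_bigr => k _.
by rewrite /= comp_polyZ comp_Xn_poly exprZn scalerA.
Qed.

Lemma coef_trunc_series (F : fieldType) K (b : nat -> F) k :
  (trunc_series K b)`_k = if (k <= K)%N then b k else 0.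
Proof. by rewrite coef_poly ltnS. Qed.

End TruncatedSeries.

Section BinomialSeriesInverse.
Local Open Scope classical_set_scope.
Variables (R : realType) (p : prime_number).
Local Notation Zp := (padic_int p).
Local Notation Qp := (padic p).
Local Notation vge := (@vge R p).
Local Notation rho := (rho R p).
Local Notation pq := (p%:R : Qp).
Let pr0 := @qp_p_neq0 p.
Let p_gt0 : (0 < p)%N. Proof. exact: prime_gt0 (prime_valP p). Qed.
Let p_gt1 : (1 < p)%N. Proof. exact: prime_gt1 (prime_valP p). Qed.
Let char0 n : n.+1%:R != 0 :> Qp. Proof. exact: qp_natr_neq0. Qed.

Lemma ordqV (y : rat) : ordq p y^-1 = - ordq p y.
Proof.
have [->|y0] := eqVneq y 0; first by rewrite invr0 /ordq (numq_int 0) (denq_int 0) logn0 logn1.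
have cop : coprime `|denq y| `|numq y| by rewrite coprime_sym; exact: coprime_num_den.
have nE : `|numq y^-1|%N = `|denq y|%N.
  rewrite -[y in LHS]divq_num_den invf_div coprimeq_num // abszM absz_sg.
  by rewrite numq_eq0 y0 mul1n.
have dE : `|denq y^-1|%N = `|numq y|%N.
  by rewrite -[y in LHS]divq_num_den invf_div coprimeq_den // numq_eq0 (negPf y0) absz_id.
by rewrite /ordq nE dE opprB.
Qed.

Lemma iotamV (y : rat) : iotam p y^-1 = iotap p y.
Proof. by rewrite /iotam /iotap ordqV opprK. Qed.

Lemma iotapV (y : rat) : iotap p y^-1 = iotam p y.
Proof. by rewrite /iotam /iotap ordqV. Qed.

Lemma rho_atV (y : rat) : rho_at R p y^-1 = rho_at R p y.
Proof. by rewrite /rho_at ordqV oppr_eq0. Qed.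

Lemma iota_sub (y : rat) : iotap p y - iotam p y = ordq p y.
Proof. by rewrite /iotam /iotap; lia. Qed.

Variables (y : rat) (kappa : nat) (omega omega' : Zp).
Hypotheses (y0 : y != 0) (omega_u : omega \is a GRing.unit) (omega'_u : omega' \is a GRing.unit).

Let om0 : zp_inj omega != 0.
Proof. by rewrite zp_inj0; apply: contraTneq omega_u => ->; rewrite unitr0. Qed.
Let om'0 : zp_inj omega' != 0.
Proof. by rewrite zp_inj0; apply: contraTneq omega'_u => ->; rewrite unitr0. Qed.

Let Cin : Qp := pq ^ (iotam p y + kappa%:Z) * zp_inj omega.
Let Cout : Qp := pq ^ (kappa%:Z + iotap p y).

Let Cin0 : Cin != 0. Proof. exact: (mulf_neq0 (expfz_neq0 _ pr0) om0). Qed.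
Let Cout0 : Cout != 0. Proof. exact: (expfz_neq0 _ pr0). Qed.

(* coefficients of omega' ((1 + Cin t)^(-y) - 1) / Cout and of its compositional
   inverse ((1 + Cout t / omega')^(-1/y) - 1) / Cin *)
Definition derivA k : Qp :=
  if k == 0%N then 0 else zp_inj omega' * (ratr (gbinom (- y) k) * Cin ^+ k) / Cout.
Definition inverseB k : Qp :=
  if k == 0%N then 0 else ratr (gbinom (- y^-1) k) * (Cout / zp_inj omega') ^+ k / Cin.

Lemma derivA_ge k : (0 < k)%N -> vge ((k%:R - 1) * (kappa%:R - rho_at R p y)) (derivA k).
Proof.
move=> k0; rewrite /derivA eqn0Ngt k0 /=.
have := vge_div_expz (kappa%:Z + iotap p y) (@gbinom_vge R p y kappa k y0 k0).
move=> /(vgeMl (vgeX k (vge_zp R omega))) /(vgeMl (vge_zp R omega')).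
move=> /(vge_le (_ : (k%:R - 1) * (kappa%:R - rho_at R p y) <= _)) H.
move: H; rewrite intrD -[kappa%:~R]/(kappa%:R) => /(_ ltac:(lra)).
congr (vge _ _); rewrite /Cin exprMn_comm; last exact: mulrC.
rewrite -/Cout; move: (zp_inj omega ^+ k) (zp_inj omega') (ratr _) (_ ^+ k) (Cout^-1) => a b c d e.
by ring.
Qed.

(** Passing to 1/y swaps iota and iota' and keeps rho_p(y), so [Cin] and [Cout] exchange roles and
    the slope is the same as for [derivA]. *)
Lemma inverseB_ge k : (0 < k)%N -> vge ((k%:R - 1) * (kappa%:R - rho_at R p y)) (inverseB k).
Proof.
move=> k0; rewrite /inverseB eqn0Ngt k0 /=.
have y'0 : y^-1 != 0 by rewrite invr_eq0.
have := vge_div_expz (iotam p y + kappa%:Z) (@gbinom_vge R p y^-1 kappa k y'0 k0).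
move=> /(vgeMl (vgeX k (vge_unitV R omega'_u))) /(vgeMl (vge_unitV R omega_u)).
rewrite rho_atV iotamV iotapV intrD -[kappa%:~R]/(kappa%:R).
move=> /(vge_le (_ : (k%:R - 1) * (kappa%:R - rho_at R p y) <= _)) H.
move: H => /(_ ltac:(lra)).
congr (vge _ _); rewrite /Cin /Cout exprMn_comm; last exact: mulrC.
rewrite invfM [kappa%:Z + _]addrC; move: ((zp_inj omega')^-1 ^+ k) (zp_inj omega)^-1 (ratr _) (_ ^+ k) (_^-1) => a b c d e.
by ring.
Qed.

(** The coefficient is - y omega omega' p^(iota - iota'), and iota' - iota is the order of y. *)
Lemma derivA1 : exists2 v : Zp, v \is a GRing.unit & derivA 1 = zp_inj v.
Proof.
have [v vu yE] := ratr_factor p y0.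
exists (- omega' * omega * v); first by rewrite !unitrM unitrN omega_u omega'_u.
rewrite /derivA /= expr1 (_ : gbinom (- y) 1 = - y); last first.
  by rewrite /gbinom big_ord1 subr0 divr1.
rewrite qp_ratrN yE !zp_injM zp_injN /Cin /Cout -iota_sub.
have := @expfz_neq0 Qp p%:R (kappa%:Z + iotap p y) pr0.
rewrite (_ : kappa%:Z + iotap p y = (iotap p y - iotam p y) + (iotam p y + kappa%:Z)); last by lia.
rewrite (expfzDr _ _ pr0); move: (pq ^ (iotap p y - _)) (pq ^ _) (zp_inj omega) (zp_inj omega') (zp_inj v).
move=> P Q a b c PQ0; apply: (mulIf PQ0); rewrite divfK //; ring.
Qed.

Lemma inverseB_derivA K : 'X^(K.+1) %|
  (trunc_series K inverseB \Po trunc_series K derivA) - 'X.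
Proof.
have aa' : ratr (- y^-1) * ratr (- y) = 1 :> Qp.
  by rewrite -qp_ratrM mulrNN mulVf // -(mulr1z 1) ratr_int.
have comp := trunc_series_comp char0 K aa' (gbinom_seq p (- y^-1)) (gbinom_seq p (- y)).
set P := trunc_series K (fun k => ratr (gbinom (- y^-1) k)) in comp.
set P' := trunc_series K (fun k => ratr (gbinom (- y) k)) in comp.
have g0 z : ratr (gbinom z 0) = 1 :> Qp.
  by rewrite /gbinom big_ord0 -(mulr1z 1) ratr_int.
have AE : trunc_series K derivA = (zp_inj omega' / Cout) *: ((P' \Po (Cin *: 'X)) - 1).
  apply/polyP => k; rewrite coefZ coefB coef_trunc_scaleX !coef_trunc_series coef1.
  rewrite /derivA; case: k => [|k] /=; first by rewrite g0 expr0 mulr1 subrr mulr0.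
  rewrite subr0; case: ifP => _; last by rewrite mulr0.
  by rewrite [LHS]mulrAC.
have BE : trunc_series K inverseB = Cin^-1 *: ((P \Po ((Cout / zp_inj omega') *: 'X)) - 1).
  apply/polyP => k; rewrite coefZ coefB coef_trunc_scaleX !coef_trunc_series coef1.
  rewrite /inverseB; case: k => [|k] /=; first by rewrite g0 expr0 mulr1 subrr mulr0.
  rewrite subr0; case: ifP => _; last by rewrite mulr0.
  by rewrite mulrC.
have one_comp (q : {poly Qp}) : (1 : {poly Qp}) \Po q = 1 by rewrite -polyC1 comp_polyC.
have cc : Cout / zp_inj omega' * (zp_inj omega' / Cout) = 1.
  by rewrite mulrA divfK // divff.
have CX0 : (Cin *: 'X : {poly Qp})`_0 = 0 by rewrite coefZ coefX mulr0.
have := dvdp_Xn_comp CX0 comp; rewrite comp_polyB comp_polyD comp_polyX one_comp.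
rewrite -comp_polyA comp_polyB one_comp => H.
rewrite BE comp_polyZ comp_polyB one_comp -comp_polyA comp_polyZ comp_polyX AE scalerA cc scale1r.
set W := P \Po _ in H *.
have -> : Cin^-1 *: (W - 1) - 'X = Cin^-1 *: (W - (1 + Cin *: 'X)).
  by rewrite opprD addrA [RHS]scalerBr scalerA mulVf // scale1r.
by rewrite (dvdpZr _ _ (invr_neq0 Cin0)).
Qed.

End BinomialSeriesInverse.

Lemma split_div (F : fieldType) (P Q D a b c d : F) : D != 0 ->
  P * a * (b * c) + Q * P * d = P * D * (a * (b * c) / D + Q * d / D).
Proof. by move=> D0; field. Qed.

Lemma sub_lincomb (A : comNzRingType) (c a b d e : A) :
  a - c * (d - e) - c * (b + e) = a - c * (d + b).
Proof. ring. Qed.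

Lemma mul_unit_cancel (F : fieldType) (P T o b x : F) : T != 0 ->
  P * - o^-1 * (b * x) = - (P * T * (b * x / (T * o))).
Proof.
move=> T0; have [->|o0] := eqVneq o 0; first by rewrite mulr0 invr0 oppr0 !mulr0 mul0r oppr0.
by field; rewrite T0 o0.
Qed.

Lemma frac_split (F : fieldType) (P a b z : F) : P != 0 ->
  P^-1 * (a + P * z) * b = a * b / P + z * b.
Proof. by move=> P0; field. Qed.

Lemma div_cancel (F : fieldType) (P Q x : F) : P != 0 -> Q != 0 -> P / Q * x / P = x / Q.
Proof. by move=> P0 Q0; field; rewrite Q0 P0. Qed.

(** * The Legendre dual and its membership in class F *)

Section DualSeries.
Local Open Scope classical_set_scope.
Variables (R : realType) (p : prime_number).
Local Notation Zp := (padic_int p).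
Local Notation Qp := (padic p).
Local Notation vge := (@vge R p).
Local Notation rho := (rho R p).
Local Notation pq := (p%:R : Qp).
Local Notation padic_e := (@padic_e R p).
Local Notation normc := (@ComplexField.Normc.normc R).
Let pr0 := @qp_p_neq0 p.
Let p_gt0 : (0 < p)%N. Proof. exact: prime_gt0 (prime_valP p). Qed.
Let p_gt1 : (1 < p)%N. Proof. exact: prime_gt1 (prime_valP p). Qed.
Let char0 n : n.+1%:R != 0 :> Qp. Proof. exact: qp_natr_neq0. Qed.

Variables (y : rat) (kappa : nat) (omega omega' : Zp).
Hypotheses (y0 : y != 0) (omega_u : omega \is a GRing.unit) (omega'_u : omega' \is a GRing.unit).
Variables (la lambda : R) (u : nat) (g : nat -> Zp).
Hypotheses (la_gt0 : 0 < la) (la_lambda : la <= lambda) (la_kappa : la <= kappa%:R - rho_at R p y).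
Hypothesis rho_lambda : rho <= lambda.
Hypothesis g_ge : forall k, vge (k%:R * lambda) (zp_inj (g k)).
Hypothesis u_ge : kappa%:Z - Num.floor lambda + iotap p y + 1 <= u%:Z.
Variables (w : int) (n s : nat) (gamma0 : Zp) (f : nat -> Qp).
Hypothesis s_eq : n%:Z - w - kappa%:Z - iotap p y = s%:Z.
Hypotheses (kappa_ge : (1 + logn p 4 <= kappa)%N) (s_ge : (1 + logn p 12 <= s)%N).
Hypothesis f_deriv : forall k, pseries_deriv f k =
  pq ^ w * zp_inj omega' *
    pseries_pow (pq ^ (iotam p y + kappa%:Z) * zp_inj omega) (- y) k
  + (if k == 0%N then pq ^ w * zp_inj gamma0 else 0)
  + pq ^ (u%:Z + w) * zp_inj (g k).
Variable u' : nat.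
Hypothesis u'_eq : u'%:Z = u%:Z - ordq p y - Num.ceil la + Num.floor lambda.

Variables (Cin Cout cw : Qp) (A B E : nat -> Qp).
Hypothesis CinE : Cin = pq ^ (iotam p y + kappa%:Z) * zp_inj omega.
Hypothesis CoutE : Cout = pq ^ (kappa%:Z + iotap p y).
Hypothesis cwE' : cw = pq ^ w * Cout.
Hypothesis AE : A = derivA y kappa omega omega'.
Hypothesis BE : B = inverseB y kappa omega omega'.
Hypothesis EE : E = fun k => if k == 0%N then 0 else pq ^ u%:Z * zp_inj (g k) / Cout.
(** A lower bound for ord E_1: p^u / Cout gives u - kappa - iota' and g_1 gives lambda. The lower
    bound on u, the first entry of the new u_0, makes it at least 1, so that the error term leaves
    the unit A_1 a unit. *)
Let theta : R := u%:R - kappa%:R - (iotap p y)%:~R + lambda.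

Let om0 : zp_inj omega != 0.
Proof. by rewrite zp_inj0; apply: contraTneq omega_u => ->; rewrite unitr0. Qed.
Let pz0 z : pq ^ z != 0. Proof. exact: (expfz_neq0 z pr0). Qed.
Let Cin0 : Cin != 0. Proof. rewrite CinE; apply: mulf_neq0; [exact: pz0|exact: om0]. Qed.
Let Cout0 : Cout != 0. Proof. rewrite CoutE; exact: pz0. Qed.

Let theta_ge1 : 1 <= theta.
Proof.
have := u_ge; rewrite -(ler_int R) !intrD rmorphN /= -!pmulrn => H.
by rewrite /theta; have := floor_le lambda; lra.
Qed.

Let E_ge k : (0 < k)%N -> vge (theta + (k%:R - 1) * lambda) (E k).
Proof.
move=> k0; rewrite EE eqn0Ngt k0 /= CoutE.
have := vge_div_expz (kappa%:Z + iotap p y) (vgeM (vge_expz R p u) (g_ge k)).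
by apply: vge_le; rewrite intrD -!pmulrn /theta; lra.
Qed.

Let A_la k : (0 < k)%N -> vge ((k%:R - 1) * la) (A k).
Proof.
move=> k0; rewrite AE; apply: vge_le (derivA_ge R kappa omega omega' y0 k0).
by rewrite ler_wpM2l // subr_ge0 ler1n.
Qed.

Let B_la k : (0 < k)%N -> vge ((k%:R - 1) * la) (B k).
Proof.
move=> k0; rewrite BE; apply: vge_le (inverseB_ge R kappa y0 omega_u omega'_u k0).
by rewrite ler_wpM2l // subr_ge0 ler1n.
Qed.

Let E_la k : (0 < k)%N -> vge (theta + (k%:R - 1) * la) (E k).
Proof.
move=> k0; apply: vge_le (E_ge k0).
by rewrite lerD2l ler_wpM2l // subr_ge0 ler1n.
Qed.

Let gauss_trunc K c (b : nat -> Qp) : b 0%N = 0 ->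
  (forall k, (0 < k)%N -> vge (c + (k%:R - 1) * la) (b k)) ->
  gauss la (c - la) (trunc_series K b).
Proof.
move=> b0 bk j; rewrite coef_trunc_series; case: ifP => _; last exact: vge0.
case: j => [|j]; first by rewrite b0; exact: vge0.
by have := bk j.+1 isT; apply: vge_le; lra.
Qed.

Let f1E : f 1%N = pq ^ w * zp_inj (omega' + gamma0 + p%:R ^+ u * g 0%N).
Proof.
have := f_deriv 0; rewrite /pseries_deriv mulr1n => ->.
have g0 : ratr (gbinom (- y) 0) = 1 :> Qp by rewrite /gbinom big_ord0 -(mulr1z 1) ratr_int.
rewrite /pseries_pow g0 expr0 !mulr1 !zp_injD zp_injM zp_inj_expp exprnP.
rewrite (expfzDr _ _ pr0) /=; move: (pq ^ w) (pq ^ u) => P Q.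
by rewrite !mulrDr [Q * P]mulrC -mulrA.
Qed.

Let fSE k : (0 < k)%N -> f k.+1 = cw * (A k + E k) / k.+1%:R.
Proof.
move=> k0; apply: (canRL (mulfK (char0 k))); rewrite mulr_natr.
have := f_deriv k; rewrite /pseries_deriv => ->.
rewrite cwE' AE EE /derivA eqn0Ngt k0 /= addr0 /pseries_pow -CoutE -CinE (expfzDr _ _ pr0).
exact: split_div.
Qed.

(** The order n - s of [cw] is what turns the denominator p^n of the phase of f into the denominator
    p^s for [H]. *)
Let cwE : cw = pq ^+ n / pq ^+ s.
Proof.
rewrite cwE' CoutE -(expfzDr _ _ pr0) [pq ^+ n]exprnP [pq ^+ s]exprnP invr_expz -(expfzDr _ _ pr0).
suff -> : w + (kappa%:Z + iotap p y) = n%:Z + - s%:Z by [].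
by move: s_eq; clear; lia.
Qed.

Let coef_int_ge (x : Qp) k : vge ((k%:R - 1) * la) x ->
  vge (n%:R - s%:R + ((k%:R - 1) * la - (logn p k.+1)%:R)) (cw * x / k.+1%:R).
Proof.
move=> xk; have cwv : vge (n%:R - s%:R) cw.
  by rewrite cwE; exact: (vge_div_expz s%:Z (vge_expn R p n)).
by have := vgeM (vgeM cwv xk) (vge_natV R p k.+1); rewrite -!addrA.
Qed.

Let tends_infty (F : nat -> Qp) :
  (forall k, (0 < k)%N ->
     vge (n%:R - s%:R + ((k%:R - 1) * la - (logn p k.+1)%:R)) (F k.+1)) ->
  forall N : nat, \forall k \near \oo, vge N%:R (F k).
Proof.
move=> Fk N; have [K KP] := logn_sublinear p (N%:R - (n%:R - s%:R)) la_gt0.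
exists K.+2 => // -[//|k] /=; rewrite ltnS => Kk.
apply: vge_le (Fk k _); last exact: leq_trans Kk.
by have := KP k Kk; lra.
Qed.

Let unit1 : exists2 c1 : Zp, c1 \is a GRing.unit & A 1%N + E 1%N = zp_inj c1.
Proof.
rewrite AE; have [v vu ->] := derivA1 kappa y0 omega_u omega'_u.
apply: (vge_unitD vu (R := R)).
by have := E_la (isT : (0 < 1)%N); apply: vge_le; rewrite subrr mul0r addr0.
Qed.

Let AE_la k : (0 < k)%N -> vge ((k%:R - 1) * la) (A k + E k).
Proof.
move=> k0; apply: vgeD; first exact: A_la.
apply: vge_le (E_la k0); rewrite lerDr; apply: le_trans theta_ge1; exact: ler01.
Qed.

Let AE00 : A 0%N + E 0%N = 0.
Proof. by rewrite AE EE /derivA addr0. Qed.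

(** K is the degree past which coefficients of slope la, once integrated, vanish modulo p^s. The
    phases therefore only see polynomials, and an inverse modulo 'X^(K+1) suffices. *)
Lemma inverse_exists : exists (K : nat) (m : {poly Qp}),
  [/\ (0 < K)%N, forall j, (K < j)%N -> s%:R <= (j%:R - 1) * la - (logn p j.+1)%:R,
      m`_0 = 0, 'X^(K.+1) %| (trunc_series K (fun k => A k + E k) \Po m) - 'X &
      gauss la (- la) m].
Proof.
have [K KP] := logn_sublinear p s%:R la_gt0; exists K.+1.
have [c1 c1u c1E] := unit1.
have P0 : (trunc_series K.+1 (fun k => A k + E k))`_0 = 0 by rewrite coef_trunc_series.
have P1 : (trunc_series K.+1 (fun k => A k + E k))`_1 = zp_inj c1.
  by rewrite coef_trunc_series.
have n1 : (trunc_series K.+1 (fun k => A k + E k))`_1 != 0.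
  by rewrite P1 zp_inj0; apply: contraTneq c1u => ->; rewrite unitr0.
have v1 : vge 0 ((trunc_series K.+1 (fun k => A k + E k))`_1)^-1.
  by rewrite P1; exact: vge_unitV.
have gP : gauss la (- la) (trunc_series K.+1 (fun k => A k + E k)).
  by rewrite -[- la]add0r; apply: gauss_trunc => // k k0; rewrite add0r; exact: AE_la.
have [m [m0 mX gm]] := inverse_series K.+1 P0 n1 v1 gP.
by exists m; split=> // j Kj; apply: KP; exact: ltnW.
Qed.

Variables (K : nat) (m : {poly Qp}).
Hypothesis K_gt0 : (0 < K)%N.
Hypothesis K_ge : forall j, (K < j)%N -> s%:R <= (j%:R - 1) * la - (logn p j.+1)%:R.
Let Phi := trunc_series K (fun k => A k + E k).
Hypotheses (m0 : m`_0 = 0) (mX : 'X^(K.+1) %| (Phi \Po m) - 'X) (gm : gauss la (- la) m).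

Let tail_ge (F : nat -> Qp) :
  (forall k, (0 < k)%N ->
     vge (n%:R - s%:R + ((k%:R - 1) * la - (logn p k.+1)%:R)) (F k.+1)) ->
  forall k, (K.+2 <= k)%N -> vge n%:R (F k).
Proof.
move=> Fk [//|k]; rewrite ltnS => Kk; have k0 : (0 < k)%N by exact: leq_ltn_trans Kk.
by apply: vge_le (Fk k k0); have := K_ge Kk; lra.
Qed.

Let eval_trunc (F : nat -> Qp) (a : int) :
  (forall k, (0 < k)%N ->
     vge (n%:R - s%:R + ((k%:R - 1) * la - (logn p k.+1)%:R)) (F k.+1)) ->
  vge n%:R (pseries_eval R F a%:~R - \sum_(k < K.+2) F k * a%:~R ^+ k).
Proof.
move=> Fk; apply: pseries_eval_trunc; [exact: vge_int|exact: tends_infty|exact: tail_ge].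
Qed.

Let H := antideriv Phi.

Let HE (x : Qp) : H.[x] = \sum_(1 <= k < K.+1) (A k + E k) / k.+1%:R * x ^+ k.+1.
Proof.
have sz : (size H <= K.+2)%N.
  apply: (leq_trans (size_poly _ _)); rewrite ltnS; exact: size_poly.
rewrite (horner_coef_wide _ sz) big_ord_recl coef0_antideriv mul0r add0r.
rewrite (eq_bigr (fun i : 'I_K.+1 => (if (i : nat) == 0%N then 0 else A i + E i) / i.+1%:R * x ^+ i.+1)); last first.
  move=> i _; rewrite lift0 coef_antideriv coef_trunc_series -ltnS ltn_ord.
  by case: (nat_of_ord i) => [|j] //=; rewrite AE EE /derivA /= addr0.
rewrite big_ord_recl /= mul0r mul0r add0r big_add1 /= big_mkord.
by apply: eq_bigr => i _; rewrite /bump add1n.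
Qed.

Lemma f_eval (a : int) :
  vge n%:R (pseries_eval R f a%:~R - (f 0%N + f 1%N * a%:~R + cw * H.[a%:~R])).
Proof.
have := @eval_trunc f a; rewrite 2!big_ord_recl /= expr0 expr1 mulr1.
set S := \sum_(i < K) _; have -> : S = cw * H.[a%:~R].
  rewrite HE mulr_sumr big_add1 /= big_mkord; apply: eq_bigr => i _.
  by rewrite /bump !add1n fSE //; move: (_^-1) (_ ^+ _) => P Q; rewrite !mulrA.
rewrite addrA; apply=> k k0; rewrite fSE //; exact: coef_int_ge (AE_la k0).
Qed.

(* The Legendre dual of [f]: its derivative is - cw m, m being the inverse of f', plus
   a linear phase [q].  Beyond degree K the inverse is replaced by its main term [B],
   so that the error term in class F is a polynomial. *)
Definition dual_series (q : int) (k : nat) : Qp :=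
  if k is j.+1 then
    cw * (- (if (j <= K)%N then m`_j else B j) + (if j == 0%N then q%:~R else 0)) / j.+1%:R
  else 0.

Let m_la j : vge ((j%:R - 1) * la) m`_j.
Proof. by have := gm j; apply: vge_le; lra. Qed.

Let dual_coef_ge q k : (0 < k)%N ->
  vge (n%:R - s%:R + ((k%:R - 1) * la - (logn p k.+1)%:R)) (dual_series q k.+1).
Proof.
move=> k0; apply: coef_int_ge; rewrite (eqn0Ngt k) k0 /= addr0; apply: vgeN.
by case: ifP => _; [exact: m_la|exact: B_la].
Qed.

(** Q = H o m - 'X m has derivative (Phi o m - 'X) m' - m, which is - m through degree K, so up to
    there Q integrates - m. Past degree K the Gauss bound still gives order at least s after
    division by j + 1, and the factor [cw] raises s to n. *)
Lemma dual_eval (q h : int) : vge n%:R (pseries_eval R (dual_series q) h%:~R -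
  cw * (q%:~R * h%:~R + (H.[m.[h%:~R]] - h%:~R * m.[h%:~R]))).
Proof.
pose x : Qp := h%:~R; rewrite -/x.
have [Q QE] : exists Q, Q = (H \Po m) - 'X * m by exists ((H \Po m) - 'X * m).
have Qx : Q.[x] = H.[m.[x]] - x * m.[x] by rewrite QE hornerD hornerN hornerM hornerX horner_comp.
pose S := \sum_(j < K.+1) m`_j / j.+1%:R * x ^+ j.+1.
have dQ : deriv Q = ((Phi \Po m) - 'X) * deriv m - m.
  rewrite QE derivB deriv_comp deriv_antideriv // derivM derivX mul1r.
  move: (Phi \Po m) (deriv m) => P P'; rewrite mulrBl opprD addrA addrAC //.
have dQ_la j : vge ((j%:R - 1) * la) (deriv Q)`_j.
  have gd : gauss la (- la + 0) (((Phi \Po m) - 'X) * deriv m).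
    apply: gaussM; last by have := coef_deriv_gauss gm; rewrite addNr.
    apply: gaussB; last exact: gaussX.
    apply: gauss_comp => //; rewrite -[- la]add0r; apply: gauss_trunc => // k k0.
    by rewrite add0r; exact: AE_la.
  rewrite dQ coefB; apply: vgeB; last exact: m_la.
  by have := gd j; apply: vge_le; lra.
have dQ_small j : (j <= K)%N -> (deriv Q)`_j = - m`_j.
  move=> jK; rewrite dQ coefB; have /dvdp_XnP -> // := dvdp_mulr (deriv m) mX.
  by rewrite sub0r.
have QS : vge s%:R (Q.[x] + S).
  pose P := Q + \poly_(i < K.+2) (m`_i.-1 / i%:R).
  have -> : Q.[x] + S = P.[x].
    rewrite /P hornerD horner_poly big_ord_recl invr0 mulr0 mul0r add0r; congr (_ + _).
  rewrite horner_coef; apply: vge_sum => i _.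
  apply: vgeMr; last by apply: vgeX; exact: vge_int.
  rewrite coefD coef_poly; case: (nat_of_ord i) => [|j] /=.
    rewrite invr0 mulr0 addr0 QE coefB coefXM coef0_comp // coef0_antideriv subr0.
    exact: vge0.
  rewrite (coef_of_deriv char0) !ltnS; case: leqP => jK.
    by rewrite dQ_small // mulNr addNr; exact: vge0.
  rewrite addr0; have := vgeM (dQ_la j) (vge_natV R p j.+1).
  by apply: vge_le; exact: K_ge.
have := eval_trunc h (dual_coef_ge q); rewrite -/x => ev.
have sumE : \sum_(k < K.+2) dual_series q k * x ^+ k = cw * (q%:~R * x - S).
  rewrite big_ord_recl mul0r add0r /S big_ord_recl [in RHS]big_ord_recl m0 mul0r mul0r add0r.
  rewrite /= m0 oppr0 add0r divr1 expr1 mulrBr mulr_sumr -sumrN mulrA; congr (_ + _).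
  apply: eq_bigr => i _; rewrite /bump !add1n /= ltn_ord addr0.
  by move: (_^-1) (_ ^+ _) m`_ _ => a b c; rewrite !mulrN !mulNr !mulrA.
rewrite sumE in ev.
have cwv : vge (n%:R - s%:R) cw.
  by rewrite cwE; exact: (vge_div_expz s%:Z (vge_expn R p n)).
have := vgeB ev (vge_le (_ : n%:R <= _) (vgeM cwv QS)); rewrite subrK => /(_ (lexx _)).
rewrite -Qx; congr (vge _ _); exact: sub_lincomb.
Qed.

(** Up to degree K, [inverse_compare] bounds m - B with the gain theta of the error E; past K the
    derivative is exactly the binomial series. *)
Lemma dual_class (q : int) :
  classF (w + ordq p y) y^-1 kappa la u' (dual_series q).
Proof.
have V0 : zp_inj omega'^-1 = (zp_inj omega')^-1 by rewrite /zp_inj rmorphV.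
have V1 : zp_inj omega^-1 = (zp_inj omega)^-1 by rewrite /zp_inj rmorphV.
(* The ratio in B is Cout / omega' = p^(iota' + kappa) / omega', and its prefactor is - cw / Cin = -
   p^(w + ord y) / omega. *)
exists omega'^-1, (- omega^-1); split; [by rewrite unitrV|by rewrite unitrN unitrV|split].
  exact/bounded_series/tends_infty/dual_coef_ge.
pose err k := if (0 < k <= K)%N then - (cw * (m`_k - B k)) else 0.
have AE0 : A 0%N = 0 by rewrite AE.
have BE0 : B 0%N = 0 by rewrite BE.
have EE0 : E 0%N = 0 by rewrite EE.
have tE (b : nat -> Qp) j : (j <= K)%N -> (trunc_series K b)`_j = b j.
  by move=> jK; rewrite coef_trunc_series jK.
have cmp k : (0 < k <= K)%N -> vge (theta - la + k%:R * la) (m`_k - B k).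
  case/andP=> k0 kK; rewrite -(tE B) //.
  apply: (inverse_compare _ _ m0 _ mX _ gm _ kK (q0 := trunc_series K A)).
  - by apply: le_trans theta_ge1; exact: ler01.
  - by rewrite tE.
  - by rewrite AE BE; exact: inverseB_derivA.
  - rewrite -[- la]add0r; apply: gauss_trunc => // j j0; rewrite add0r; exact: B_la.
  - have -> : Phi - trunc_series K A = trunc_series K E.
      apply/polyP => j; rewrite coefB !coef_trunc_series; case: ifP => _; last by rewrite subr0.
      by rewrite addrAC subrr add0r.
    exact: gauss_trunc.
(* The error has order at least n - s + theta - la + k la = w + u + lambda - la + k la; rounding
   lambda down and la up gives W + k la, whence the value of u'. *)
pose W := u'%:Z + (w + ordq p y).
have errv k : vge (W%:~R + k%:R * la) (err k).
  rewrite /err; case: ifP => [/cmp H1|_]; last exact: vge0.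
  apply: vgeN; have cwv : vge (n%:R - s%:R) cw.
    by rewrite cwE; exact: (vge_div_expz s%:Z (vge_expn R p n)).
  apply: vge_le (vgeM cwv H1); rewrite /theta.
  have e1 : n%:R - s%:R = w%:~R + kappa%:R + (iotap p y)%:~R :> R.
    have -> : n%:R - s%:R = (n%:Z - s%:Z)%:~R :> R by rewrite intrB.
    have -> : n%:Z - s%:Z = w + kappa%:Z + iotap p y by move: s_eq; clear; lia.
    by rewrite !intrD.
  have e2 : W%:~R = u%:R - (Num.ceil la)%:~R + (Num.floor lambda)%:~R + w%:~R :> R.
    have -> : W = u%:Z - Num.ceil la + Num.floor lambda + w by rewrite /W u'_eq; clear; lia.
    by rewrite !intrD rmorphN.
  by rewrite e1 e2; have := ceil_ge la; have := floor_le lambda; lra.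
have /choice[z zP] : forall k, exists z : Zp, err k = pq ^ W * zp_inj z /\ vge (k%:R * la) (zp_inj z).
  move=> k; have := vge_div_expz W (errv k); rewrite addrAC subrr add0r => Hk.
  have /vge0P[z zE] : vge 0 (err k / pq ^ W) by apply: vge_le Hk; rewrite mulr_ge0 // ltW.
  exists z; rewrite -zE; split; last exact: Hk.
  by rewrite mulrC (divfK (pz0 W)).
have [I IE] : exists I : nat, I%:Z = kappa%:Z + iotam p y.
  by exists `|(kappa%:Z + iotam p y)%R|%N; rewrite gez0_abs // /iotam; clear; lia.
(* The inverse of f' has no constant term, so omega^-1 cancels that of the binomial series; the rest
   is the linear phase, as cw = p^(w + ord y) p^I. *)
exists (omega^-1 + q%:~R * p%:R ^+ I), z; split.
  apply/I0_ge; split; last by move=> k; exact: (zP k).2.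
  apply/(padic_norm_cvg0P R (fun k => zp_inj (z k))) => N; exists K.+1 => // k /= Kk.
  have := (zP k).1; rewrite /err [(k <= K)%N]leqNgt Kk andbF => /eqP; rewrite eq_sym mulf_eq0.
  rewrite (negPf (expfz_neq0 _ pr0)) /= => /eqP ->; exact: vge0.
move=> k; rewrite -/W -(zP k).1 /pseries_deriv /dual_series.
rewrite -(mulr_natr (_ / _)) (divfK (char0 k)) zp_injD zp_injM zp_inj_int zp_inj_expp zp_injN V0 V1 iotamV.
have cwE2 : cw = pq ^ (w + ordq p y) * pq ^ (kappa%:Z + iotam p y).
  rewrite cwE' CoutE -!(expfzDr _ _ pr0) -iota_sub.
  suff -> : w + (iotap p y - iotam p y) + (kappa%:Z + iotam p y) =
    w + (kappa%:Z + iotap p y) by [].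
  by clear; lia.
case: k => [|k].
  rewrite leq0n m0 oppr0 add0r /err /= addr0 /pseries_pow expr0 mulr1.
  have -> : ratr (gbinom (- y^-1) 0) = 1 :> Qp by rewrite /gbinom big_ord0 -(mulr1z 1) ratr_int.
  rewrite cwE2 -IE -exprnP mulr1; move: (pq ^ _) (pq ^+ I) (zp_inj omega)^-1 (q%:~R) => P T a b.
  by rewrite mulrN mulrDr addrA addNr add0r mulrA mulrAC.
rewrite /= !addr0; set main := _ * pseries_pow _ _ _.
have mainE : main = - (cw * B k.+1).
  rewrite /main /pseries_pow BE /inverseB /= cwE2.
  rewrite [iotam p y + _]addrC [iotap p y + _]addrC.
  exact: (mul_unit_cancel _ _ _ _ (pz0 _)).
rewrite mainE /err /=; case: ifP => _; last by rewrite addr0 mulrN.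
by rewrite mulrBr opprB addrA addNr add0r mulrN.
Qed.

Let Phi_coef j : (j <= K)%N -> Phi`_j = A j + E j.
Proof. by move=> jK; rewrite coef_trunc_series jK. Qed.

Let stationary :
  (forall h x t, vge 0 x -> vge 0 t -> phase R H s h (x + p%:R ^+ s * t) = phase R H s h x) /\
  exists G, forall (h : int) (x : Qp), vge 0 x -> vge s%:R (Phi.[x] - h%:~R) ->
  \sum_(i < p ^ s) phase R H s h i%:R = G * phase R H s h x.
Proof.
have [c1 c1u c1E] := unit1; have rho0 := rho_gt0 p R.
have tr (b : nat -> Qp) c j : vge c (b j) -> vge c (trunc_series K b)`_j.
  by move=> bj; rewrite coef_trunc_series; case: ifP => // _; exact: vge0.
apply: (@stationary_phase_class R p Phi (fun j => (trunc_series K A)`_j)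
  (fun j => (trunc_series K E)`_j) c1 kappa s) => //.
- by rewrite Phi_coef.
- by rewrite Phi_coef.
- move=> j _; rewrite !coef_trunc_series; case: ifP => // _; by rewrite addr0.
- move=> j j1; apply: tr; rewrite AE; have j0 : (0 < j)%N by exact: ltnW.
  apply: vge_le (derivA_ge R kappa omega omega' y0 j0); rewrite ler_wpM2l ?subr_ge0 ?ler1n //.
  by rewrite lerD2l lerN2 /rho_at; case: ifP => // _; exact: ltW.
- move=> j j1; apply: tr; have j0 : (0 < j)%N by exact: ltnW.
  by apply: vge_le (E_ge j0); rewrite lerD // ler_wpM2l // subr_ge0 ler1n.
Qed.

Let m_vge0 (h : int) : vge 0 m.[h%:~R].
Proof.
apply: horner_vge0; last exact: vge_int.
case=> [|j]; first by rewrite m0; exact: vge0.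
by apply: vge_le (m_la j.+1); rewrite mulr_ge0 ?subr_ge0 ?ler1n // ltW.
Qed.

(** Phi o m - 'X has no coefficients up to degree K, and beyond K its coefficients have order at
    least s by the Gauss bound. *)
Let m_stationary (h : int) : vge s%:R (Phi.[m.[h%:~R]] - h%:~R).
Proof.
have -> : Phi.[m.[h%:~R]] - h%:~R = ((Phi \Po m) - 'X).[h%:~R].
  by rewrite hornerD hornerN hornerX horner_comp.
rewrite horner_coef; apply: vge_sum => i _.
apply: vgeMr; last by apply: vgeX; exact: vge_int.
case: (leqP i K) => iK.
  by move/dvdp_XnP: mX => ->; [exact: vge0|rewrite ltnS].
have g1 : gauss la (- la) ((Phi \Po m) - 'X).
  apply: gaussB; last exact: gaussX.
  apply: gauss_comp => //; rewrite -[- la]add0r; apply: gauss_trunc => // k k0.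
  by rewrite add0r; exact: AE_la.
apply: vge_le (g1 i); apply: le_trans (K_ge iK) _.
by have : 0 <= (logn p i.+1)%:R :> R by []; lra.
Qed.

Lemma poisson_data_trunc : exists (beta : R) (K0 G : R[i]) (phi c : int -> R[i]),
  [/\ normc K0 = 1, forall a, normc (phi a) = 1, forall h, normc (c h) = 1 &
      forall a, phi (a + (p ^ s)%N%:Z) = phi a] /\
  [/\ forall a : int, padic_e (pseries_eval R f a%:~R / pq ^+ n) =
        K0 * e (beta * a%:~R / p%:R ^+ s) * phi a,
      forall h : int, \sum_(i < p ^ s) phi (i : nat)%:Z * e (- (h%:~R * i%:R / p%:R ^+ s)) = G * c h &
      forall q : int, exists2 f' : nat -> Qp,
        classF (w + ordq p y) y^-1 kappa la u' f' &
        forall h : int, padic_e (pseries_eval R f' h%:~R / pq ^+ n) =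
          c h * e (q%:~R * h%:~R / p%:R ^+ s)].
Proof.
have [per [G GP]] := stationary.
pose alpha := omega' + gamma0 + p%:R ^+ u * g 0%N.
have [t tE] : exists t : nat, t%:Z = kappa%:Z + iotap p y.
  by exists `|(kappa%:Z + iotap p y)%R|%N; rewrite gez0_abs // /iotap; clear; lia.
have pqR k : (p%:R ^+ k : R) != 0 by rewrite expf_neq0 // pnatr_eq0 -lt0n.
have pqQ k : pq ^+ k != 0 by exact: (expf_neq0 k pr0).
have cwn (x : Qp) : cw * x / pq ^+ n = x / pq ^+ s.
  by rewrite cwE; exact: div_cancel (pqQ n) (pqQ s).
(* Since n - w = s + t, the linear term of f over p^n is alpha a / p^(s + t) modulo integers, where
   alpha may be replaced by its residue. The constant term of f gives K0, and the remaining series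
   gives phi. *)
exists ((alpha (s + t)%N)%:~R / p%:R ^+ t), (padic_e (f 0%N / pq ^+ n)), G,
  (fun a => padic_e (H.[a%:~R] / pq ^+ s)), (fun h => phase R H s h m.[h%:~R]).
split; first split; try by [move=> ?; exact: normc_padic_e|exact: normc_padic_e].
  move=> a; have := per 0 a%:~R 1 (vge_int R p a) (vge_nat R p 1).
  rewrite /phase !mul0r !subr0 mulr1 => <-; congr (padic_e (_.[_] / _)).
  by rewrite intrD -pmulrn natrX.
split.
- move=> a; have /vge_divX ev := f_eval a.
  have congr_n (X Y : Qp) : vge 0 ((X - Y) / pq ^+ n) -> padic_e (X / pq ^+ n) = padic_e (Y / pq ^+ n).
    by rewrite mulrBl; exact: padic_e_congr.
  rewrite (congr_n _ _ ev) !mulrDl !padic_eD cwn; congr (_ * _ * _).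
  have [z zE] := zp_resB alpha (s + t).
  have wn : pq ^ w / pq ^+ n = (pq ^+ (s + t))^-1.
    rewrite [pq ^+ n]exprnP [pq ^+ (s + t)]exprnP !invr_expz -(expfzDr _ _ pr0).
    suff -> : w + - n%:Z = - (s + t)%N%:Z by [].
    by rewrite PoszD tE; move: s_eq; clear; lia.
  have E1 : f 1%N * a%:~R / pq ^+ n = (alpha (s + t)%N * a)%:~R / p%:R ^+ (s + t) + zp_inj (z * a%:~R).
    rewrite f1E -/alpha mulrAC (mulrAC (pq ^ w)) wn {1}zE.
    rewrite zp_injD !zp_injM !zp_inj_int zp_inj_expp intrM.
    by have := pqQ (s + t)%N; move: (pq ^+ (s + t)) => P P0; exact: frac_split.
  rewrite (padic_eE R E1); congr (e _); rewrite intrM exprD.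
  by have := pqR s; have := pqR t; move: (p%:R ^+ s) (p%:R ^+ t) => P Q P0 Q0; field; rewrite P0 Q0.
- move=> h; rewrite -(GP h _ (m_vge0 h) (m_stationary h)); apply: eq_bigr => i _.
  rewrite /phase mulrBl padic_eD -pmulrn; congr (_ * _).
  rewrite padic_eN eN; congr (_^-1).
  by have := padic_e_div R p (h * (i : nat)%:Z) s; rewrite !intrM => <-.
- move=> q; exists (dual_series q); first exact: dual_class.
  move=> h; have /vge_divX := dual_eval q h; rewrite mulrBl => /padic_e_congr ->.
  by rewrite cwn mulrDl padic_eD mulrC /phase -intrM padic_e_div intrM.
Qed.

End DualSeries.

Section PoissonData.
Variables (R : realType) (p : prime_number).
Local Notation Qp := (padic p).
Local Notation normc := (@ComplexField.Normc.normc R).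
Local Notation padic_e := (@padic_e R p).
Let p_gt0 : (0 < p)%N. Proof. exact: prime_gt0 (prime_valP p). Qed.
Let p_gt1 : (1 < p)%N. Proof. exact: prime_gt1 (prime_valP p). Qed.

Lemma iotap_nat (m : nat) : iotap p m%:R = (logn p m)%:Z.
Proof.
by rewrite /iotap /ordq [m%:R]pmulrn (numq_int m) (denq_int m) logn1 subr0 max_r.
Qed.

(** This needs kappa > rho_p(y). For p = 2 one has rho = 1, and the shift by iota'(2) in
    admissibility supplies kappa >= 2. *)
Lemma lambda_tilde_gt0 (y : rat) kappa (lambda : R) : admissible p kappa lambda -> 0 < lambda_tilde y p kappa lambda.
Proof.
case=> k1 [j j0 ->]; have rho0 := rho_gt0 p R.
rewrite lt_min mulr_gt0 ?ltr0n // andbT subr_gt0.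
have : rho_at R p y <= rho R p by rewrite /rho_at; case: ifP => // _; exact: ltW.
move/le_lt_trans; apply; move: k1; rewrite (iotap_nat 2) => k1.
case: (prime_cases p) => [p2|p3|p5].
- rewrite rho_p2 // ltr1n; move: k1; rewrite p2 (_ : logn 2 2 = 1%N) //; lia.
- rewrite rho_p3 //; apply: (@lt_le_trans _ _ 1); [lra|rewrite ler1n; lia].
- apply: le_lt_trans (rho_p5 _ p5) _; apply: (@lt_le_trans _ _ 1); [lra|rewrite ler1n; lia].
Qed.

(** The interface to the analytic half, which uses only the unit moduli, the period, the Fourier
    coefficients and the freedom in q. *)
Lemma poisson_data (y : rat) (w : int) (kappa : nat) (lambda : R) (n u u' s : nat) (f : nat -> Qp) :
  y != 0 -> admissible p kappa lambda ->
  1 + iotap p 4 <= kappa%:Z ->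
  n%:Z - w - kappa%:Z - iotap p y = s%:Z -> 1 + iotap p 12 <= s%:Z ->
  kappa%:Z - Num.floor lambda + iotap p y + 1 <= u%:Z ->
  u'%:Z = u%:Z - ordq p y - Num.ceil (lambda_tilde y p kappa lambda) + Num.floor lambda ->
  classF w y kappa lambda u f ->
  exists (beta : R) (K0 G : R[i]) (phi c : int -> R[i]),
  [/\ normc K0 = 1, forall a, normc (phi a) = 1, forall h, normc (c h) = 1 &
      forall a, phi (a + (p ^ s)%N%:Z) = phi a] /\
  [/\ forall a : int, padic_e (pseries_eval R f a%:~R / p%:R ^+ n) =
        K0 * e (beta * a%:~R / p%:R ^+ s) * phi a,
      forall h : int, \sum_(i < p ^ s) phi (i : nat)%:Z * e (- (h%:~R * i%:R / p%:R ^+ s)) = G * c h &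
      forall q : int, exists2 f' : nat -> Qp,
        classF (w + ordq p y) y^-1 kappa (lambda_tilde y p kappa lambda) u' f' &
        forall h : int, padic_e (pseries_eval R f' h%:~R / p%:R ^+ n) =
          c h * e (q%:~R * h%:~R / p%:R ^+ s)].
Proof.
move=> y0 adm k4 sE s12 uE u'E [omega [omega' [ou ou' [_ [gamma0 [g [/I0_ge[_ g_ge] fE]]]]]]].
set la := lambda_tilde _ _ _ _ in u'E *.
have la0 : 0 < la := lambda_tilde_gt0 y adm.
have la_l : la <= lambda by rewrite /la /lambda_tilde ge_min lexx orbT.
have la_k : la <= kappa%:R - rho_at R p y by rewrite /la /lambda_tilde ge_min lexx.
have rl : rho R p <= lambda.
  have [_ [j j0 ->]] := adm; rewrite ler_peMl ?ler1n //; exact/ltW/rho_gt0.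
move: k4 s12; rewrite (iotap_nat 4) (iotap_nat 12) => k4 s12.
have k4' : (1 + logn p 4 <= kappa)%N by rewrite -lez_nat PoszD.
have s12' : (1 + logn p 12 <= s)%N by rewrite -lez_nat PoszD.
have [K [m [K0 KP m0 mX gm]]] := inverse_exists y0 ou ou' la0 la_l la_k g_ge uE s erefl erefl erefl.
apply: (poisson_data_trunc y0 ou ou' la0 la_l la_k rl g_ge uE sE k4' s12' fE u'E
  erefl erefl erefl erefl erefl erefl K0 KP m0 mX gm).
Qed.

End PoissonData.

(** * Summation by parts *)

Section ExponentialBounds.
Variable R : realType.
Local Notation e := (@e R).
Local Notation normc := (@ComplexField.Normc.normc R).
Implicit Types (x y : R[i]) (t : R).

Lemma normcD x y : normc (x + y) <= normc x + normc y.
Proof. exact: (@le_normcD R x y). Qed.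

Lemma normc_opp x : normc (- x) = normc x.
Proof. exact: (@normcN R x). Qed.

Lemma normcB x y : normc (x - y) <= normc x + normc y.
Proof. by apply: le_trans (normcD _ _) _; rewrite normc_opp. Qed.

Lemma normcBC x y : normc (x - y) = normc (y - x).
Proof. by rewrite -normc_opp opprB. Qed.

Lemma normc_ge0 x : 0 <= normc x.
Proof. by case: x => a b; rewrite sqrtr_ge0. Qed.

Lemma normc_sum (I : Type) (r : seq I) (P : pred I) (F : I -> R[i]) :
  normc (\sum_(i <- r | P i) F i) <= \sum_(i <- r | P i) normc (F i).
Proof.
elim/big_rec2: _ => [|i a b _ IH]; first by rewrite ComplexField.Normc.normc0.
by apply: le_trans (normcD _ _) _; rewrite lerD2l.
Qed.

Lemma normc_Re x : `|complex.Re x| <= normc x.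
Proof.
case: x => a b /=; rewrite -sqrtr_sqr; apply: ler_wsqrtr.
by rewrite lerDl sqr_ge0.
Qed.

Lemma normc_le x : normc x <= `|complex.Re x| + `|complex.Im x|.
Proof.
case: x => a b /=; rewrite -[leRHS]ger0_norm ?addr_ge0 // -sqrtr_sqr; apply: ler_wsqrtr.
rewrite sqrrD !real_normK ?num_real // addrAC lerDl.
by rewrite mulrn_wge0 // mulr_ge0.
Qed.

(** On [1/4, 3/4] the cosine is nonpositive, so the modulus is at least 1. Smaller t are reached by
    halving, since |e(2t) - 1| = |e(t) - 1| |e(t) + 1| <= 2 |e(t) - 1|. *)
Lemma e_sub1_ge (t : R) : 0 <= t <= 3 / 4 -> t <= normc (e t - 1).
Proof.
have base u : 4^-1 <= u <= 3 / 4 -> 1 <= normc (e u - 1).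
  move=> /andP[u1 u2]; apply: le_trans (normc_Re _).
  have c0 : cos (2 * pi * u) <= 0 :> R.
    rewrite -[_ * u](subrK pi) cosDpi oppr_le0; apply: cos_ge0_pihalf.
    have pi0 := pi_gt0 R; apply/andP; split; nra.
  by rewrite /= ler0_norm; lra.
move=> /andP[t0 t1]; have [->|tn0] := eqVneq t 0; first exact: normc_ge0.
have {t0 tn0} t0 : 0 < t by rewrite lt_neqAle eq_sym tn0.
have [k] : exists k : nat, 4^-1 / 2 ^+ k <= t.
  pose k := (Num.truncn (t^-1)).+1; exists k.
  have tk : t^-1 <= 2 ^+ k.
    apply: le_trans (ltW (truncnS_gt _)) _; rewrite -natrX ler_nat.
    exact: ltnW (ltn_expl _ _).
  have : (2 ^+ k)^-1 <= t by rewrite -[leRHS]invrK lef_pV2 ?posrE ?invr_gt0 ?exprn_gt0.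
  have : 0 < (2 ^+ k)^-1 :> R by rewrite invr_gt0 exprn_gt0.
  by set v := _^-1; lra.
elim: k t t0 t1 => [|k IH] t t0 t1.
  rewrite expr0 divr1 => t4; apply: le_trans (base t _); [lra|by rewrite t4].
have [t4 _|t4] := lerP 4^-1 t; first by apply: le_trans (base t _); [lra|rewrite t4].
rewrite exprS invfM => tk.
have := IH (t + t); rewrite eD.
have -> : e t * e t - 1 = (e t - 1) * (e t + 1) by ring.
rewrite ComplexField.Normc.normcM => H.
have n2 : normc (e t + 1) <= 2.
  apply: le_trans (normcD _ _) _; rewrite normc_e ComplexField.Normc.normc1; lra.
have : t + t <= normc (e t - 1) * normc (e t + 1).
  apply: H; [lra|lra|]; move: tk; set v := (_ ^+ k)^-1; lra.
have := normc_ge0 (e t - 1); have := normc_ge0 (e t + 1); nra.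
Qed.

Lemma lip_unit (f df : R -> R) (x : R) : (forall z, is_derive z (1 : R) f (df z)) ->
  (forall z, `|df z| <= 1) -> `|f x - f 0| <= `|x|.
Proof.
move=> fd df1; have fc : continuous f.
  by move=> z; apply: differentiable_continuous; apply/derivable1_diffP; have [] := fd z.
have [x0|x0] := leP 0 x.
  have [z _ ->] := MVT_segment x0 (fun z _ => fd z) (continuous_subspaceT fc).
  by rewrite subr0 normrM ler_piMl.
have [z _ E] := MVT_segment (ltW x0) (fun z _ => fd z) (continuous_subspaceT fc).
by rewrite distrC E sub0r normrM normrN ler_piMl.
Qed.

(** The constant 4 pi comes from bounding real and imaginary parts separately by 2 pi |t|. *)
Lemma e_sub1_le (t : R) : normc (e t - 1) <= 4 * pi * `|t|.
Proof.
apply: le_trans (normc_le _) _ => /=; rewrite subr0.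
have pi0 := pi_gt0 R.
have h1 := @lip_unit sin cos (2 * pi * t) (@is_derive_sin R) (@cos_max R).
have h2 : `|cos (2 * pi * t) - cos 0| <= `|2 * pi * t|.
  apply: (@lip_unit cos (fun v => - sin v) _ (@is_derive_cos R)) => v.
  by rewrite normrN sin_max.
have nE : `|2 * pi * t| = 2 * pi * `|t| by rewrite normrM ger0_norm // mulr_ge0 // ltW.
rewrite nE sin0 subr0 in h1; rewrite nE cos0 in h2.
lra.
Qed.

End ExponentialBounds.

Section Abel.
Variable R : realType.
Local Notation e := (@e R).
Local Notation normc := (@ComplexField.Normc.normc R).

Lemma abel_sum (F : comNzRingType) (a k : nat -> F) n :
  \sum_(i < n.+1) a i * k i = (\sum_(i < n.+1) a i) * k n -
    \sum_(i < n) (\sum_(j < i.+1) a j) * (k i.+1 - k i).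
Proof.
elim: n => [|n IH]; first by rewrite !big_ord_recl !big_ord0 subr0 !addr0.
rewrite big_ord_recr /= IH [in RHS]big_ord_recr /= [X in _ = _ - X]big_ord_recr /=.
by move: (\sum_(i < n.+1) a i) (\sum_(i < n) _) => A S; ring.
Qed.

Lemma abel_bound (a k : nat -> R[i]) n :
  normc (\sum_(i < n.+1) a i * k i) <= normc (\sum_(i < n.+1) a i) * normc (k n) +
    \sum_(i < n) normc (\sum_(j < i.+1) a j) * normc (k i.+1 - k i).
Proof.
rewrite abel_sum; apply: le_trans (normcB _ _) _; rewrite ComplexField.Normc.normcM lerD2l.
apply: le_trans (normc_sum _ _ _) _; apply: ler_sum => i _.
by rewrite ComplexField.Normc.normcM.
Qed.

Lemma normcX (z : R[i]) n : normc (z ^+ n) = normc z ^+ n.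
Proof.
elim: n => [|n IH]; first exact: ComplexField.Normc.normc1.
by rewrite !exprS ComplexField.Normc.normcM IH.
Qed.

(** The index i is a frequency at distance i - xi on one side of - beta, and N is comparable to X /
    b. Up to N the geometric sum [ker] is bounded by b; beyond N it decays like X / i. [LX] keeps
    theta in the range of [e_sub1_ge]. *)
Variables (X xi : R) (b L N : nat) (q : nat -> R) (E : R) (a : nat -> R[i]).
Hypotheses (X0 : 0 < X) (xi01 : 0 <= xi <= 1) (N0 : (0 < N)%N).
Hypotheses (NbX : N%:R * b%:R <= X) (XNb : X <= 2 * (N%:R * b%:R)).
Hypothesis LX : L%:R <= 3 / 4 * X.
Variable c : R.
Hypothesis cE : c = 4 * pi.
Let theta (i : nat) : R := (i%:R - xi) / X.
Let z i := e (theta i).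
Hypothesis q_ge0 : forall n, 0 <= q n.
Hypothesis q_mono : forall n m, (n <= m)%N -> q n <= q m.
Hypothesis HU : forall n, (n <= L)%N -> normc (\sum_(i < n) a i) <= q n.
Hypothesis HV : forall n, (n <= L)%N -> normc (\sum_(i < n) a i * z i.+1 ^+ b) <= q n.
Hypothesis E0 : 0 <= E.
Hypothesis q_sum : (N < L)%N -> \sum_(i < L - N.+1) q (N + i.+1)%N / (N + i.+1)%:R ^+ 2 <= E * (q N / N%:R).
Hypothesis q_last : (N < L)%N -> q L / L%:R <= q N / N%:R.

Let ker i : R[i] := \sum_(j < b) z i ^+ j.+1.

Let c0 : 0 <= c. Proof. by rewrite cE mulr_ge0 // pi_ge0. Qed.

Let XV0 : 0 <= X^-1. Proof. by rewrite invr_ge0 ltW. Qed.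
Let Xge0 : 0 <= X. Proof. exact: ltW. Qed.

Let normz i : normc (z i) = 1. Proof. exact: normc_e. Qed.

Let thetaS i : theta i.+1 = theta i + X^-1.
Proof. by rewrite /theta -natr1; field; rewrite gt_eqF. Qed.

Let normker i : normc (ker i) <= b%:R.
Proof.
apply: le_trans (normc_sum _ _ _) _.
rewrite (eq_bigr (fun=> 1)) ?sumr_const ?card_ord // => j _.
by rewrite normcX normz expr1n.
Qed.

Let dker i : normc (ker i.+1 - ker i) <= c * b%:R ^+ 2 / X.
Proof.
rewrite /ker -sumrB; apply: le_trans (normc_sum _ _ _) _.
have -> : c * b%:R ^+ 2 / X = \sum_(j < b) c * b%:R / X.
  by rewrite sumr_const card_ord -mulr_natr; ring.
apply: ler_sum => j _; rewrite /z thetaS -!eMn mulrnDl eD -{2}[e (theta i *+ _)]mulr1 -mulrBr.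
rewrite ComplexField.Normc.normcM normc_e mul1r.
apply: le_trans (e_sub1_le _) _; rewrite -cE -[leRHS]mulrA ler_wpM2l //.
rewrite -[X^-1 *+ _]mulr_natl ger0_norm ?mulr_ge0 //.
by rewrite ler_wpM2r // ler_nat.
Qed.

(** On this range [ker] is at most b and its total variation is at most N c b^2 / X <= c b. *)
Lemma abel_inner n : (n <= L)%N -> (n <= N)%N ->
  normc (\sum_(i < n) a i * ker i.+1) <= q N * b%:R * (1 + c).
Proof.
case: n => [|n] nL nN.
  by rewrite big_ord0 ComplexField.Normc.normc0 !mulr_ge0 ?addr_ge0.
apply: le_trans (abel_bound a (fun i => ker i.+1) n) _.
have h1 : normc (\sum_(i < n.+1) a i) * normc (ker n.+1) <= q N * b%:R.
  apply: ler_pM; rewrite ?normc_ge0 ?normker //.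
  by apply: le_trans (HU nL) (q_mono nN).
have h2 : \sum_(i < n) normc (\sum_(j < i.+1) a j) * normc (ker i.+2 - ker i.+1) <= q N * b%:R * c.
  apply: (@le_trans _ _ (\sum_(i < n) q N * (c * b%:R ^+ 2 / X))).
    apply: ler_sum => i _; apply: ler_pM; rewrite ?normc_ge0 ?dker //.
    have iL : (i.+1 <= L)%N by apply: leq_trans nL; exact: ltnW (ltn_ord i).
    by apply: le_trans (HU iL) (q_mono _); apply: leq_trans nN; exact: ltnW (ltn_ord i).
  have nR : n%:R * b%:R <= X.
    by apply: le_trans NbX; rewrite ler_wpM2r // ler_nat ltnW.
  have h : b%:R / X * n%:R <= 1 by rewrite mulrAC ler_pdivrMr // mul1r mulrC.
  rewrite sumr_const card_ord -[_ *+ n]mulr_natr.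
  have -> : q N * (c * b%:R ^+ 2 / X) * n%:R = q N * b%:R * c * (b%:R / X * n%:R) by ring.
  by rewrite ler_piMr // !mulr_ge0.
lra.
Qed.

Let theta_ge i : (0 < i)%N -> (i%:R - 1) / X <= theta i.
Proof.
by move=> i0; rewrite /theta ler_wpM2r // lerD2l lerN2; case/andP: xi01.
Qed.

Let z1_ge i : (1 < i)%N -> (i <= L)%N -> (i%:R - 1) / X <= normc (z i - 1).
Proof.
move=> i1 iL; apply: le_trans (theta_ge (ltnW i1)) (e_sub1_ge _).
have iR : 1 <= i%:R :> R by rewrite ler1n ltnW.
have iLR : i%:R <= L%:R :> R by rewrite ler_nat.
case/andP: xi01 => x0 x1; apply/andP; split.
  by apply: divr_ge0 => //; lra.
by rewrite /theta ler_pdivrMr //; move: LX; lra.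
Qed.

Let z1_gt0 i : (1 < i)%N -> (i <= L)%N -> 0 < normc (z i - 1).
Proof.
move=> i1 iL; apply: lt_le_trans (z1_ge i1 iL).
by rewrite divr_gt0 // subr_gt0 ltr1n.
Qed.

Let z1_neq0 i : (1 < i)%N -> (i <= L)%N -> z i - 1 != 0.
Proof.
move=> i1 iL; apply: contraTneq (z1_gt0 i1 iL) => ->.
by rewrite ComplexField.Normc.normc0 ltxx.
Qed.

Let w i : R[i] := z i / (z i - 1).

Let kerE i : (1 < i)%N -> (i <= L)%N -> ker i = (z i ^+ b - 1) * w i.
Proof.
move=> i1 iL; rewrite /w subrX1 /ker.
have -> : \sum_(j < b) z i ^+ j.+1 = z i * \sum_(j < b) z i ^+ j.
  by rewrite mulr_sumr; apply: eq_bigr => j _; rewrite exprS.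
have := z1_neq0 i1 iL; move: (\sum_(j < b) z i ^+ j) (z i) => S x y0; by field.
Qed.

Let norm_w i : (1 < i)%N -> (i <= L)%N -> normc (w i) <= X / (i%:R - 1).
Proof.
move=> i1 iL; rewrite ComplexField.Normc.normcM ComplexField.Normc.normcV normz mul1r.
have i1R : 0 < i%:R - 1 :> R by rewrite subr_gt0 ltr1n.
rewrite -[X / _]invf_div lef_pV2 ?posrE ?divr_gt0 ?z1_gt0 //; exact: z1_ge.
Qed.

Let dw i : (1 < i)%N -> (i.+1 <= L)%N ->
  normc (w i.+1 - w i) <= c * X / ((i%:R - 1) * i%:R).
Proof.
move=> i1 iL; have [y1 y2] := (z1_neq0 i1 (ltnW iL), z1_neq0 (ltnW i1 : (1 < i.+1)%N) iL).
have i1R : 0 < i%:R - 1 :> R by rewrite subr_gt0 ltr1n.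
have iR : 0 < i%:R :> R by rewrite ltr0n ltnW.
have -> : w i.+1 - w i = (z i - z i.+1) * ((z i.+1 - 1)^-1 * (z i - 1)^-1).
  by rewrite /w; move: (z i) (z i.+1) y1 y2 => x y y1 y2; field; rewrite y1 y2.
rewrite !ComplexField.Normc.normcM !ComplexField.Normc.normcV.
have h1 : normc (z i - z i.+1) <= c / X.
  rewrite normcBC /z thetaS eD -{2}[e (theta i)]mulr1 -mulrBr ComplexField.Normc.normcM normc_e mul1r.
  by apply: le_trans (e_sub1_le _) _; rewrite -cE normfV ger0_norm.
have h2 : (normc (z i.+1 - 1))^-1 <= X / i%:R.
  rewrite -[X / _]invf_div lef_pV2 ?posrE ?divr_gt0 ?z1_gt0 //; last exact: ltnW.
  by have := z1_ge (ltnW i1 : (1 < i.+1)%N) iL; rewrite -natr1 addrK.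
have h3 : (normc (z i - 1))^-1 <= X / (i%:R - 1).
  rewrite -[X / _]invf_div lef_pV2 ?posrE ?divr_gt0 ?z1_gt0 //; last exact: ltnW.
  exact: (z1_ge i1 (ltnW iL)).
have -> : c * X / ((i%:R - 1) * i%:R) = c / X * (X / i%:R * (X / (i%:R - 1))).
  by field; rewrite !gt_eqF.
by do 2?[apply: ler_pM => //]; rewrite ?mulr_ge0 ?invr_ge0 ?normc_ge0.
Qed.

(* ker i = z (z^b - 1) / (z - 1) at z = z i: the factor z^b - 1 splits into the two
   linear phases bounded by HU and HV, and the weight z / (z - 1) varies by X / i^2. *)
Lemma abel_outer : (N < L)%N ->
  normc (\sum_(i < L - N) a (N + i)%N * ker (N + i).+1) <= q N * b%:R * (16 + 16 * c * E).
Proof.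
move=> NL; have [n nE] : exists n, (L - N)%N = n.+1 by exists (L - N).-1; rewrite prednK // subn_gt0.
pose a' i := a (N + i)%N * (z (N + i).+1 ^+ b - 1).
(* The 4 counts two phases, each giving a difference of two partial sums from 0. *)
have partial m : (N + m <= L)%N -> normc (\sum_(i < m) a' i) <= 4 * q (N + m)%N.
  move=> mL.
  have NqM : q N <= q (N + m)%N by apply: q_mono; exact: leq_addr.
  have NL' : (N <= L)%N := ltnW NL.
  have -> : \sum_(i < m) a' i =
      (\sum_(i < N + m) a i * z i.+1 ^+ b - \sum_(i < N) a i * z i.+1 ^+ b) -
      (\sum_(i < N + m) a i - \sum_(i < N) a i).
    have sp (f : nat -> R[i]) : \sum_(i < N + m) f i - \sum_(i < N) f i = \sum_(i < m) f (N + i)%N.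
      by rewrite big_split_ord /= addrAC subrr add0r.
    rewrite (sp a) (sp (fun i => a i * z i.+1 ^+ b)) -sumrB.
    by apply: eq_bigr => i _; rewrite /a' mulrBr mulr1.
  apply: le_trans (normcB _ _) _.
  have := normcB (\sum_(i < N + m) a i * z i.+1 ^+ b) (\sum_(i < N) a i * z i.+1 ^+ b).
  have := normcB (\sum_(i < N + m) a i) (\sum_(i < N) a i).
  have := HU mL; have := HV mL; have := HU NL'; have := HV NL'; lra.
have -> : \sum_(i < L - N) a (N + i)%N * ker (N + i).+1 = \sum_(i < n.+1) a' i * w (N + i).+1.
  rewrite nE; apply: eq_bigr => i _; rewrite /a' -mulrA -kerE //.
    by rewrite ltnS addn_gt0 N0.
  by rewrite -addnS -leq_subRL ?(ltnW NL) // nE ltn_ord.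
have LE : L = (N + n.+1)%N by rewrite -nE subnKC // ltnW.
have NR : 0 < N%:R :> R by rewrite ltr0n.
have XN : X / N%:R <= 2 * b%:R by rewrite ler_pdivrMr //; move: XNb; lra.
have qN : q N / N%:R * X <= q N * b%:R * 2.
  by rewrite mulrAC -mulrA -[leRHS]mulrA ler_wpM2l // mulrC; move: XN; lra.
apply: le_trans (abel_bound a' (fun i => w (N + i).+1) n) _.
have LR : 1 < L%:R :> R by rewrite ltr1n LE addnS ltnS addn_gt0 N0.
have h1 : normc (\sum_(i < n.+1) a' i) * normc (w (N + n).+1) <= q N * b%:R * 16.
  rewrite -addnS -LE; have pn := partial n.+1; rewrite -LE in pn.
  apply: (@le_trans _ _ (4 * q L * (2 * X / L%:R))).
    apply: ler_pM; rewrite ?normc_ge0 ?pn //.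
    have L1 : (1 < L)%N by rewrite -(ltr_nat R).
    apply: le_trans (norm_w L1 (leqnn L)) _.
    have L2 : 2 <= L%:R :> R by rewrite (ler_nat R 2).
    rewrite ler_pdivrMr ?subr_gt0 // mulrAC ler_pdivlMr; last lra.
    by move: X0; nra.
  have := ler_wpM2l (ltW X0) (q_last NL).
  have -> : 4 * q L * (2 * X / L%:R) = 8 * (X * (q L / L%:R)) by ring.
  by move: qN; lra.
have h2 : \sum_(i < n) normc (\sum_(j < i.+1) a' j) * normc (w (N + i.+1).+1 - w (N + i).+1) <=
    q N * b%:R * (16 * c * E).
  apply: (@le_trans _ _ (\sum_(i < n) 8 * c * X * (q (N + i.+1)%N / (N + i.+1)%:R ^+ 2))).
    apply: ler_sum => i _.
    have iL : (N + i.+2 <= L)%N by rewrite LE leq_add2l ltnS ltn_ord.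
    have i1 : (1 < N + i.+1)%N by rewrite addnS ltnS addn_gt0 N0.
    apply: (@le_trans _ _ (4 * q (N + i.+1)%N * (c * X * 2 / (N + i.+1)%:R ^+ 2))).
      apply: ler_pM; rewrite ?normc_ge0 //.
        by apply: partial; apply: leq_trans iL; rewrite leq_add2l.
      rewrite -[(N + i).+1]addnS; apply: le_trans (dw i1 _) _; first by rewrite -addnS.
      have i2 : 2 <= (N + i.+1)%:R :> R by rewrite (ler_nat R 2).
      move: i2; set v : R := (N + i.+1)%:R => v2.
      rewrite -[c * X * 2 / _]mulrA ler_wpM2l ?mulr_ge0 //.
      rewrite -[leLHS]mul1r ler_pdivrMr ?mulr_gt0 //; [|lra|lra].
      by rewrite mulrAC ler_pdivlMr ?exprn_gt0 //; [nra|lra].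
    by rewrite le_eqVlt; apply/orP; left; apply/eqP; ring.
  rewrite -mulr_sumr; have nn : (L - N.+1)%N = n by rewrite subnS nE.
  have := q_sum NL; rewrite nn => qs.
  have := ler_wpM2l (mulr_ge0 (mulr_ge0 (ler0n R 8) c0) (ltW X0)) qs.
  have := ler_wpM2l (mulr_ge0 (mulr_ge0 (ler0n R 8) c0) E0) qN.
  lra.
lra.
Qed.

Lemma abel_one_sided :
  normc (\sum_(i < L) a i * ker i.+1) <= q N * b%:R * (17 + c + 16 * c * E).
Proof.
have [LN|NL] := leqP L N.
  apply: le_trans (abel_inner (leqnn L) LN) _; rewrite ler_wpM2l ?mulr_ge0 //.
  have := mulr_ge0 c0 E0; lra.
rewrite -(subnKC (ltnW NL)) big_split_ord /=; apply: le_trans (normcD _ _) _.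
have -> : 17 + c + 16 * c * E = (1 + c) + (16 + 16 * c * E) by ring.
by rewrite mulrDr; apply: lerD; [exact: abel_inner (ltnW NL) (leqnn N)|exact: abel_outer].
Qed.

End Abel.

Section PowerSums.
Variable R : realType.

(** From 1 + x <= exp x at x = - 1 / (n + 1). *)
Lemma inv_le_ln_diff n : (0 < n)%N -> (n.+1%:R)^-1 <= ln n.+1%:R - ln n%:R :> R.
Proof.
move=> n0; have nR : 0 < n%:R :> R by rewrite ltr0n.
have SR : 0 < n.+1%:R :> R by rewrite ltr0n.
rewrite -ln_div ?posrE //.
have h : expR (n.+1%:R^-1) <= n.+1%:R / n%:R :> R.
  rewrite -[leRHS]invrK invf_div -[X in X <= _]invrK -expRN lef_pV2 ?posrE ?expR_gt0 ?divr_gt0 //.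
  apply: le_trans (expR_ge1Dx _); rewrite ler_pdivrMr // mulrDl mul1r mulNr mulVf ?gt_eqF //.
  by rewrite -natr1 addrK.
by rewrite -[leLHS]expRK ler_ln ?posrE ?expR_gt0 ?divr_gt0.
Qed.

Lemma powR_pos (x t : R) : 0 < x -> x `^ t = expR (t * ln x).
Proof. by move=> x0; rewrite /powR gt_eqF. Qed.

(** A discrete comparison with the integral of x^(- eta - 1), in a form that telescopes. *)
Lemma powR_step (eta : R) n : 0 < eta -> (0 < n)%N ->
  n.+1%:R `^ (- eta) / n.+1%:R <= eta^-1 * (n%:R `^ (- eta) - n.+1%:R `^ (- eta)).
Proof.
move=> eta0 n0; have nR : 0 < n%:R :> R by rewrite ltr0n.
have SR : 0 < n.+1%:R :> R by rewrite ltr0n.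
rewrite !powR_pos // -ler_pdivrMl ?invr_gt0 // invrK.
set Lm := ln n.+1%:R; set l := ln n%:R; have := inv_le_ln_diff n0; rewrite -/Lm -/l => h.
have -> : expR (- eta * l) = expR (- eta * Lm) * expR (eta * (Lm - l)).
  by rewrite -expRD; congr expR; ring.
rewrite mulrCA -{3}[expR (- eta * Lm)]mulr1 -mulrBr ler_wpM2l ?expR_ge0 //.
rewrite lerBrDl; apply: le_trans (expR_ge1Dx _); rewrite lerD2l ler_wpM2l //; exact: ltW.
Qed.

Lemma sum_powR (eta : R) N m : 0 < eta -> (0 < N)%N ->
  \sum_(i < m) (N + i.+1)%:R `^ (- eta) / (N + i.+1)%:R <= eta^-1 * N%:R `^ (- eta).
Proof.
move=> eta0 N0; apply: (@le_trans _ _ (eta^-1 * (N%:R `^ (- eta) - (N + m)%:R `^ (- eta)))).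
  elim: m => [|m IH]; first by rewrite big_ord0 addn0 subrr mulr0.
  rewrite big_ord_recr /= addnS.
  have Nm : (0 < N + m)%N by rewrite addn_gt0 N0.
  apply: le_trans (lerD IH (powR_step eta0 Nm)) _.
  by rewrite -mulrDr addrA subrK.
by rewrite ler_wpM2l ?invr_ge0 ?(ltW eta0) // gerBl powR_ge0.
Qed.

Lemma sum_inv_ln N m : (0 < N)%N ->
  \sum_(i < m) ((N + i.+1)%:R)^-1 <= ln (N + m)%:R - ln N%:R :> R.
Proof.
move=> N0; elim: m => [|m IH]; first by rewrite big_ord0 addn0 subrr.
rewrite big_ord_recr /= addnS.
apply: le_trans (lerD IH (inv_le_ln_diff (leq_trans N0 (leq_addr m N)))) _.
by rewrite addrC addrA subrK.
Qed.

Variables (D tau : R).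
Hypotheses (D0 : 0 <= D) (tau01 : 0 <= tau <= 1).
Definition qpow (n : nat) : R := D * n%:R `^ tau.

Lemma qpow_ge0 n : 0 <= qpow n.
Proof. by rewrite mulr_ge0 ?powR_ge0. Qed.

Lemma qpow_mono n m : (n <= m)%N -> qpow n <= qpow m.
Proof.
move=> nm; rewrite ler_wpM2l // ge0_ler_powR ?nnegrE ?ler_nat //; by case/andP: tau01.
Qed.

Lemma qpow_div n : (0 < n)%N -> qpow n / n%:R = D * n%:R `^ (- (1 - tau)).
Proof.
move=> n0; have nR : 0 < n%:R :> R by rewrite ltr0n.
rewrite /qpow -mulrA !powR_pos //; congr (_ * _).
have -> : n%:R^-1 = expR (- ln n%:R) :> R by rewrite expRN lnK ?posrE.
by rewrite -expRD; congr expR; ring.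
Qed.

Lemma qpow_last N L : (0 < N)%N -> (N <= L)%N -> qpow L / L%:R <= qpow N / N%:R.
Proof.
move=> N0 NL; rewrite !qpow_div //; last exact: leq_trans NL.
have NR : 0 < N%:R :> R by rewrite ltr0n.
have LR : 0 < L%:R :> R by rewrite ltr0n (leq_trans N0).
rewrite ler_wpM2l // !powR_pos // ler_expR !mulNr lerN2 ler_wpM2l //.
  by case/andP: tau01; lra.
by rewrite ler_ln ?posrE // ler_nat.
Qed.

Lemma qpow_sum (E : R) N L : (0 < N)%N -> (N < L)%N ->
  (tau < 1 -> (1 - tau)^-1 <= E) -> (tau = 1 -> ln L%:R <= E) ->
  \sum_(i < L - N.+1) qpow (N + i.+1)%N / (N + i.+1)%:R ^+ 2 <= E * (qpow N / N%:R).
Proof.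
move=> N0 NL E1 E2; have NR : 0 < N%:R :> R by rewrite ltr0n.
have tE i : qpow (N + i.+1)%N / (N + i.+1)%:R ^+ 2 =
    D * ((N + i.+1)%:R `^ (- (1 - tau)) / (N + i.+1)%:R).
  by rewrite expr2 invfM [LHS]mulrA qpow_div ?addn_gt0 ?N0 // [RHS]mulrA.
rewrite (eq_bigr _ (fun (i : 'I_(L - N.+1)) _ => tE i)) -mulr_sumr qpow_div // mulrCA ler_wpM2l //.
have [t1|t1] := ltrP tau 1.
  apply: le_trans (sum_powR _ _ N0) _; first lra.
  by rewrite ler_wpM2r ?powR_ge0 ?E1.
have {}t1 : tau = 1 by case/andP: tau01; lra.
rewrite t1 subrr oppr0 powRr0 mulr1 (eq_bigr (fun i : 'I__ => (N + i.+1)%:R^-1)); last first.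
  by move=> i _; rewrite powRr0 mul1r.
apply: le_trans (sum_inv_ln _ N0) (le_trans _ (E2 t1)).
have lN : 0 <= ln N%:R :> R by rewrite ln_ge0 // ler1n.
rewrite (@le_trans _ _ (ln (N + (L - N.+1))%:R)) ?gerBl //.
rewrite ler_ln ?posrE ?ltr0n ?addn_gt0 ?N0 ?ler_nat //; last exact: leq_trans NL.
by rewrite -[leqRHS](subnKC NL) leq_add2r.
Qed.

End PowerSums.

(** * Poisson summation *)

Section FiniteFourier.
Variable R : realType.
Local Notation e := (@e R).
Local Notation normc := (@ComplexField.Normc.normc R).
Local Notation conj := (@conjc R).

Lemma conj_e (x : R) : conj (e x) = e (- x).
Proof. by rewrite /Defs.e mulrN cosN sinN. Qed.

Lemma normc_conj (z : R[i]) : normc (conj z) = normc z.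
Proof. by case: z => a b /=; rewrite sqrrN. Qed.

Lemma mul_conj (z : R[i]) : z * conj z = ((normc z) ^+ 2)%:C%C.
Proof.
case: z => a b; simpc; rewrite /= sqr_sqrtr ?addr_ge0 ?sqr_ge0 //.
by congr Complex; ring.
Qed.

Variables (X : nat) (X2 : (1 < X)%N).
Let X0 : (0 : R) < X%:R. Proof. by rewrite ltr0n ltnW. Qed.
Let Xn0 : X%:R != 0 :> R. Proof. by rewrite gt_eqF. Qed.
Let XC0 : X%:R != 0 :> R[i]. Proof. by rewrite pnatr_eq0 -lt0n ltnW. Qed.

Lemma e_orth (h0 d : int) :
  \sum_(i < X) e ((h0 + (i : nat)%:Z)%:~R * d%:~R / X%:R) = if (X%:Z %| d)%Z then X%:R else 0.
Proof.
have -> : \sum_(i < X) e ((h0 + (i : nat)%:Z)%:~R * d%:~R / X%:R) =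
   e (h0%:~R * d%:~R / X%:R) * \sum_(i < X) e (d%:~R / X%:R) ^+ i.
  rewrite mulr_sumr; apply: eq_bigr => i _; rewrite -eMn -eD; congr e.
  by rewrite intrD -pmulrn -mulr_natr; ring.
case: ifP => dv.
  have /dvdzP[k dE] := dv.
  have e1 : e (d%:~R / X%:R) = 1 by rewrite dE intrM -pmulrn mulfK // e_int.
  have -> : e (h0%:~R * d%:~R / X%:R) = 1.
    by rewrite dE intrM -pmulrn mulrA mulfK // -intrM e_int.
  by rewrite mul1r e1 (eq_bigr (fun=> 1)) ?sumr_const ?card_ord // => i _; rewrite expr1n.
rewrite geom_sum_root ?mulr0 //.
  by rewrite -eMn -[_ *+ X]mulr_natr divfK // e_int.
have [k [r [dE r0 rX]]] : exists k r, [/\ d = k * X%:Z + r, 0 <= r & r < X%:Z].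
  exists (d %/ X%:Z)%Z, (d %% X%:Z)%Z; split; first exact: divz_eq.
    by rewrite modz_ge0 // -lt0n ltnW.
  by rewrite ltz_pmod // ltz_nat ltnW.
have -> : e (d%:~R / X%:R) = e (r%:~R / X%:R).
  by rewrite dE intrD intrM -pmulrn mulrDl mulfK // eD e_int mul1r.
apply: e_eq1; rewrite ltr_pdivrMr // mul1r [X%:R]pmulrn ltr_int rX andbT.
rewrite divr_gt0 // ltr0z lt_neqAle r0 andbT eq_sym; apply: contraFneq dv => rz.
by rewrite dE rz addr0 dvdz_mull.
Qed.

Variables (phi c : int -> R[i]) (G : R[i]).
Hypotheses (phi1 : forall a, normc (phi a) = 1) (c1 : forall h, normc (c h) = 1).
Hypothesis phi_per : forall a, phi (a + X%:Z) = phi a.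
Hypothesis phi_hat : forall h : int,
  \sum_(i < X) phi (i : nat)%:Z * e (- (h%:~R * i%:R / X%:R)) = G * c h.

Lemma phi_modz (a : int) : phi (a %% X%:Z)%Z = phi a.
Proof.
have perM k b : phi (b + k%:Z * X%:Z) = phi b.
  elim: k => [|k IH]; first by rewrite mul0r addr0.
  by rewrite -addn1 PoszD mulrDl mul1r addrA phi_per.
rewrite [in RHS](divz_eq a X%:Z); case: (a %/ X%:Z)%Z => k; first by rewrite addrC perM.
by rewrite -[RHS](perM k.+1) NegzE addrAC mulNr addNr add0r.
Qed.

(** The first frequency h0 is free, which allows a window centred near - beta. *)
Lemma phi_inversion (h0 a : int) :
  X%:R * phi a = \sum_(i < X) G * c (h0 + (i : nat)%:Z) *
    e ((h0 + (i : nat)%:Z)%:~R * a%:~R / X%:R).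
Proof.
have E : \sum_(i < X) G * c (h0 + (i : nat)%:Z) * e ((h0 + (i : nat)%:Z)%:~R * a%:~R / X%:R) =
    \sum_(k < X) phi (k : nat)%:Z * (if (X%:Z %| a - (k : nat)%:Z)%Z then X%:R else 0).
  under eq_bigr => i _ do rewrite -phi_hat mulr_suml.
  rewrite exchange_big /=; apply: eq_bigr => k _; rewrite -(e_orth h0) mulr_sumr.
  apply: eq_bigr => i _; rewrite -mulrA -eD; congr (_ * e _).
  by rewrite intrB -pmulrn; ring.
pose r := `|(a %% X%:Z)%Z|%N.
have rE : (a %% X%:Z)%Z = r%:Z by rewrite /r gez0_abs // modz_ge0 // -lt0n ltnW.
have rX : (r < X)%N by rewrite -ltz_nat -rE ltz_pmod // ltz_nat ltnW.
rewrite E (bigD1 (Ordinal rX)) //= big1 => [|k kr].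
  have -> : (X%:Z %| a - r%:Z)%Z by rewrite -eqz_mod_dvd -rE modz_mod.
  by rewrite addr0 mulrC -rE phi_modz.
rewrite ifN ?mulr0 //; apply: contra kr; rewrite -eqz_mod_dvd => /eqP ak.
apply/eqP/val_inj => /=; apply/eqP; rewrite -eqz_nat -rE ak modz_small //.
by rewrite lez_nat ltz_nat ltn_ord.
Qed.

(** Parseval: X times the sum of |phi|^2 is X^2, while expanding one factor by inversion and
    recognising the transform in the other gives X |G|^2, because |c| = 1. *)
Lemma phi_hat_norm : normc G = Num.sqrt X%:R.
Proof.
have : X%:R * X%:R = X%:R * ((normc G) ^+ 2)%:C%C :> R[i].
  transitivity (\sum_(a < X) (X%:R * phi (a : nat)%:Z) * conj (phi (a : nat)%:Z)).
    rewrite (eq_bigr (fun=> X%:R)) ?sumr_const ?card_ord ?mulr_natr // => a _.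
    by rewrite -mulrA mul_conj phi1 expr1n mulr1.
  under eq_bigr => a _ do rewrite (phi_inversion 0) mulr_suml.
  rewrite exchange_big /= (eq_bigr (fun=> ((normc G) ^+ 2)%:C%C)).
    by rewrite sumr_const card_ord mulr_natl.
  move=> i _; under eq_bigr => a _ do rewrite -!mulrA.
  rewrite -!mulr_sumr add0r.
  have -> : \sum_(a < X) e ((i : nat)%:~R * ((a : nat)%:~R / X%:R)) * conj (phi (a : nat)) = conj (G * c (i : nat)).
    rewrite -phi_hat rmorph_sum; apply: eq_bigr => a _.
    by rewrite rmorphM mulrC; congr (_ * _); rewrite [RHS]conj_e opprK mulrA.
  by rewrite (mulrA G) mul_conj ComplexField.Normc.normcM c1 mulr1.
move/(mulfI XC0) => /(congr1 (@complex.Re R)).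
rewrite -(rmorph_nat (real_complex R)) /= => ->.
by rewrite sqrtr_sqr ger0_norm // normc_ge0.
Qed.

End FiniteFourier.

Section PoissonBound.
Variable R : realType.
Local Notation e := (@e R).
Local Notation normc := (@ComplexField.Normc.normc R).
Local Notation conj := (@conjc R).

Variables (X : nat) (X2 : (1 < X)%N).
Let X0 : (0 : R) < X%:R. Proof. by rewrite ltr0n ltnW. Qed.
Let Xn0 : X%:R != 0 :> R. Proof. by rewrite gt_eqF. Qed.
Let XC0 : X%:R != 0 :> R[i]. Proof. by rewrite pnatr_eq0 -lt0n ltnW. Qed.

Variables (phi c : int -> R[i]) (G : R[i]).
Hypotheses (phi1 : forall a, normc (phi a) = 1) (c1 : forall h, normc (c h) = 1).
Hypothesis phi_per : forall a, phi (a + X%:Z) = phi a.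
Hypothesis phi_hat : forall h : int,
  \sum_(i < X) phi (i : nat)%:Z * e (- (h%:~R * i%:R / X%:R)) = G * c h.
Variables (D tau E : R).
Hypotheses (D0 : 0 <= D) (tau01 : 0 <= tau <= 1) (E0 : 0 <= E).
(* E is the loss in \sum_(i > N) i^(tau - 2) <= E N^(tau - 1), the sum being cut at X. *)
Hypothesis E_lt1 : tau < 1 -> (1 - tau)^-1 <= E.
Hypothesis E_eq1 : tau = 1 -> ln X%:R <= E.
Hypothesis c_sum : forall (q M : int) (H : nat), (0 < H <= X)%N ->
  normc (\sum_(1 <= j < H.+1) c (M + j%:Z) * e (q%:~R * (M + j%:Z)%:~R / X%:R)) <= qpow D tau H.

Variables (beta : R) (M : int) (b : nat) (b0 : (0 < b)%N) (bX : (b <= X)%N).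
(** [N] is the number of frequencies on each side of - beta where the kernel does not decay. Those
    to the right are h0 + i + 1, at distance i + 1 - xi; those to the left are h0 - i, at distance i
    + 1 - (1 - xi). *)
Let N := (X %/ b)%N.
Let h0 : int := Num.floor (- beta).
Let xi : R := - beta - h0%:~R.

Let xi01 : 0 <= xi <= 1.
Proof.
rewrite /xi subr_ge0 floor_le /= lerBlDl; apply/ltW.
by have := floorD1_gt (- beta); rewrite intrD.
Qed.

Let xi01' : 0 <= 1 - xi <= 1.
Proof. by case/andP: xi01 => ? ?; apply/andP; split; lra. Qed.

Let N0 : (0 < N)%N. Proof. by rewrite divn_gt0. Qed.
Let NbX : N%:R * b%:R <= X%:R :> R.
Proof. by rewrite -natrM ler_nat leq_divM. Qed.
Let XNb : X%:R <= 2 * (N%:R * b%:R) :> R.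
Proof.
rewrite -natrM -[2]/(2%:R) -natrM ler_nat.
have := divn_eq X b; have := ltn_pmod X b0; rewrite -/N => h1 h2.
have : (b <= N * b)%N by rewrite leq_pmull.
by move: h1 h2; move: (N * b)%N (X %% b)%N => u v; clear; lia.
Qed.

Let dual (a : nat -> R[i]) (t : R) (L : nat) : 0 <= t <= 1 -> L%:R <= 3 / 4 * X%:R :> R ->
  (forall n, (n <= L)%N -> normc (\sum_(i < n) a i) <= qpow D tau n) ->
  (forall n, (n <= L)%N -> normc (\sum_(i < n) a i * e ((i.+1%:R - t) / X%:R) ^+ b) <= qpow D tau n) ->
  normc (\sum_(i < L) a i * \sum_(j < b) e ((i.+1%:R - t) / X%:R) ^+ j.+1)
    <= qpow D tau N * b%:R * (17 + 4 * pi + 16 * (4 * pi) * E).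
Proof.
move=> t01 LX HU HV.
apply: (abel_one_sided X0 t01 N0 NbX XNb LX (erefl _) (qpow_ge0 tau D0) (qpow_mono D0 tau01) HU HV E0) => // NL.
- apply: (qpow_sum D0 tau01 N0 NL E_lt1) => t1; apply: le_trans (E_eq1 t1).
  have L0 : (0 < L)%N by exact: leq_ltn_trans NL.
  rewrite ler_ln ?posrE ?X0 ?ltr0n //; apply: le_trans LX _.
  by rewrite -[leRHS]mul1r (ler_wpM2r (ltW X0)) // ler_pdivrMr // mul1r ler_nat.
- exact: (qpow_last D0 tau01 N0 (ltnW NL)).
Qed.

Let sum_right (q : int) n : (n <= X)%N ->
  normc (\sum_(i < n) c (h0 + i.+1%:Z) * e (q%:~R * ((h0 + i.+1%:Z)%:~R + beta) / X%:R)) <= qpow D tau n.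
Proof.
case: n => [_|n nX]; first by rewrite big_ord0 ComplexField.Normc.normc0 qpow_ge0.
have := c_sum q h0 (nX : (0 < n.+1 <= X)%N); rewrite big_add1 /= big_mkord.
congr (_ <= _).
have -> : \sum_(i < n.+1) c (h0 + i.+1%:Z) * e (q%:~R * ((h0 + i.+1%:Z)%:~R + beta) / X%:R) =
   e (q%:~R * beta / X%:R) * \sum_(i < n.+1) c (h0 + i.+1%:Z) * e (q%:~R * (h0 + i.+1%:Z)%:~R / X%:R).
  rewrite mulr_sumr; apply: eq_bigr => i _.
  by rewrite [q%:~R * (_ + beta)]mulrDr mulrDl eD [e _ * e _]mulrC mulrCA.
by rewrite ComplexField.Normc.normcM normc_e mul1r.
Qed.

Let sum_left (q : int) n : (n <= X)%N ->
  normc (\sum_(i < n) c (h0 - (i : nat)%:Z) * e (q%:~R * ((h0 - (i : nat)%:Z)%:~R + beta) / X%:R)) <= qpow D tau n.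
Proof.
case: n => [_|n nX]; first by rewrite big_ord0 ComplexField.Normc.normc0 qpow_ge0.
have := c_sum q (h0 - n.+1%:Z) (nX : (0 < n.+1 <= X)%N); rewrite big_add1 /= big_mkord.
congr (_ <= _).
have -> : \sum_(i < n.+1) c (h0 - (i : nat)%:Z) * e (q%:~R * ((h0 - (i : nat)%:Z)%:~R + beta) / X%:R) =
   e (q%:~R * beta / X%:R) * \sum_(i < n.+1) c (h0 - n.+1%:Z + i.+1%:Z) * e (q%:~R * (h0 - n.+1%:Z + i.+1%:Z)%:~R / X%:R).
  rewrite mulr_sumr (reindex_inj rev_ord_inj) /=; apply: eq_bigr => i _.
  have -> : h0 - (n.+1 - i.+1)%N%:Z = h0 - n.+1%:Z + i.+1%:Z 
    by have := ltn_ord i; move: (i : nat) (h0); clear; lia.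
  by rewrite [q%:~R * (_ + beta)]mulrDr mulrDl eD [e _ * e _]mulrC mulrCA.
by rewrite ComplexField.Normc.normcM normc_e mul1r.
Qed.

(** The two halves of the window, the left one taking the extra frequency when X is odd. Since X >=
    2, both stay below 3X/4. *)
Let L1 := (X %/ 2)%N.
Let L2 := (X - L1)%N.

Let half_le : L1%:R <= 3 / 4 * X%:R :> R /\ L2%:R <= 3 / 4 * X%:R :> R.
Proof.
have h1 : (4 * L1 <= 3 * X)%N by rewrite /L1; move: (X); clear; lia.
have h2 : (4 * L2 <= 3 * X)%N by rewrite /L2 /L1; move: X2; move: (X); clear; lia.
by move: h1 h2; rewrite -!(ler_nat R) !natrM; move: (X%:R : R) (L1%:R : R) (L2%:R : R) => x y z h1 h2; split; lra.
Qed.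

Let kern (x : R) := \sum_(j < b) e (x * (M + j.+1%:Z)%:~R / X%:R).

Let kernE x : kern x = e (x * M%:~R / X%:R) * \sum_(j < b) e (x / X%:R) ^+ j.+1.
Proof.
rewrite mulr_sumr; apply: eq_bigr => j _; rewrite -eMn -eD; congr e.
by rewrite intrD -pmulrn -mulr_natr; ring.
Qed.

Let Cst : R := 17 + 4 * pi + 16 * (4 * pi) * E.

(** The factor e(x M / X) of [kern] is moved into the coefficients. Their partial sums are then
    [c_sum] with q = M, and those twisted by the b-th power are [c_sum] with q = M + b; the shift by
    beta only contributes a constant phase. *)
Let right_bound :
  normc (\sum_(i < L1) c (h0 + i.+1%:Z) * kern ((h0 + i.+1%:Z)%:~R + beta)) <= qpow D tau N * b%:R * Cst.
Proof.
have xE i : (h0 + i.+1%:Z)%:~R + beta = i.+1%:R - xi by rewrite intrD -pmulrn /xi; ring.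
have L1X n : (n <= L1)%N -> (n <= X)%N by move=> h; apply: leq_trans h (leq_div _ _).
pose a i := c (h0 + i.+1%:Z) * e (((h0 + i.+1%:Z)%:~R + beta) * M%:~R / X%:R).
have -> : \sum_(i < L1) c (h0 + i.+1%:Z) * kern ((h0 + i.+1%:Z)%:~R + beta) =
    \sum_(i < L1) a i * \sum_(j < b) e ((i.+1%:R - xi) / X%:R) ^+ j.+1.
  by apply: eq_bigr => i _; rewrite kernE mulrA -/(a i) xE.
apply: dual => //; first exact: half_le.1.
- move=> n /L1X nX; have := sum_right M nX; congr (normc _ <= _).
  by apply: eq_bigr => i _; rewrite /a [_ * M%:~R]mulrC.
- move=> n /L1X nX; have := sum_right (M + b%:Z) nX; congr (normc _ <= _).
  apply: eq_bigr => i _; rewrite /a -[RHS]mulrA -eMn -eD -xE; congr (_ * e _).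
  by rewrite intrD -pmulrn -mulr_natr; ring.
Qed.

(** Complex conjugation reverses the sign of h + beta and leads back to the one-sided estimate, with
    1 - xi in place of xi. *)
Let left_bound :
  normc (\sum_(i < L2) c (h0 - (i : nat)%:Z) * kern ((h0 - (i : nat)%:Z)%:~R + beta)) <= qpow D tau N * b%:R * Cst.
Proof.
have xE (i : nat) : (h0 - i%:Z)%:~R + beta = - (i.+1%:R - (1 - xi)).
  by rewrite intrB -pmulrn -natr1 /xi; ring.
have L2X n : (n <= L2)%N -> (n <= X)%N by move=> h; apply: leq_trans h (leq_subr _ _).
pose a (i : nat) := conj (c (h0 - i%:Z) * e (((h0 - i%:Z)%:~R + beta) * M%:~R / X%:R)).
rewrite -normc_conj rmorph_sum.
have -> : \sum_(i < L2) conj (c (h0 - (i : nat)%:Z) * kern ((h0 - (i : nat)%:Z)%:~R + beta)) =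
    \sum_(i < L2) a i * \sum_(j < b) e ((i.+1%:R - (1 - xi)) / X%:R) ^+ j.+1.
  apply: eq_bigr => i _; rewrite kernE mulrA [LHS]rmorphM; congr (_ * _).
  rewrite rmorph_sum; apply: eq_bigr => j _; rewrite [LHS]rmorphXn; congr (_ ^+ _).
  by rewrite [LHS]conj_e xE mulNr opprK.
apply: dual => //; first exact: half_le.2.
- move=> n /L2X nX; have := sum_left M nX; rewrite -normc_conj rmorph_sum; congr (normc _ <= _).
  by apply: eq_bigr => i _; rewrite /a [_ * M%:~R]mulrC.
- move=> n /L2X nX.
  have := sum_left (M + b%:Z) nX; rewrite -normc_conj rmorph_sum; congr (normc _ <= _).
  apply: eq_bigr => i _; rewrite /a.
  have -> : e ((i.+1%:R - (1 - xi)) / X%:R) ^+ b = conj (e (((h0 - (i : nat)%:Z)%:~R + beta) * b%:R / X%:R)).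
    by rewrite conj_e -eMn xE; congr e; rewrite -mulr_natr; ring.
  rewrite -[RHS]rmorphM -[X in _ = conj X]mulrA -eD; congr (conj (_ * e _)).
  by rewrite intrD -pmulrn; ring.
Qed.

Lemma poisson_bound :
  normc (\sum_(1 <= j < b.+1) e (beta * (M + j%:Z)%:~R / X%:R) * phi (M + j%:Z)) <=
  (Num.sqrt X%:R)^-1 * (2 * (qpow D tau N * b%:R * Cst)).
Proof.
pose F (h : int) := c h * kern (h%:~R + beta).
set S := (X in normc X).
have SE : X%:R * S = G * (\sum_(i < L2) F (h0 - (i : nat)%:Z) + \sum_(i < L1) F (h0 + i.+1%:Z)).
  have -> : \sum_(i < L2) F (h0 - (i : nat)%:Z) + \sum_(i < L1) F (h0 + i.+1%:Z) =
      \sum_(i < X) F (h0 - L2%:Z + 1 + (i : nat)%:Z).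
    have XE : X = (L2 + L1)%N by rewrite /L2 subnK // leq_div.
    rewrite [in RHS]XE big_split_ord /=; congr (_ + _).
      rewrite (reindex_inj rev_ord_inj) /=; apply: eq_bigr => i _; congr F.
      by have := ltn_ord i; move: (L2) (h0) (i : nat); clear; lia.
    by apply: eq_bigr => i _; congr F; rewrite PoszD; move: (L2) (h0) (i : nat); clear; lia.
  rewrite /S big_add1 big_mkord mulr_sumr mulr_sumr.
  have -> : \sum_(i < X) G * F (h0 - L2%:Z + 1 + (i : nat)%:Z) =
     \sum_(i < X) \sum_(j < b) G * c (h0 - L2%:Z + 1 + (i : nat)%:Z) *
        e (((h0 - L2%:Z + 1 + (i : nat)%:Z)%:~R + beta) * (M + j.+1%:Z)%:~R / X%:R).
    by apply: eq_bigr => i _; rewrite /F mulrA mulr_sumr.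
  rewrite exchange_big; apply: eq_bigr => j _.
  rewrite mulrCA (phi_inversion X2 phi_per phi_hat (h0 - L2%:Z + 1)) mulr_sumr.
  apply: eq_bigr => i _; rewrite mulrCA -eD; congr (_ * e _).
  by rewrite -mulrDl -mulrDl addrC.
have GE := phi_hat_norm X2 phi1 c1 phi_per phi_hat.
have : normc (X%:R * S) <= Num.sqrt X%:R * (2 * (qpow D tau N * b%:R * Cst)).
  rewrite SE ComplexField.Normc.normcM GE ler_wpM2l ?sqrtr_ge0 //.
  apply: le_trans (normcD _ _) _; rewrite mulr2n mulrDl !mul1r.
  exact: lerD left_bound right_bound.
have sX : 0 < Num.sqrt X%:R :> R by rewrite sqrtr_gt0.
have normX : normc (X%:R : R[i]) = Num.sqrt X%:R * Num.sqrt X%:R.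
  rewrite -expr2 sqr_sqrtr ?(ltW X0) //.
  by rewrite -(rmorph_nat (real_complex R)) /= expr0n addr0 sqrtr_sqr ger0_norm ?(ltW X0).
rewrite ComplexField.Normc.normcM normX -mulrA ler_pM2l // => h.
by rewrite ler_pdivlMl.
Qed.

End PoissonBound.

Section Exponents.
Variable R : realType.
Implicit Types X B b k l : R.

Lemma sqrt_powR X : 0 < X -> (Num.sqrt X)^-1 = X `^ (- 2^-1).
Proof. by move=> X0; rewrite powRN powR12_sqrt // ltW. Qed.

(** Brings the given bound to the shape D H^tau of [qpow], with tau = l - k and X^k put into D. *)
Lemma primal_exponents X B k l : 0 < X -> 0 < B ->
  (X / B) `^ k * B `^ l = X `^ k * B `^ (l - k).
Proof.
move=> X0 B0; rewrite !powR_pos ?divr_gt0 // -!expRD ln_div ?posrE //.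
by congr expR; ring.
Qed.

(** With b in place of B the two sides agree exactly, as X^(-1/2) X^k b = (X/b)^(k - 1/2) b^(k +
    1/2). Passing from b to B costs 2^(l - 1/2) <= 2. *)
Lemma dual_exponents X B b k l : 0 < X -> 0 < b -> b <= B -> B <= 2 * b ->
  0 <= k -> 2^-1 <= l <= 1 ->
  (Num.sqrt X)^-1 * (X `^ k * (X / b) `^ (l - k) * b) <=
    2 * ((X / B) `^ (l - 2^-1) * B `^ (k + 2^-1)).
Proof.
move=> X0 b0 bB Bb k0 /andP [l0 l1].
have B0 : 0 < B by exact: lt_le_trans bB.
have -> : (Num.sqrt X)^-1 * (X `^ k * (X / b) `^ (l - k) * b) =
    (X / b) `^ (l - 2^-1) * b `^ (k + 2^-1).
  rewrite sqrt_powR // -[X in _ * (_ * X)](powRr1 (ltW b0)) !powR_pos ?divr_gt0 //.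
  by rewrite -!expRD ln_div ?posrE //; congr expR; field.
rewrite mulrA; apply: ler_pM; rewrite ?powR_ge0 //; last first.
  by rewrite ge0_ler_powR ?nnegrE ?(ltW b0) ?(ltW B0) // addr_ge0 // invr_ge0.
apply: (@le_trans _ _ ((2 * (X / B)) `^ (l - 2^-1))).
  rewrite ge0_ler_powR ?nnegrE ?subr_ge0 ?(divr_ge0 (ltW X0) (ltW b0)) //.
    by rewrite mulr_ge0 // divr_ge0 ?ltW.
  rewrite mulrCA ler_wpM2l ?(ltW X0) // -[leLHS]mul1r ler_pdivrMr //.
  by rewrite mulrAC ler_pdivlMr // mul1r.
rewrite powRM ?divr_ge0 ?(ltW X0) ?(ltW B0) // ler_wpM2r ?powR_ge0 //.
rewrite -[leRHS]powRr1 // ler_powR ?ler1n //; lra.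
Qed.

(** In the given ranges l - k = 1 holds only at (k, l) = (0, 1), so this is where the extra
    logarithm is decided. In that case the additive constant is absorbed using ln X >= ln 2. *)
Lemma kernel_const k l : 0 <= k <= 2^-1 -> 2^-1 <= l <= 1 ->
  exists2 C : R, 0 <= C & forall X : nat, (1 < X)%N -> exists E : R,
   [/\ 0 <= E, l - k < 1 -> (1 - (l - k))^-1 <= E, l - k = 1 -> ln X%:R <= E &
     17 + 4 * pi + 16 * (4 * pi) * E <= C * ln X%:R `^ (if (k == 0) && (l == 1) then 1 else 0)].
Proof.
move=> /andP [k0 k1] /andP [l0 l1]; have pi0 : 0 <= pi :> R by exact: pi_ge0.
have [/andP [/eqP kE /eqP lE]|kl] := ifPn.
  have ln2 : 0 < ln 2 :> R by rewrite ln_gt0 // ltr1n.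
  exists ((17 + 4 * pi) / ln 2 + 16 * (4 * pi)).
    apply: addr_ge0; last by do !apply: mulr_ge0.
    by apply: divr_ge0; [lra|exact: ltW].
  move=> X X2; exists (ln X%:R).
  have lnX : ln 2 <= ln X%:R :> R by rewrite ler_ln ?posrE ?ltr0n ?(ltnW X2) // ler_nat.
  have lnX0 : 0 <= ln X%:R :> R by rewrite (le_trans _ lnX) // ltW.
  split=> //; first by rewrite kE lE subr0 ltxx.
  rewrite powRr1 // [leRHS]mulrDl lerD2r -mulrA ler_peMr //; first lra.
  by rewrite mulrC ler_pdivlMr // mul1r.
have t1 : l - k < 1.
  rewrite lt_neqAle (_ : l - k <= 1) ?andbT; last lra.
  by apply: contraNneq kl => lk; apply/andP; split; apply/eqP; lra.
exists (17 + 4 * pi + 16 * (4 * pi) * (1 - (l - k))^-1).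
  apply: addr_ge0; first lra.
  by apply: mulr_ge0; [do !apply: mulr_ge0|rewrite invr_ge0 subr_ge0 ltW].
move=> X X2; exists (1 - (l - k))^-1; split=> //.
- by rewrite invr_ge0 subr_ge0 ltW.
- by move=> t1'; move: t1; rewrite t1' ltxx.
- by rewrite powRr0 mulr1.
Qed.

End Exponents.

(** * Exponent data *)

Section ExponentData.
Local Open Scope classical_set_scope.
Variable R : realType.

Lemma prime_val_inj : injective prime_val.
Proof.
by case=> p pP [q qP] /= pq; case: q / pq qP => qP; congr PrimeNumber; exact: bool_irrelevance.
Qed.

Lemma finite_ordq_neq0 (y : rat) : y != 0 -> finite_set [set p : prime_number | ordq p y != 0].
Proof.
move=> y0; pose N := (`|numq y| + `|denq y|)%N.
apply: (@sub_finite_set _ _ (prime_val @^-1` `I_N.+1)) => [p /=|].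
  apply: contraR; rewrite ltnS -ltnNge => Np.
  have log0 m : (0 < m <= N)%N -> logn p m = 0%N.
    case/andP=> m0 mN; rewrite lognE; case: ifP => // /and3P [_ _ /(dvdn_leq m0)].
    by move/leq_trans/(_ mN); rewrite leqNgt Np.
  rewrite /ordq !log0 ?subrr // absz_gt0 ?numq_eq0 ?denq_neq0 ?y0 /= ?leq_addr ?leq_addl //.
apply: finite_preimage; last exact: finite_II.
by move=> p q _ _; exact: prime_val_inj.
Qed.

(** kappa is kappa (p - 1) times rho, so kappa - rho_p(y) is again an integer multiple of rho. *)
Lemma lambda_tilde_admissible (p : prime_number) (y : rat) kappa (lambda : R) :
  admissible p kappa lambda -> admissible p kappa (lambda_tilde y p kappa lambda).
Proof.
move=> adm; have := lambda_tilde_gt0 y adm; case: adm => k1 [j j0 lE] lt0; split=> //.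
have rho0 := rho_gt0 p R.
suff [i iE] : exists i : nat, lambda_tilde y p kappa lambda = i%:R * rho R p.
  exists i => //; rewrite lt0n; apply: contraTneq lt0 => i0.
  by rewrite iE i0 mul0r ltxx.
rewrite /lambda_tilde minElt; case: ifP => _; last by exists j.
exists (kappa * (p.-1) - (ordq p y != 0))%N.
have p1 : (0 < p.-1)%N by rewrite -subn1 subn_gt0 (prime_gt1 (prime_valP p)).
have kp : ((ordq p y != 0) <= kappa * p.-1)%N.
  apply: leq_trans (leq_b1 _) _; rewrite muln_gt0 p1 andbT.
  by move: k1; rewrite (iotap_nat p 2); clear; lia.
rewrite natrB // mulrBl natrM -mulrA.
have -> : p.-1%:R * rho R p = 1.
  have pE : p.-1%:R = p%:R - 1 :> R by rewrite -subn1 natrB // prime_gt0 // prime_valP.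
  by rewrite /rho -pE mulfV // pnatr_eq0 -lt0n.
by rewrite mulr1 /rho_at; case: ifP; rewrite ?mul1r ?mul0r.
Qed.

Lemma ordq1 (p : prime_number) : ordq p 1 = 0.
Proof. by rewrite /ordq (numq_int 1) (denq_int 1) logn1. Qed.

Lemma lambda_tilde_ord0 (p : prime_number) (y : rat) kappa (lambda : R) :
  ordq p y = 0 -> lambda_tilde y p kappa lambda = lambda_tilde 1 p kappa lambda.
Proof. by move=> y0; rewrite /lambda_tilde /rho_at y0 ordq1. Qed.

(** Outside the finitely many primes with ord_p y nonzero, [F] and the new slope take the values
    they have at y = 1, so the comparison function is built at y = 1 and these primes join the
    exceptional set. *)
Lemma J1_dual (shared : bool) (T T' : Type) (Y : set T) (Y' : set T')
    (g : rat -> prime_number -> nat -> R -> T)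
    (F : rat -> prime_number -> nat -> R -> T -> T') :
  J1 shared Y g ->
  (forall y p kappa lambda t, 0 < y -> admissible p kappa lambda -> Y t -> Y' (F y p kappa lambda t)) ->
  (forall y p kappa lambda t, ordq p y = 0 -> F y p kappa lambda t = F 1 p kappa lambda t) ->
  J1 shared Y' (fun y p kappa lambda =>
    F y p kappa lambda (g y^-1 p kappa (lambda_tilde y p kappa lambda))).
Proof.
case=> Yg gP YF F0; split=> [y p kappa lambda y0 adm|].
  by apply: YF => //; apply: Yg; rewrite ?invr_gt0 //; exact: lambda_tilde_admissible.
pose h (g0 : prime_number -> nat -> R -> T) p kappa lambda :=
  F 1 p kappa lambda (g0 p kappa (lambda_tilde 1 p kappa lambda)).
have agree y g0 : 0 < y ->
    (exists P0 : set prime_number, finite_set P0 /\ forall p kappa lambda, ~ P0 p ->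
       admissible p kappa lambda -> g y^-1 p kappa lambda = g0 p kappa lambda) ->
    exists P0 : set prime_number, finite_set P0 /\ forall p kappa lambda, ~ P0 p ->
       admissible p kappa lambda ->
       F y p kappa lambda (g y^-1 p kappa (lambda_tilde y p kappa lambda)) = h g0 p kappa lambda.
  move=> y0 [P0 [finP0 gE]]; exists (P0 `|` [set p : prime_number | ordq p y != 0]); split.
    by rewrite finite_setU; split=> //; apply: finite_ordq_neq0; rewrite gt_eqF.
  move=> p kappa lambda /not_orP [nP /negP]; rewrite negbK => /eqP py adm.
  rewrite gE //; last exact: lambda_tilde_admissible.
  by rewrite F0 // lambda_tilde_ord0.
case: shared gP => gP; first case: gP => g0 gP.
  by exists (h g0) => y y0; apply: agree => //; apply: gP; rewrite invr_gt0.
move=> y y0; have [g0 g0P] := gP y^-1 (etrans (invr_gt0 y) y0).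
by exists (h g0); exact: agree.
Qed.

Lemma J_dual (shared : bool) (T1 T2 T' : Type) (Y1 : set T1) (Y2 : set T2) (Y' : set T')
    (g1 : rat -> prime_number -> T1) (g2 : rat -> prime_number -> T2)
    (F : rat -> prime_number -> T1 -> T2 -> T') :
  J shared Y1 g1 -> J shared Y2 g2 ->
  (forall y p t1 t2, 0 < y -> Y1 t1 -> Y2 t2 -> Y' (F y p t1 t2)) ->
  (forall y p t1 t2, ordq p y = 0 -> F y p t1 t2 = F 1 p t1 t2) ->
  J shared Y' (fun y p => F y p (g1 y^-1 p) (g2 y^-1 p)).
Proof.
case=> Yg1 g1P [Yg2 g2P] YF F0; split=> [y p y0|].
  by apply: YF => //; [apply: Yg1|apply: Yg2]; rewrite invr_gt0.
pose h (g0 : prime_number -> T1) (g0' : prime_number -> T2) p := F 1 p (g0 p) (g0' p).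
have agree y g0 g0' : 0 < y ->
    (exists P0 : set prime_number, finite_set P0 /\ forall p, ~ P0 p -> g1 y^-1 p = g0 p) ->
    (exists P0 : set prime_number, finite_set P0 /\ forall p, ~ P0 p -> g2 y^-1 p = g0' p) ->
    exists P0 : set prime_number, finite_set P0 /\ forall p, ~ P0 p ->
       F y p (g1 y^-1 p) (g2 y^-1 p) = h g0 g0' p.
  move=> y0 [P1 [finP1 g1E]] [P2 [finP2 g2E]].
  exists (P1 `|` P2 `|` [set p : prime_number | ordq p y != 0]); split.
    by rewrite !finite_setU; split=> //; apply: finite_ordq_neq0; rewrite gt_eqF.
  move=> p /not_orP [/not_orP [nP1 nP2] /negP]; rewrite negbK => /eqP py.
  by rewrite g1E // g2E // F0.
case: shared g1P g2P => g1P g2P.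
  case: g1P g2P => [g0 g1P] [g0' g2P].
  by exists (h g0 g0') => y y0; apply: agree => //; [apply: g1P|apply: g2P]; rewrite invr_gt0.
move=> y y0; have y1 : 0 < y^-1 by rewrite invr_gt0.
have [[g0 g0P] [g0' g0P']] := (g1P y^-1 y1, g2P y^-1 y1).
by exists (h g0 g0'); exact: agree.
Qed.

End ExponentData.

Section DualBound.
Variables (R : realType) (p : prime_number).
Local Notation Qp := (padic p).
Local Notation normc := (@ComplexField.Normc.normc R).
Local Notation padic_e := (@padic_e R p).

(** The factor 4 combines the two sides of - beta with the loss in replacing B by its integer
    part. *)
Lemma dual_bound (y : rat) (w : int) (kappa : nat) (lambda : R) (n u u' s : nat) (f : nat -> Qp)
    (M : int) (B k l D E : R) :
  y != 0 -> admissible p kappa lambda ->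
  1 + iotap p 4 <= kappa%:Z ->
  n%:Z - w - kappa%:Z - iotap p y = s%:Z -> 1 + iotap p 12 <= s%:Z ->
  kappa%:Z - Num.floor lambda + iotap p y + 1 <= u%:Z ->
  u'%:Z = u%:Z - ordq p y - Num.ceil (lambda_tilde y p kappa lambda) + Num.floor lambda ->
  classF w y kappa lambda u f ->
  0 <= k <= 2^-1 -> 2^-1 <= l <= 1 -> 0 <= D -> 0 <= E ->
  (l - k < 1 -> (1 - (l - k))^-1 <= E) -> (l - k = 1 -> ln (p ^ s)%N%:R <= E) ->
  (forall f', classF (w + ordq p y) y^-1 kappa (lambda_tilde y p kappa lambda) u' f' ->
     forall (M : int) (H : nat), (0 < H <= p ^ s)%N ->
     normc (\sum_(1 <= j < H.+1) padic_e (pseries_eval R f' (M + j%:Z)%:~R / p%:R ^+ n))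
       <= D * ((p ^ s)%N%:R / H%:R) `^ k * H%:R `^ l) ->
  0 < B <= (p ^ s)%N%:R ->
  normc (\sum_(1 <= j < (Num.truncn B).+1) padic_e (pseries_eval R f (M + j%:Z)%:~R / p%:R ^+ n))
    <= 4 * (17 + 4 * pi + 16 * (4 * pi) * E) * D * ((p ^ s)%N%:R / B) `^ (l - 2^-1) * B `^ (k + 2^-1).
Proof.
move=> y0 adm k4 sE s12 uE u'E fF k01 l01 D0 E0 E1 E2 Hf /andP [B0 BX].
have [beta [K0 [G [phi [c [[K1 phi1 c1 phi_per] [fE phi_hat f'E]]]]]]] :=
  poisson_data y0 adm k4 sE s12 uE u'E fF.
set X := (p ^ s)%N in E2 Hf BX phi_per *.
have XE : p%:R ^+ s = X%:R :> R by rewrite -natrX.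
rewrite XE in fE phi_hat f'E.
have s1 : (0 < s)%N by move: s12; rewrite (iotap_nat p 12); clear; lia.
have X2 : (1 < X)%N by rewrite -(exp1n s) ltn_exp2r // prime_gt1 // prime_valP.
have X0 : 0 < X%:R :> R by rewrite ltr0n ltnW.
have Cst0 : 0 <= 17 + 4 * pi + 16 * (4 * pi) * E.
  have pi0 : 0 <= pi :> R by exact: pi_ge0.
  by rewrite addr_ge0 ?mulr_ge0 //; lra.
(* For B < 1 the sum is empty; otherwise b = truncn B satisfies b <= B <= 2b. *)
have [b0|b0] := posnP (Num.truncn B).
  by rewrite b0 big_geq // ComplexField.Normc.normc0 !mulr_ge0 ?powR_ge0.
set b := Num.truncn B in b0 *.
have bB : b%:R <= B by rewrite truncn_le ltW.
have bR : 1 <= b%:R :> R by rewrite ler1n.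
have Bb : B <= 2 * b%:R.
  by have := truncnS_gt B; rewrite -/b -natr1; move: bR; move: (b%:R : R) => z; lra.
have bX : (b <= X)%N by rewrite -(ler_nat R) (le_trans bB).
have c_sum (q M' : int) (H : nat) : (0 < H <= X)%N ->
   normc (\sum_(1 <= j < H.+1) c (M' + j%:Z) * e (q%:~R * (M' + j%:Z)%:~R / X%:R))
     <= qpow (D * X%:R `^ k) (l - k) H.
  move=> HX; have [f' f'F f'V] := f'E q.
  have := Hf f' f'F M' H HX.
  have H0 : 0 < H%:R :> R by rewrite ltr0n; case/andP: HX.
  rewrite -mulrA primal_exponents // mulrA /qpow; congr (normc _ <= _).
  by apply: eq_bigr => j _; rewrite f'V.
have tau01 : 0 <= l - k <= 1.
  by move: k01 l01 => /andP [? ?] /andP [? ?]; apply/andP; split; lra.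
have DX0 : 0 <= D * X%:R `^ k by rewrite mulr_ge0 ?powR_ge0.
have := poisson_bound X2 phi1 c1 phi_per phi_hat DX0 tau01 E0 E1 E2 c_sum beta M b0 bX.
have -> : \sum_(1 <= j < b.+1) padic_e (pseries_eval R f (M + j%:Z)%:~R / p%:R ^+ n) =
    K0 * \sum_(1 <= j < b.+1) e (beta * (M + j%:Z)%:~R / X%:R) * phi (M + j%:Z).
  by rewrite mulr_sumr; apply: eq_bigr => j _; rewrite fE mulrA.
rewrite ComplexField.Normc.normcM K1 mul1r => /le_trans; apply.
have b0R : 0 < b%:R :> R by rewrite ltr0n.
have k0 : 0 <= k by case/andP: k01.
have dual := dual_exponents X0 b0R bB Bb k0 l01.
have Nb : qpow (D * X%:R `^ k) (l - k) (X %/ b) <= D * (X%:R `^ k * (X%:R / b%:R) `^ (l - k)).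
  rewrite /qpow -mulrA ler_wpM2l // ler_wpM2l ?powR_ge0 // ge0_ler_powR ?nnegrE ?divr_ge0 //.
    by case/andP: tau01.
  by rewrite ler_pdivlMr // -natrM ler_nat leq_divM.
set Cst := 17 + _ + _ in Cst0 *.
apply: (@le_trans _ _ (2 * Cst * D * ((Num.sqrt X%:R)^-1 * (X%:R `^ k * (X%:R / b%:R) `^ (l - k) * b%:R)))).
  rewrite (_ : 2 * Cst * D * _ = (Num.sqrt X%:R)^-1 *
     (2 * ((D * (X%:R `^ k * (X%:R / b%:R) `^ (l - k))) * b%:R * Cst))); last by ring.
  by rewrite ler_wpM2l ?invr_ge0 ?sqrtr_ge0 // ler_wpM2l // ler_wpM2r // ler_wpM2r.
apply: le_trans (ler_wpM2l _ dual) _; first by rewrite !mulr_ge0.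
by rewrite le_eqVlt; apply/orP; left; apply/eqP; ring.
Qed.

End DualBound.

Theorem theorem4 (R : realType) (shared : bool) (k l : R)
    (r : rat -> prime_number -> nat -> R -> R) (delta : R)
    (n0 u0 : rat -> prime_number -> nat -> R -> int)
    (kappa0 : rat -> prime_number -> int)
    (lambda0 : rat -> prime_number -> R) :
  padic_exponent_datum shared k l r delta n0 u0 kappa0 lambda0 ->
  padic_exponent_datum shared
    (l - 2^-1) (k + 2^-1)
    (fun y p kappa lambda => r y^-1 p kappa (lambda_tilde y p kappa lambda))
    (delta + (if (k == 0) && (l == 1) then 1 else 0))
    (fun y p kappa lambda =>
       Num.max (kappa%:Z + iotap p y + 1 + iotap p 12)
         (ordq p y + n0 y^-1 p kappa (lambda_tilde y p kappa lambda)))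
    (fun y p kappa lambda =>
       Num.max (Num.max
         (kappa%:Z - Num.floor lambda + iotap p y + 1)
         (ordq p y + u0 y^-1 p kappa (lambda_tilde y p kappa lambda)
            + Num.ceil (lambda_tilde y p kappa lambda) - Num.floor lambda))
         1)
    (fun y p =>
       Num.ceil (Num.max (Num.max
         (1 + iotap p 4)%:~R
         (kappa0 y^-1 p)%:~R)
         (lambda0 y^-1 p + rho_at R p y)))
    (fun y p => lambda0 y^-1 p).
Proof.
move=> [[k01 l01 delta0] [[Jr Jn Ju Jk Jl] [n0_gt [C datum]]]].
have iotap_ge0 (p : prime_number) (y : rat) : 0 <= iotap p y by rewrite /iotap le_max lexx.
split; [|split; [split|split]].
- split.
  + by move: l01 => /andP [? ?]; apply/andP; split; lra.
  + by move: k01 => /andP [? ?]; apply/andP; split; lra.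
  + by rewrite addr_ge0 //; case: ifP.
- exact: (J1_dual (F := fun _ _ _ _ t => t) Jr).
- apply: (J1_dual (F := fun y p kappa _ t => Num.max (kappa%:Z + iotap p y + 1 + iotap p 12) (ordq p y + t)) Jn).
    move=> y p kappa lambda t _ _ _; rewrite /posint /= lt_max; apply/orP; left.
    by move: (iotap_ge0 p y) (iotap_ge0 p 12); lia.
  by move=> y p kappa lambda t py; rewrite /iotap py ordq1.
- apply: (J1_dual (F := fun y p kappa lambda t => Num.max (Num.max
         (kappa%:Z - Num.floor lambda + iotap p y + 1)
         (ordq p y + t + Num.ceil (lambda_tilde y p kappa lambda) - Num.floor lambda)) 1) Ju).
    by move=> *; rewrite /posint /= lt_max ltr01 orbT.
  by move=> y p kappa lambda t py; rewrite lambda_tilde_ord0 // /iotap py ordq1.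
- apply: (J_dual (F := fun y p t1 t2 => Num.ceil (Num.max (Num.max
         (1 + iotap p 4)%:~R t1%:~R) (t2 + rho_at R p y))) Jk Jl).
    move=> y p t1 t2 _ _ _; rewrite /posint /= ceil_gt0.
    by rewrite !lt_max ltr0z; apply/orP; left; apply/orP; left; move: (iotap_ge0 p 4); lia.
  by move=> y p t1 t2 py; rewrite /rho_at py ordq1.
- exact: (J_dual (F := fun _ _ _ t => t) Jk Jl).
- move=> y p kappa lambda y0 adm; rewrite lt_max; apply/orP; left.
  by move: (iotap_ge0 p 12); lia.
have [C2 C2_ge0 kern_const] := kernel_const k01 l01.
(* The sign of [C] is unknown, while [D] below must be nonnegative: hence the absolute value. *)
exists (4 * C2 * `|C|) => p y w kappa lambda n u y0 adm npos upos.
rewrite ceil_le_int !ge_max !ler_int => /andP [/andP [k4 kk] kl] ll.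
set la := lambda_tilde y p kappa lambda.
rewrite -lerBrDl !ge_max lerBrDl => /andP [nE nn] /andP [/andP [uE uu] _] f M B fF X.
have yV0 : 0 < y^-1 by rewrite invr_gt0.
have adm' := lambda_tilde_admissible y adm.
have [s sE s12] : exists2 s : nat, n%:Z - w - kappa%:Z - iotap p y = s%:Z & 1 + iotap p 12 <= s%:Z.
  move: nE (iotap_ge0 p 12); move: (n%:Z) (kappa%:Z) (iotap p y) (iotap p 12); clear=> n a b c nE c0.
  exists (absz (n - w - a - b)%R); rewrite gez0_abs; lia.
have [u' u'E u'0] : exists2 u' : nat, u'%:Z = u%:Z - ordq p y - Num.ceil la + Num.floor lambda &
    u0 y^-1 p kappa la <= u'%:Z.
  have u0_gt0 : 0 < u0 y^-1 p kappa la by exact: Ju.1.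
  move: u0_gt0 uu; move: (u0 _ _ _ _) (ordq p y) (Num.ceil la) (Num.floor lambda) (u%:Z); clear=> a b c d u a0 uu.
  exists (absz (u - b - c + d)%R); rewrite gez0_abs; lia.
have u'pos : (0 < u')%N.
  have : 0 < u0 y^-1 p kappa la by exact: Ju.1.
  by move=> /lt_le_trans /(_ u'0).
have XE : X = (p ^ s)%N%:R by rewrite /X sE natrX.
rewrite XE => HB.
have X2 : (1 < p ^ s)%N.
  have s1 : (0 < s)%N by move: s12 (iotap_ge0 p 12); move: (iotap p 12); clear; lia.
  by rewrite -(exp1n s) ltn_exp2r // prime_gt1 // prime_valP.
have [E [E0 E1 E2 EC]] := kern_const _ X2.
have lnX0 : 0 < ln (p ^ s)%N%:R :> R by rewrite ln_gt0 // ltr1n.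
pose D := `|C| * p%:R `^ (r y^-1 p kappa la) * ln (p ^ s)%N%:R `^ delta.
have D0 : 0 <= D by rewrite !mulr_ge0 ?powR_ge0.
have Hf (f' : nat -> padic p) : classF (w + ordq p y) y^-1 kappa la u' f' ->
     forall (M' : int) (H : nat), (0 < H <= p ^ s)%N ->
     ComplexField.Normc.normc (\sum_(1 <= j < H.+1) padic_e R (pseries_eval R f' (M' + j%:Z)%:~R / p%:R ^+ n))
       <= D * ((p ^ s)%N%:R / H%:R) `^ k * H%:R `^ l.
  move=> f'F M' H /andP [H0 HX].
  (* The length X is the same for the dual sum, because iota'(1/y) = iota and ord y = iota' -
     iota. *)
  have X'E : n%:Z - (w + ordq p y) - kappa%:Z - iotap p y^-1 = s%:Z.
    by rewrite iotapV -sE -(iota_sub p y); ring.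
  have nn' : w + ordq p y + n0 y^-1 p kappa la <= n%:Z by rewrite -addrA -lerBrDl.
  (* The third entry of the new kappa_0 gives kappa - rho_p(y) >= lambda_0(1/y, p), which is what
     the minimum requires. *)
  have ll' : lambda0 y^-1 p <= la.
    by rewrite /la /lambda_tilde le_min ll andbT lerBrDr.
  have := datum p y^-1 (w + ordq p y) kappa la n u' yV0 adm' npos u'pos kk ll' nn' u'0 f' M' H%:R f'F.
  rewrite X'E (_ : p%:R ^ s%:Z = (p ^ s)%N%:R); last by rewrite natrX.
  rewrite natrK ltr0n H0 /= ler_nat HX => /(_ isT) /le_trans; apply.
  rewrite /D (_ : _ * _ * _ * _ * _ = C * (p%:R `^ (r y^-1 p kappa la) * ((p ^ s)%N%:R / H%:R) `^ k *
    H%:R `^ l * ln (p ^ s)%N%:R `^ delta)); last by ring.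
  rewrite (_ : _ * _ * _ * _ * _ = `|C| * (p%:R `^ (r y^-1 p kappa la) * ((p ^ s)%N%:R / H%:R) `^ k *
    H%:R `^ l * ln (p ^ s)%N%:R `^ delta)); last by ring.
  by rewrite ler_wpM2r ?mulr_ge0 ?powR_ge0 // ler_norm.
have yn0 : y != 0 by rewrite gt_eqF.
have := dual_bound M yn0 adm k4 sE s12 uE u'E fF k01 l01 D0 E0 E1 E2 Hf HB.
move=> /le_trans; apply; rewrite [ln _ `^ _]powRD; last by rewrite (gt_eqF lnX0) implybT.
have -> : 4 * C2 * `|C| * p%:R `^ (r y^-1 p kappa la) * ((p ^ s)%N%:R / B) `^ (l - 2^-1) *
    B `^ (k + 2^-1) * (ln (p ^ s)%N%:R `^ delta * ln (p ^ s)%N%:R `^ (if (k == 0) && (l == 1) then 1 else 0))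
  = 4 * (C2 * ln (p ^ s)%N%:R `^ (if (k == 0) && (l == 1) then 1 else 0)) * D *
    ((p ^ s)%N%:R / B) `^ (l - 2^-1) * B `^ (k + 2^-1) by rewrite /D; ring.
by rewrite !ler_wpM2r ?powR_ge0 // ler_wpM2l.
Qed.
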